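(* Let $A=K[a_1,\ldots,a_n]=\bigoplus_{p\in\mathbb{N}}A_p$ be an $\mathbb{N}$-graded solvable polynomial algebra with respect to a positive-degree function $d$, with a fixed admissible system $(\mathcal{B},\prec)$. Let $L_0=\bigoplus_{i=1}^sAe_i$ be the $\mathbb{N}$-graded free left $A$-module with $d_{\rm gr}(e_i)=b_i$, $1\le i\le s$, let $N=\sum_{i=1}^mA\xi_i$ be the graded submodule of $L_0$ generated by a set $U=\{\xi_1,\ldots,\xi_m\}$ of nonzero homogeneous elements, and let $M=L_0/N$. Then the graded $A$-module $M$ has a minimal graded free resolution of length $d\le n$: $$0\to L_d\xrightarrow{\varphi_d}\cdots\xrightarrow{\varphi_2}L_1\xrightarrow{\varphi_1}L_0\xrightarrow{\varphi_0}M\to0,$$ which can be constructed by implementing the following procedures (the algorithms and matrices named here are described in the context). Procedure 1. Run Algorithm-MINHGSQ with the initial input data $E=\{e_1,\ldots,e_s\}$ and $U=\{\xi_1,\ldots,\xi_m\}$ to compute a subset $E'=\{e_{i_1},\ldots,e_{i_{s'}}\}\subset\{e_1,\ldots,e_s\}$ and a subset $V=\{v_1,\ldots,v_t\}\subset N\cap L_0'$ such that $M\cong L_0'/N'$ as graded $A$-modules, where $L_0'=\bigoplus_{q=1}^{s'}Ae_{i_q}$ with $s'\le s$ and $N'=\sum_{k=1}^tAv_k$, and such that $\{\overline{e}_{i_1},\ldots,\overline{e}_{i_{s'}}\}$ is a minimal homogeneous generating set of $M$. For convenience, after accomplishing Procedure 1 one may assume $E=E'$, $U=V$ and $N=N'$;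 accordingly one has the short exact sequence $0\to N\to L_0\xrightarrow{\varphi_0}M\to0$ such that $\varphi_0(E)=\{\overline{e}_1,\ldots,\overline{e}_s\}$ is a minimal homogeneous generating set of $M$. Procedure 2. Choose a left monomial ordering $\prec_e$ on the $K$-basis $\mathcal{B}(e)$ of $L_0$ and run Algorithm-MINHGS with the initial input data $U=\{\xi_1,\ldots,\xi_m\}$ to compute a minimal homogeneous generating set $U_{\min}=\{\xi_{j_1},\ldots,\xi_{j_{s_1}}\}$ and a left Gröbner basis $\mathcal{G}$ for $N$; at the same time, by keeping track of the reductions during executing the first WHILE loop and the second WHILE loop respectively, return the matrices $\mathcal{S}_{r\times t}$ and $V_{t\times m}$. Procedure 3. By using the division by the left Gröbner basis $\mathcal{G}$ obtained in Procedure 2, compute the matrix $U_{m\times t}$. Use the matrices $\mathcal{S}_{r\times t}$, $V_{t\times m}$ obtained in Procedure 2, the matrix $U_{m\times t}$, and the matrix description of syzygy modules recalled in the context, to compute a homogeneous generating set of $N_1=\mathrm{Syz}(U_{\min})$ in the $\mathbb{N}$-graded free $A$-module $L_1=\bigoplus_{i=1}^{s_1}A\varepsilon_i$, where the gradation of $L_1$ is defined by setting $d_{\rm gr}(\varepsilon_k)=d_{\rm gr}(\xi_{j_k})$, $1\le k\le s_1$. Procedure 4. Construct the exact sequence $0\to N_1\to L_1\xrightarrow{\varphi_1}L_0\xrightarrow{\varphi_0}M\to0$, where $\varphi_1(\varepsilon_k)=\xi_{j_k}$, $1\le k\le s_1$. If $N_1\ne0$, then repeat Procedures 2--4 for $N_1$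 and so on. The desired minimal finite graded free resolution for $M$ is obtained after processing these procedures finitely many times.
   Context: $K$ is a field, $K^*=K\setminus\{0\}$, $\mathbb{N}$ is the set of nonnegative integers; algebras are associative unital $K$-algebras and modules are left modules. Solvable polynomial algebras. Let $A=K[a_1,\ldots,a_n]$ be a $K$-algebra generated by $a_1,\ldots,a_n$, no proper subset of which generates $A$. $A$ has the PBW $K$-basis $\mathcal{B}$ if $\mathcal{B}=\{a^\alpha=a_1^{\alpha_1}\cdots a_n^{\alpha_n}\mid\alpha\in\mathbb{N}^n\}$ is a $K$-basis of $A$. For a total ordering $\prec$ on $\mathcal{B}$, $\mathrm{LM}(f)$ is the $\prec$-largest basis element occurring in a nonzero $f\in A$ ($\mathrm{LM}(0)=0$), $\mathrm{LC}(f)$ is its coefficient. A monomial ordering on $\mathcal{B}$ is a total ordering $\prec$ such that: (1) $\prec$ is a well-ordering; (2) if $a^\gamma\ne1$, $a^\beta\ne a^\gamma$ and $a^\gamma=\mathrm{LM}(a^\alpha a^\beta a^\eta)$, then $a^\beta\prec a^\gamma$; (3) if $a^\alpha\prec a^\beta$, $\mathrm{LM}(a^\gamma a^\alpha a^\eta)\ne0$ and $\mathrm{LM}(a^\gamma a^\beta a^\eta)\notin\{0,1\}$, then $\mathrm{LM}(a^\gamma a^\alpha a^\eta)\prec\mathrm{LM}(a^\gamma a^\beta a^\eta)$. $A$ is a solvable polynomial algebra with admissible system $(\mathcal{B},\prec)$ if $\mathcal{B}$ is a $K$-basis, $\prec$ is a monomial ordering on $\mathcal{B}$, and for all $\alpha,\beta$,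 $a^\alpha a^\beta=\lambda_{\alpha,\beta}a^{\alpha+\beta}+f_{\alpha,\beta}$ with $\lambda_{\alpha,\beta}\in K^*$ and $f_{\alpha,\beta}=0$ or $\mathrm{LM}(f_{\alpha,\beta})\prec a^{\alpha+\beta}$. Grading. A positive-degree function $d$ on $A$ is given by positive integers $m_1,\ldots,m_n$: $d(a^\alpha)=\sum_im_i\alpha_i$. $A$ is an $\mathbb{N}$-graded solvable polynomial algebra with respect to $d$ if, with $A_p=K\text{-span}\{a^\alpha\mid d(a^\alpha)=p\}$, $A_pA_q\subseteq A_{p+q}$ for all $p,q$ (so $A_0=K$). For $L=\bigoplus_iAe_i$ and fixed $b_i\in\mathbb{N}$, the $\mathbb{N}$-graded free module with $d_{\rm gr}(e_i)=b_i$ has homogeneous parts $L_q=K\text{-span}\{a^\alpha e_i\mid d(a^\alpha)+b_i=q\}$; $d_{\rm gr}$ is the degree of a nonzero homogeneous element. A graded submodule is one generated by homogeneous elements; graded homomorphisms preserve degrees. A homogeneous generating set is minimal if no proper subset generates. $\overline{e}_i$ is the coset of $e_i$. Left Gröbner bases. $\mathcal{B}(e)=\{a^\alpha e_i\}$. A left monomial ordering $\prec_e$ on $\mathcal{B}(e)$ is a total ordering such that $a^\alpha e_i\prec_ea^\beta e_j$ implies $\mathrm{LM}(a^\gamma a^\alpha e_i)\prec_e\mathrm{LM}(a^\gamma a^\beta e_j)$ for all $a^\gamma\in\mathcal{B}$, and $a^\alpha\prec a^\beta$ implies $a^\alpha e_i\prec_ea^\beta e_i$; $\mathrm{LM}$,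 $\mathrm{LC}$, $\mathrm{LT}=\mathrm{LC}\cdot\mathrm{LM}$ on $L$ are taken with respect to $\prec_e$. A monomial $u$ of $L$ divides a monomial $w$ of $L$ if $w=\mathrm{LM}(a^\gamma u)$ for some $a^\gamma\in\mathcal{B}$. A set $\mathcal{G}$ of nonzero elements of a submodule $N$ is a left Gröbner basis of $N$ if for each nonzero $\xi\in N$ some $\mathrm{LM}(g)$, $g\in\mathcal{G}$, divides $\mathrm{LM}(\xi)$. Division. For a finite set $\Xi=\{\xi_1,\ldots,\xi_s\}$ of nonzero elements and $\xi\in L$, start with $q_1=\cdots=q_s=0$, $\eta=0$, $\omega=\xi$. While $\omega\ne0$: if there are $i$ and $a^{\alpha(i)}\in\mathcal{B}$ with $\mathrm{LM}(\omega)=\mathrm{LM}(a^{\alpha(i)}\mathrm{LM}(\xi_i))$, choose the least such $i$ and put $q_i:=q_i+\mathrm{LC}(\xi_i)^{-1}\mathrm{LC}(\omega)a^{\alpha(i)}$, $\omega:=\omega-\mathrm{LC}(\xi_i)^{-1}\mathrm{LC}(\omega)a^{\alpha(i)}\xi_i$; otherwise put $\eta:=\eta+\mathrm{LT}(\omega)$, $\omega:=\omega-\mathrm{LT}(\omega)$. Then $\xi=\sum q_i\xi_i+\eta$, and $\overline{\xi}^{\Xi}=\eta$ is the remainder. Left S-polynomial. If $\mathrm{LM}(\xi)=a^\alpha e_i$, $\mathrm{LM}(\zeta)=a^\beta e_j$, $\gamma_k=\max\{\alpha_k,\beta_k\}$, then $S_\ell(\xi,\zeta)=\frac{1}{\mathrm{LC}(a^{\gamma-\alpha}\xi)}a^{\gamma-\alpha}\xi-\frac{1}{\mathrm{LC}(a^{\gamma-\beta}\zeta)}a^{\gamma-\beta}\zeta$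 if $i=j$, and $0$ if $i\ne j$. Algorithm-MINHGSQ. Input: $E=\{e_1,\ldots,e_s\}$, $U=\{\xi_1,\ldots,\xi_m\}$ with $\xi_\ell=\sum_kf_{k\ell}e_k$, $f_{k\ell}$ homogeneous. Initialize $t:=m$, $V:=U$, $s':=s$, $E':=E$. While there is a $v_j=\sum_{k=1}^{s'}f_{kj}e_k\in V$ with $f_{kj}\notin K^*$ for $k<i$ and $f_{ij}\in K^*$: for $T=\{1,\ldots,j-1,j+1,\ldots,t\}$ compute $v_\ell'=v_\ell-\frac{1}{f_{ij}}f_{i\ell}v_j$ ($\ell\in T$) and $r=\#\{\ell\in T\mid v_\ell'=0\}$; put $t:=t-r-1$, $V:=\{v_\ell=v_\ell'\mid\ell\in T,\ v_\ell'\ne0\}=\{v_1,\ldots,v_t\}$ (after reordering), $s':=s'-1$, $E':=E'-\{e_i\}=\{e_1,\ldots,e_{s'}\}$ (after reordering). Output: $E'$ and $V$. Algorithm-MINHGS. Input: nonzero homogeneous $\xi_1,\ldots,\xi_m$ with $d_{\rm gr}(\xi_1)\le\cdots\le d_{\rm gr}(\xi_m)$, $U=\{\xi_1,\ldots,\xi_m\}$. Initialize $\mathcal{S}:=\emptyset$, $W:=U$, $\mathcal{G}:=\emptyset$, $t':=0$, $U_{\min}:=\emptyset$. Loop: let $p$ be the minimum of all $d_{\rm gr}(\xi_i)$, $\xi_i\in W$, and all $d_{\rm gr}(S_\ell(g_i,g_j))$, $S_\ell(g_i,g_j)\in\mathcal{S}$; let $\mathcal{S}_p$, $W_p$ be the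 sets of degree-$p$ members of $\mathcal{S}$, $W$; put $\mathcal{S}:=\mathcal{S}-\mathcal{S}_p$, $W:=W-W_p$. First WHILE loop: while $\mathcal{S}_p\ne\emptyset$, choose and remove any $S_\ell(g_i,g_j)$ from $\mathcal{S}_p$; if $\eta=\overline{S_\ell(g_i,g_j)}^{\mathcal{G}}\ne0$ with $\mathrm{LM}(\eta)=a^\rho e_k$, put $t':=t'+1$, $g_{t'}:=\eta$, add to $\mathcal{S}$ all nonzero $S_\ell(g_i,g_{t'})$ with $g_i\in\mathcal{G}$, $1\le i<t'$, $\mathrm{LM}(g_i)=a^\tau e_k$, and put $\mathcal{G}:=\mathcal{G}\cup\{g_{t'}\}$. Second WHILE loop: while $W_p\ne\emptyset$, choose and remove any $\xi_j$ from $W_p$; if $\eta=\overline{\xi_j}^{\mathcal{G}}\ne0$ with $\mathrm{LM}(\eta)=a^\rho e_k$, put $U_{\min}:=U_{\min}\cup\{\xi_j\}$ and then update $t'$, $g_{t'}$, $\mathcal{S}$, $\mathcal{G}$ exactly as in the first WHILE loop. Until $\mathcal{S}=\emptyset$. Output: $U_{\min}$ and $\mathcal{G}=\{g_1,\ldots,g_t\}$. Syzygies and matrices. For $W=\{w_1,\ldots,w_c\}$, $\mathrm{Syz}(W)=\{\sum_kh_k\omega_k\in\bigoplus_{k=1}^cA\omega_k\mid\sum_kh_kw_k=0\}$. Let $\mathcal{G}=\{g_1,\ldots,g_t\}$ be a left Gröbner basis of $N=\sum_{i=1}^mA\xi_i$, $U=\{\xi_1,\ldots,\xi_m\}$. $U_{m\times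 t}$ and $V_{t\times m}$ are matrices over $A$ with $(\xi_1,\ldots,\xi_m)^T=U_{m\times t}(g_1,\ldots,g_t)^T$ (obtained by division by $\mathcal{G}$) and $(g_1,\ldots,g_t)^T=V_{t\times m}(\xi_1,\ldots,\xi_m)^T$ (obtained by keeping track of the reductions in computing $\mathcal{G}$). For $i<j$ with $\mathrm{LM}(g_i)=a^{\alpha(i)}e_k$, $\mathrm{LM}(g_j)=a^{\alpha(j)}e_k$, $\gamma$ the componentwise maximum of $\alpha(i),\alpha(j)$, and $S_\ell(g_i,g_j)=\sum_lf_lg_l$ the representation obtained by division by $\mathcal{G}$, put $s_{ij}=\sum_lf_l\varepsilon_l-\frac{a^{\gamma-\alpha(i)}}{\mathrm{LC}(a^{\gamma-\alpha(i)}g_i)}\varepsilon_i+\frac{a^{\gamma-\alpha(j)}}{\mathrm{LC}(a^{\gamma-\alpha(j)}g_j)}\varepsilon_j$; these elements generate $\mathrm{Syz}(\mathcal{G})$. Writing them as $1\times t$ rows $\mathcal{S}_1,\ldots,\mathcal{S}_r$ gives the matrix $\mathcal{S}_{r\times t}$. The matrix description of syzygies: with $D_{(1)},\ldots,D_{(m)}$ the rows of $U_{m\times t}V_{t\times m}-E_{m\times m}$ ($E_{m\times m}$ the identity matrix), $\mathrm{Syz}(U)$ is generated by $\mathcal{S}_1V_{t\times m},\ldots,\mathcal{S}_rV_{t\times m},D_{(1)},\ldots,D_{(m)}$. A minimal graded free resolution of $M=L_0/N$ is an exact sequence $\cdots\to L_1\xrightarrow{\varphi_1}L_0\xrightarrow{\varphi_0}M\to0$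 in which each $L_i$ is an $\mathbb{N}$-graded free $A$-module with finite homogeneous $A$-basis $E_i$, each $\varphi_i$ is a graded homomorphism, $\varphi_0(E_0)$ is a minimal homogeneous generating set of $M$ with $\mathrm{Ker}\,\varphi_0=N$ (after the replacement made in Procedure 1), and for $i\ge1$, $\varphi_i(E_i)$ is a minimal homogeneous generating set of $\mathrm{Ker}\,\varphi_{i-1}$. It has length $d$ if $L_i=0$ for $i>d$.
   Formalization: The division multiplier is LC(a^{α(i)}ξ_i)^{-1}LC(ω)a^{α(i)} instead of LC(ξ_i)^{-1}LC(ω)a^{α(i)}, with which division need not end; Algorithm-MINHGS runs until both S and W are empty, as stopping at S=∅ can leave generators untreated. *)

(* Defs.v *)
(* The free left A-module with basis e_1, ..., e_s is 'rV[A]_s, e_i being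
   delta_mx 0 i and f *: x the action of f; left A-linear maps between such
   modules are the right multiplications by matrices over A. *)
From HB Require Import structures.
From mathcomp Require Import all_boot all_order all_algebra.
From mathcomp Require Import mpoly.
From Stdlib Require Import ClassicalEpsilon Relation_Operators.

Set Implicit Arguments.
Unset Strict Implicit.
Unset Printing Implicit Defensive.

Import GRing.Theory.
Local Open Scope ring_scope.
Local Open Scope quotient_scope.

Section Span.
Variables (R : nzRingType) (V : lmodType R).

Definition lspan k (g : 'I_k -> V) (J : {set 'I_k}) (x : V) : Prop :=
  exists c : 'I_k -> R, x = \sum_(i in J) c i *: g i.

Definition span (U : seq V) : V -> Prop := lspan (tnth (in_tuple U)) setT.

(* Families are indexed, so a repeated member already violates minimality. *)
Definition minimal_generators (N : V -> Prop) k (g : 'I_k -> V) : Prop :=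
  (forall x, N x <-> lspan g setT x) /\
  (forall J : {set 'I_k}, J \proper setT -> ~ (forall x, N x -> lspan g J x)).

Definition in_span (U : seq V) : {pred V} := fun x =>
  if excluded_middle_informative (span U x) then true else false.

Lemma in_spanP U x : reflect (span U x) (x \in in_span U).
Proof.
rewrite unfold_in; case: excluded_middle_informative => h; first exact: ReflectT.
exact: ReflectF.
Qed.

Fact in_span_closed U : subsemimod_closed (in_span U).
Proof.
split; first split.
- apply/in_spanP; exists (fun=> 0); rewrite big1 // => i _; exact: scale0r.
- move=> x y /in_spanP[c ->] /in_spanP[e ->]; apply/in_spanP.
  exists (fun i => c i + e i); rewrite -big_split /=.
  by apply: eq_bigr => i _; rewrite scalerDl.
move=> a x /in_spanP[c ->]; apply/in_spanP; exists (fun i => a * c i).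
by rewrite scaler_sumr; apply: eq_bigr => i _; rewrite scalerA.
Qed.

HB.instance Definition _ (U : seq V) :=
  GRing.isSubmodClosed.Build R V (in_span U) (in_span_closed U).

(* The quotient module V / span U. *)
Definition quotm (U : seq V) : Type := Quotient.quot (in_span U).

Section QuotientModule.
Variable U : seq V.
HB.instance Definition _ := GRing.Zmodule.on (quotm U).

Definition coset (x : V) : quotm U := \pi_(Quotient.quot (in_span U)) x.

Lemma coset_eq x y : (coset x = coset y) <-> span U (x - y).
Proof.
rewrite /coset; split.
- by move/eqP; rewrite -Quotient.idealrBE => /in_spanP.
- by move/in_spanP; rewrite Quotient.idealrBE => /eqP.
Qed.

Lemma cosetK (m : quotm U) : coset (repr m) = m.
Proof. exact: reprK. Qed.

Lemma cosetD : {morph coset : x y / x + y}.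
Proof. by move=> x y; rewrite /coset Quotient.pi_add. Qed.

Definition qscale (a : R) (m : quotm U) : quotm U := coset (a *: repr m).

Lemma qscaleE a x : qscale a (coset x) = coset (a *: x).
Proof.
apply/coset_eq; rewrite -scalerBr; apply/in_spanP; rewrite rpredZ //.
by apply/in_spanP/coset_eq; rewrite cosetK.
Qed.

Fact qscaleA a b m : qscale a (qscale b m) = qscale (a * b) m.
Proof. by rewrite -[m]cosetK !qscaleE scalerA. Qed.
Fact qscale1 : left_id 1 qscale.
Proof. by move=> m; rewrite -[m]cosetK qscaleE scale1r. Qed.
Fact qscaleDr : right_distributive qscale +%R.
Proof.
by move=> a m k; rewrite -[m]cosetK -[k]cosetK -cosetD !qscaleE scalerDr cosetD.
Qed.
Fact qscaleDl m : {morph qscale^~ m : a b / a + b}.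
Proof. by move=> a b; rewrite -[m]cosetK !qscaleE scalerDl cosetD. Qed.

HB.instance Definition _ := GRing.Zmodule_isLmodule.Build R (quotm U)
  qscaleA qscale1 qscaleDr qscaleDl.

Fact coset_linear : linear coset.
Proof. by move=> a x y; rewrite cosetD -qscaleE. Qed.

HB.instance Definition _ :=
  GRing.isLinear.Build R V (quotm U) _ coset coset_linear.
End QuotientModule.
End Span.


Section SolvablePolynomialAlgebra.
Variables (K : fieldType) (n : nat) (A : algType K) (a : 'I_n -> A).
Implicit Types (al be ga et mu nu : 'X_{1..n}) (f : A) (s : nat).

Inductive generated (J : {set 'I_n}) : A -> Prop :=
| Gen_scalar (c : K) : generated J c%:A
| Gen_var i : i \in J -> generated J (a i)
| Gen_add f g : generated J f -> generated J g -> generated J (f + g)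
| Gen_mul f g : generated J f -> generated J g -> generated J (f * g).

Definition minimally_generated : Prop :=
  (forall f, generated setT f) /\
  (forall J : {set 'I_n}, J \proper setT -> exists f, ~ generated J f).

(* a^al = a_1^al_1 ... a_n^al_n, the product being taken in this order. *)
Definition mon al : A := \prod_(i < n) a i ^+ al i.

(* {mpoly K[n]} only serves as the type of finitely supported functions from
   exponent vectors to K; its product is not that of A. *)
Definition lincomb (p : {mpoly K[n]}) : A := \sum_(al <- msupp p) p@_al *: mon al.

Definition pbw_basis : Prop := forall f, exists! p, lincomb p = f.

(* The coordinates of f in the PBW basis. *)
Definition crd f : {mpoly K[n]} := epsilon (inhabits 0) (fun p => lincomb p = f).

(* The lt-largest member of r; None plays the part of the leading monomial 0. *)
Definition lead (T : eqType) (lt : rel T) (r : seq T) : option T :=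
  ohead [seq u <- r | all (fun w => (w == u) || lt w u) r].

Definition strict_total (T : eqType) (lt : rel T) : Prop :=
  [/\ irreflexive lt, transitive lt & forall x y, x != y -> lt x y || lt y x].

Section Ordering.
Variable lt : rel 'X_{1..n}.

(* The exponent of LM(f). *)
Definition LMA f : option 'X_{1..n} := lead lt (msupp (crd f)).

Definition monomial_ordering : Prop :=
  [/\ strict_total lt,
      well_founded (fun al be => lt al be : Prop),
      (forall al be et ga, ga <> 0%MM -> be <> ga ->
         LMA (mon al * mon be * mon et) = Some ga -> lt be ga)
    & (forall al be ga et mu nu, lt al be ->
         LMA (mon ga * mon al * mon et) = Some mu ->
         LMA (mon ga * mon be * mon et) = Some nu -> nu <> 0%MM -> lt mu nu)].

Definition solvable_products : Prop := forall al be,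
  exists lam : K, exists f,
    [/\ lam != 0, mon al * mon be = lam *: mon (al + be)%MM + f
      & f = 0 \/ exists2 mu, LMA f = Some mu & lt mu (al + be)%MM].

Definition solvable_polynomial_algebra : Prop :=
  [/\ minimally_generated, pbw_basis, monomial_ordering & solvable_products].
End Ordering.

Section Grading.
Variable wt : 'I_n -> nat.

Definition wdeg al : nat := (\sum_(i < n) wt i * al i)%N.

Definition homogA p f : bool := all (fun al => wdeg al == p) (msupp (crd f)).

Definition graded_algebra : Prop :=
  (forall i, 0 < wt i)%N /\
  (forall p q f g, homogA p f -> homogA q g -> homogA (p + q)%N (f * g)).

Section FreeModule.
Variable s : nat.
Implicit Types x y : 'rV[A]_s.

(* (al, i) stands for the monomial a^al e_i of L. *)
Definition bmon (u : 'X_{1..n} * 'I_s) : 'rV[A]_s := mon u.1 *: delta_mx 0 u.2.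

Definition supp x : seq ('X_{1..n} * 'I_s) :=
  [seq (al, i) | i <- enum 'I_s, al <- msupp (crd (x 0 i))].

Variable b : 'I_s -> nat.

Definition homogL q x : bool := all (fun u => wdeg u.1 + b u.2 == q)%N (supp x).

(* The degree of x when x is nonzero and homogeneous. *)
Definition dgr x : nat := (\max_(u <- supp x) (wdeg u.1 + b u.2))%N.

Definition nz_homog x : Prop := x != 0 /\ exists q, homogL q x.
End FreeModule.
Arguments supp {s} x.
Arguments bmon {s} u.

Section Groebner.
Variables (lt : rel 'X_{1..n}) (s : nat) (lte : rel ('X_{1..n} * 'I_s)).
Implicit Types x y : 'rV[A]_s.

Definition LM x : option ('X_{1..n} * 'I_s) := lead lte (supp x).
Definition LC x : K := if LM x is Some u then (crd (x 0 u.2))@_(u.1) else 0.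
(* LM(x) as an element of L. *)
Definition LMv x : 'rV[A]_s := if LM x is Some u then bmon u else 0.
Definition LT x : 'rV[A]_s := (LC x)%:A *: LMv x.

Definition left_monomial_ordering : Prop :=
  [/\ strict_total lte,
      (forall ga u w u' w', lte u w -> LM (mon ga *: bmon u) = Some u' ->
         LM (mon ga *: bmon w) = Some w' -> lte u' w')
    & (forall al be i, lt al be -> lte (al, i) (be, i))].

Definition left_groebner (N : 'rV[A]_s -> Prop) (G : seq 'rV[A]_s) : Prop :=
  (forall g, g \in G -> g != 0 /\ N g) /\
  (forall x, N x -> x != 0 ->
     exists2 g, g \in G & exists ga, LM (mon ga *: LMv g) = LM x).

(* [division_loop Xi q eta omega q' eta']: started in the state
   (q, eta, omega), the division by Xi ends with quotients q' and remainder
   eta'.  The multiplier is LC(omega) / LC(a^al xi_i), which is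
   LC(omega) / LC(xi_i) when the product a^al LM(xi_i) has leading coefficient
   1; it is what makes the leading term of omega cancel in general. *)
Inductive division_loop (Xi : seq 'rV[A]_s) :
    'rV[A]_(size Xi) -> 'rV[A]_s -> 'rV[A]_s ->
    'rV[A]_(size Xi) -> 'rV[A]_s -> Prop :=
| Div_stop q eta : division_loop q eta 0 q eta
| Div_reduce q eta omega (i : 'I_(size Xi)) al q' eta' :
    omega != 0 ->
    LM (mon al *: LMv Xi`_i) = LM omega ->
    (forall (j : 'I_(size Xi)) be, (j < i)%N ->
       LM (mon be *: LMv Xi`_j) <> LM omega) ->
    let h := ((LC (mon al *: Xi`_i))^-1 * LC omega) *: mon al in
    division_loop (q + h *: delta_mx 0 i) eta (omega - h *: Xi`_i) q' eta' ->
    division_loop q eta omega q' eta'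
| Div_move q eta omega q' eta' :
    omega != 0 ->
    (forall (j : 'I_(size Xi)) be, LM (mon be *: LMv Xi`_j) <> LM omega) ->
    division_loop q (eta + LT omega) (omega - LT omega) q' eta' ->
    division_loop q eta omega q' eta'.

Definition division (Xi : seq 'rV[A]_s) x (q : 'rV[A]_(size Xi)) eta : Prop :=
  division_loop 0 0 x q eta.

Definition same_component x y : bool :=
  if (LM x, LM y) is (Some u, Some w) then u.2 == w.2 else false.

(* The multiplier a^(ga - al) / LC(a^(ga - al) x) of x in S_l(x, y). *)
Definition scoef x y : A :=
  if (LM x, LM y) is (Some u, Some w) then
    let de := (mlcm u.1 w.1 - u.1)%MM in (LC (mon de *: x))^-1 *: mon de
  else 0.

Definition spoly x y : 'rV[A]_s :=
  if same_component x y then scoef x y *: x - scoef y x *: y else 0.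
End Groebner.
Arguments division {s} lte Xi x q eta.

Section MINHGSQ.
Variable s : nat.

Definition inKstar f : Prop := exists2 c : K, c != 0 & f = c%:A.

(* A state consists of the remaining basis elements, as the list of their
   indices, and of the current generators. *)
Inductive hgsq_step :
    seq 'I_s * seq 'rV[A]_s -> seq 'I_s * seq 'rV[A]_s -> Prop :=
| Hgsq_step (E1 E2 E' : seq 'I_s) i (V1 V2 V' : seq 'rV[A]_s)
    (v : 'rV[A]_s) (c : K) :
    (forall k, k \in E1 -> ~ inKstar (v 0 k)) ->
    c != 0 -> v 0 i = c%:A ->
    perm_eq E' (E1 ++ E2) ->
    perm_eq V' [seq x <- [seq w - (c^-1 *: w 0 i) *: v | w : 'rV[A]_s <- V1 ++ V2]
                  | x != 0] ->
    hgsq_step (E1 ++ i :: E2, V1 ++ v :: V2) (E', V').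

Definition hgsq_init (U : seq 'rV[A]_s) : seq 'I_s * seq 'rV[A]_s :=
  (enum 'I_s, U).

Definition hgsq_final (st : seq 'I_s * seq 'rV[A]_s) : Prop :=
  forall v i, v \in st.2 -> i \in st.1 -> ~ inKstar (v 0 i).
End MINHGSQ.

Section MINHGS.
Variables (s : nat) (b : 'I_s -> nat) (lte : rel ('X_{1..n} * 'I_s)).
Variable U : seq 'rV[A]_s.

(* The members of S and S_p are pairs (i, j) of positions in hG, standing for
   S_l(g_i, g_j); those of W, W_p and U_min are positions in U.  The l-th row
   of hV expresses the l-th member of hG through U, and hQ records, for each
   treated pair (i, j), the coefficients of S_l(g_i, g_j) on hG found by the
   reduction, a nonzero remainder being the new member of hG. *)
Record hgs_state := HgsState {
  hS : seq (nat * nat);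
  hW : seq 'I_(size U);
  hSp : seq (nat * nat);
  hWp : seq 'I_(size U);
  hG : seq 'rV[A]_s;
  hV : seq 'rV[A]_(size U);
  hQ : seq ((nat * nat) * seq A);
  hmin : seq 'I_(size U) }.

Definition hgs_init : hgs_state :=
  HgsState [::] (enum 'I_(size U)) [::] [::] [::] [::] [::] [::].

(* The loop runs until both S and W are exhausted. *)
Definition hgs_final (st : hgs_state) : Prop :=
  [/\ hS st = [::], hW st = [::], hSp st = [::] & hWp st = [::]].

Definition pair_spoly (G : seq 'rV[A]_s) (ij : nat * nat) : 'rV[A]_s :=
  spoly lte G`_(ij.1) G`_(ij.2).

Definition new_pairs (G : seq 'rV[A]_s) (eta : 'rV[A]_s) : seq (nat * nat) :=
  [seq (i, size G) | i <- iota 0 (size G)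
     & same_component lte G`_i eta && (spoly lte G`_i eta != 0)].

Definition lift_quot (G : seq 'rV[A]_s) (V : seq 'rV[A]_(size U))
    (q : 'rV[A]_(size G)) : 'rV[A]_(size U) :=
  \sum_(l < size G) q 0 l *: V`_l.

Definition row_seq m (q : 'rV[A]_m) : seq A := [seq q 0 l | l <- enum 'I_m].

Implicit Types (S Sp : seq (nat * nat)) (W Wp M : seq 'I_(size U))
  (G : seq 'rV[A]_s) (V : seq 'rV[A]_(size U))
  (T : seq ((nat * nat) * seq A)) (j : 'I_(size U)).

Inductive hgs_step : hgs_state -> hgs_state -> Prop :=
| Hgs_select S W G V T M p :
    let degs := [seq dgr b (pair_spoly G ij) | ij <- S] ++
                [seq dgr b U`_j | j : 'I_(size U) <- W] in
    p \in degs -> all (leq p) degs ->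
    hgs_step (HgsState S W [::] [::] G V T M)
      (HgsState [seq ij <- S | dgr b (pair_spoly G ij) != p]
                [seq j : 'I_(size U) <- W | dgr b U`_j != p]
                [seq ij <- S | dgr b (pair_spoly G ij) == p]
                [seq j : 'I_(size U) <- W | dgr b U`_j == p] G V T M)
| Hgs_spair_zero S W Sp Wp G V T M ij q :
    ij \in Sp -> division lte G (pair_spoly G ij) q 0 ->
    hgs_step (HgsState S W Sp Wp G V T M)
      (HgsState S W (rem ij Sp) Wp G V (rcons T (ij, row_seq q)) M)
| Hgs_spair_new S W Sp Wp G V T M ij q eta :
    ij \in Sp -> division lte G (pair_spoly G ij) q eta -> eta != 0 ->
    let gi := G`_(ij.1) in let gj := G`_(ij.2) in
    hgs_step (HgsState S W Sp Wp G V T M)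
      (HgsState (S ++ new_pairs G eta) W (rem ij Sp) Wp (rcons G eta)
        (rcons V (scoef lte gi gj *: V`_(ij.1) - scoef lte gj gi *: V`_(ij.2)
                  - lift_quot V q))
        (rcons T (ij, rcons (row_seq q) 1)) M)
| Hgs_gen_zero S W Wp G V T M j q :
    j \in Wp -> division lte G U`_j q 0 ->
    hgs_step (HgsState S W [::] Wp G V T M) (HgsState S W [::] (rem j Wp) G V T M)
| Hgs_gen_new S W Wp G V T M j q eta :
    j \in Wp -> division lte G U`_j q eta -> eta != 0 ->
    hgs_step (HgsState S W [::] Wp G V T M)
      (HgsState (S ++ new_pairs G eta) W [::] (rem j Wp) (rcons G eta)
        (rcons V (delta_mx 0 j - lift_quot V q)) T (rcons M j)).

Section Output.
Variable o : hgs_state.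

Definition Umin (k : 'I_(size (hmin o))) : 'rV[A]_s :=
  U`_(tnth (in_tuple (hmin o)) k).
Definition Umin_mx : 'M[A]_(size (hmin o), s) := \matrix_k Umin k.
Definition Umx : 'M[A]_(size U, s) := \matrix_(j < size U) U`_j.
Definition Gmx : 'M[A]_(size (hG o), s) := \matrix_(l < size (hG o)) (hG o)`_l.
(* V_{t x m} *)
Definition Vmx : 'M[A]_(size (hG o), size U) :=
  \matrix_(l < size (hG o)) (hV o)`_l.

Definition Umin_dgr (k : 'I_(size (hmin o))) : nat := dgr b (Umin k).

Definition critical_pairs : seq ('I_(size (hG o)) * 'I_(size (hG o))) :=
  [seq ij : 'I_(size (hG o)) * 'I_(size (hG o)) <- enum predT
     | (ij.1 < ij.2)%N && same_component lte (hG o)`_(ij.1) (hG o)`_(ij.2)].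

(* The recorded representation of S_l(g_i, g_j); pairs with S_l(g_i, g_j) = 0
   have not been treated and get the row 0. *)
Definition spair_quot (ij : 'I_(size (hG o)) * 'I_(size (hG o))) :
    'rV[A]_(size (hG o)) :=
  \row_l
    if [seq e.2 | e <- hQ o & e.1 == (val ij.1, val ij.2)] is r :: _
    then r`_l else 0.

Definition srow (ij : 'I_(size (hG o)) * 'I_(size (hG o))) :=
  let gi := (hG o)`_(ij.1) in let gj := (hG o)`_(ij.2) in
  spair_quot ij - scoef lte gi gj *: delta_mx 0 ij.1
                + scoef lte gj gi *: delta_mx 0 ij.2.

Definition Smx : 'M[A]_(size critical_pairs, size (hG o)) :=
  \matrix_(r < size critical_pairs) srow (tnth (in_tuple critical_pairs) r).

Section Matrices.
(* Q stands for U_{m x t}. *)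
Variable Q : 'M[A]_(size U, size (hG o)).

Definition division_matrix : Prop :=
  forall j : 'I_(size U), division lte (hG o) U`_j (row j Q) 0.

(* The matrix description of Syz(U_min): the rows of U_{m x t} and the columns
   of V_{t x m} are restricted to the members of U_min. *)
Definition Vmin : 'M[A]_(size (hG o), size (hmin o)) :=
  colsub (tnth (in_tuple (hmin o))) Vmx.
Definition Qmin : 'M[A]_(size (hmin o), size (hG o)) :=
  rowsub (tnth (in_tuple (hmin o))) Q.
Definition syzygy_rows : seq 'rV[A]_(size (hmin o)) :=
  [seq row r (Smx *m Vmin) | r <- enum 'I_(size critical_pairs)] ++
  [seq row k (Qmin *m Vmin - 1%:M) | k <- enum 'I_(size (hmin o))].
Definition syzygy_gens : seq 'rV[A]_(size (hmin o)) :=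
  [seq x <- syzygy_rows | x != 0].
End Matrices.
End Output.
End MINHGS.

(* Every run of the nondeterministic program [step] from [x] is finite, and
   none gets stuck before reaching a final state. *)
Definition terminates T (step : T -> T -> Prop) (final : T -> Prop) (x : T) :=
  Acc (fun y z => step z y) x /\
  (forall y, clos_refl_trans T step x y -> final y \/ exists z, step y z).

Definition outputs T (step : T -> T -> Prop) (final : T -> Prop) (x y : T) :=
  clos_refl_trans T step x y /\ final y.

(* A free module with degrees of its basis and generators of a submodule. *)
Record stage := Stage { rk : nat; dg : 'I_rk -> nat; gens : seq 'rV[A]_rk }.

Section Procedures.
Variable lt : rel 'X_{1..n}.

Section Procedure1.
Variables (s : nat) (b : 'I_s -> nat) (U : seq 'rV[A]_s).

Definition qhomog q (m : quotm U) : Prop := exists2 x, homogL b q x & coset U x = m.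

Variables (E : seq 'I_s) (V : seq 'rV[A]_s).

(* The inclusion of L_0' in L_0, in coordinates. *)
Definition basis_mx : 'M[A]_(size E, s) :=
  \matrix_(q < size E) delta_mx 0 (tnth (in_tuple E) q).

Definition stage1 : stage :=
  Stage (fun q : 'I_(size E) => b (tnth (in_tuple E) q))
        [seq colsub (tnth (in_tuple E)) v | v <- V].

Definition phi0 : {linear 'rV[A]_(size E) -> quotm U} :=
  coset U \o mulmxr basis_mx.
End Procedure1.

(* One round of Procedures 2-4, with the matrix of the new differential. *)
Inductive round (X : stage) : forall Y : stage, 'M[A]_(rk Y, rk X) -> Prop :=
| Round lte U (o : hgs_state U) Q :
    left_monomial_ordering lt lte ->
    perm_eq U (gens X) -> sorted (relpre (dgr (@dg X)) leq) U ->
    outputs (hgs_step (@dg X) lte (U := U)) (@hgs_final _ U) (hgs_init U) o ->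
    division_matrix lte Q ->
    @round X (Stage (Umin_dgr (@dg X) (o := o)) (syzygy_gens lte Q))
           (Umin_mx o).

Inductive reachable (X : stage) : stage -> Prop :=
| Reach_refl : reachable X X
| Reach_round Y Z (F : 'M[A]_(rk Z, rk Y)) :
    reachable X Y -> gens Y <> [::] -> round F -> reachable X Z.

(* A complete run, continued by zero modules once N_i = 0. *)
Definition run (X : nat -> stage) (F : forall i, 'M[A]_(rk (X i.+1), rk (X i))) :=
  forall i, if gens (X i) is [::] then rk (X i.+1) = 0%N /\ gens (X i.+1) = [::]
            else round (F i).

Definition stage_seq (X0 : stage) (Xs : nat -> stage) (i : nat) : stage :=
  if i is j.+1 then Xs j else X0.
End Procedures.

Section Resolution.
Variables (M : lmodType A) (Mhomog : nat -> M -> Prop).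
Variables (r : nat -> nat) (e : forall i, 'I_(r i) -> nat).
Variables (f0 : {linear 'rV[A]_(r 0%N) -> M})
  (f : forall i, {linear 'rV[A]_(r i.+1) -> 'rV[A]_(r i)}).

Definition res_exact : Prop :=
  [/\ forall m, exists x, f0 x = m,
      forall x, f0 x = 0 <-> exists y, f 0%N y = x
    & forall i x, f i x = 0 <-> exists y, f i.+1 y = x].

Definition res_graded : Prop :=
  (forall q x, homogL (@e 0%N) q x -> Mhomog q (f0 x)) /\
  (forall i q x, homogL (@e i.+1) q x -> homogL (@e i) q (f i x)).

Definition res_minimal : Prop :=
  [/\ minimal_generators (fun=> True) (fun k : 'I_(r 0%N) => f0 (delta_mx 0 k)),
      minimal_generators (fun x => f0 x = 0)
        (fun k : 'I_(r 1%N) => f 0%N (delta_mx 0 k))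
    & forall i, minimal_generators (fun x => f i x = 0)
        (fun k : 'I_(r i.+2) => f i.+1 (delta_mx 0 k))].

(* The degrees of f0(e_k) and f_i(e_k) are prescribed by [res_graded]. *)
Definition minimal_graded_resolution : Prop :=
  [/\ res_exact, res_graded & res_minimal].

Definition res_length d : Prop := forall i, (d < i)%N -> r i = 0%N.
End Resolution.

Section Claims.
Variable lt : rel 'X_{1..n}.

Section Claim1.
Variables (s : nat) (b : 'I_s -> nat) (U : seq 'rV[A]_s).

Definition procedure1_claim (E : seq 'I_s) (V : seq 'rV[A]_s) : Prop :=
  let X := stage1 b E V in
  [/\ uniq E,
      forall v, v \in V -> span U v /\ (forall i, i \notin E -> v 0 i = 0),
      forall v, v \in gens X -> nz_homog (@dg X) v,
      (exists th : {linear quotm (gens X) -> quotm U}, bijective th /\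
         forall q m, qhomog (@dg X) q m <-> qhomog b q (th m))
    & minimal_generators (fun=> True)
        (fun q => coset U (delta_mx 0 (tnth (in_tuple E) q))) /\
      (forall m, exists x, phi0 U E x = m) /\
      (forall x, phi0 U E x = 0 <-> span (gens X) x)].
End Claim1.

(* The last two clauses state that V_{t x m}, and the quotients entering
   S_{r x t}, recorded during the computation, are those of the definition. *)
Definition procedure2_claim (X : stage) lte (U : seq 'rV[A]_(rk X))
    (o : hgs_state U) : Prop :=
  [/\ minimal_generators (span (gens X)) (Umin (o := o)),
      forall k, exists q, homogL (@dg X) q (Umin (o := o) k),
      left_groebner lte (span (gens X)) (hG o),
      Gmx o = Vmx o *m Umx U
    & forall ij, ij \in critical_pairs lte o ->
        division lte (hG o) (spoly lte (hG o)`_(ij.1) (hG o)`_(ij.2))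
          (spair_quot ij) 0].

Definition syz s c (w : 'I_c -> 'rV[A]_s) (h : 'rV[A]_c) : Prop :=
  \sum_(k < c) h 0 k *: w k = 0.

Definition procedure3_claim (X : stage) lte (U : seq 'rV[A]_(rk X))
    (o : hgs_state U) Q : Prop :=
  [/\ Umx U = Q *m Gmx o,
      forall x, x \in syzygy_gens lte Q ->
        nz_homog (Umin_dgr (@dg X) (o := o)) x
    & forall x, syz (Umin (o := o)) x <-> span (syzygy_gens lte Q) x].

(* With phi_1 the right multiplication by Umin_mx: Ker phi_1 = N_1, and the
   image of phi_1 is N, the kernel of the preceding map. *)
Definition procedure4_claim (X : stage) lte (U : seq 'rV[A]_(rk X))
    (o : hgs_state U) Q : Prop :=
  (forall x : 'rV_(size (hmin o)),
     x *m Umin_mx o = 0 <-> span (syzygy_gens lte Q) x) /\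
  (forall x, span (gens X) x <-> exists y, y *m Umin_mx o = x).

(* Procedures 2-4 applied to N = span (gens X), for any choice of the left
   monomial ordering and of the order in which equal degrees are listed. *)
Definition procedures234_claim (X : stage) : Prop :=
  (exists lte, left_monomial_ordering lt (s := rk X) lte) /\
  (forall lte (U : seq 'rV[A]_(rk X)),
     left_monomial_ordering lt lte ->
     perm_eq U (gens X) -> sorted (relpre (dgr (@dg X)) leq) U ->
     let step := hgs_step (@dg X) lte (U := U) in
     terminates step (@hgs_final _ U) (hgs_init U) /\
     forall o, outputs step (@hgs_final _ U) (hgs_init U) o ->
       [/\ procedure2_claim lte o,
           exists Q, division_matrix lte (o := o) Q
         & forall Q, division_matrix lte (o := o) Q ->
             procedure3_claim lte Q /\ procedure4_claim lte Q]).

End Claims.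
End Grading.
End SolvablePolynomialAlgebra.

(* Main.v *)
(* Let eps : A -> K be reduction modulo A_+, a ring morphism because A is graded
   with A_0 = K.  A set of homogeneous generators is minimal as soon as all its
   syzygies vanish under eps.  In Algorithm-MINHGS every syzygy produced lies in
   a degree larger than that of the members of U_min it involves, because the
   critical pairs of degree p are treated before the generators of degree p.

   The length bound comes from a second resolution.  In Schreyer's ordering, the
   leading monomials of the syzygies of a suitably sorted Groebner basis avoid
   one variable more than those of the basis itself; this yields a free
   resolution of length at most n.  A chain homotopy equivalence between it and
   the minimal resolution, read modulo A_+, where the differentials of the
   latter vanish, bounds the ranks of the latter. *)
From HB Require Import structures.
Require Import Defs.
From mathcomp Require Import all_boot all_order all_algebra.
From mathcomp Require Import mpoly.
From Stdlib Require Import Classical ClassicalEpsilon Relation_Operators.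

Set Implicit Arguments.
Unset Strict Implicit.
Unset Printing Implicit Defensive.

Import GRing.Theory.
Local Open Scope ring_scope.

(** * Coordinates and leading monomials *)

(** What Algorithm-MINHGS records refers to the basis at the time of recording, while the matrices
    refer to the final one. The division is therefore studied under appending to its list: by the
    least-index rule earlier members act first, so a division with remainder 0 only gets padded
    quotients, and one with remainder eta becomes, once eta is appended, a division with remainder 0
    and quotient 1 at the new place. As the division is deterministic, the quotients of a member of
    U_min by the final basis lift back to a unit row. Hence the rows D_(k) formed for U_min vanish,
    the rows of critical pairs alone generate the syzygies, and only these have to be examined under
    eps.

    The bound n, not n + 1, comes from the last variable: leading monomials in one variable can be
    thinned out to one per component, and such a basis is free. Of the homotopy equivalence only one
    composite is used, on the side of the minimal resolution, and its relation is required only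
    after composition with a differential. It holds trivially at the start, since both resolutions
    cover the same submodule N of L_0. *)

Section Lead.
Variables (T : eqType) (r : rel T).
Hypothesis rP : strict_total r.

(** Two distinct members surviving the filter would lie below each other, so the head of the
    filtered list does not depend on the order of [q]. *)
Lemma leadP (q : seq T) (u : T) :
  lead r q = Some u <-> u \in q /\ (forall w, w \in q -> w = u \/ r w u).
Proof.
have maxE v : v \in [seq u <- q | all (fun w => (w == u) || r w u) q] <->
    v \in q /\ (forall w, w \in q -> w = v \/ r w v).
  rewrite mem_filter; split.
    by case/andP=> /allP h vq; split=> // w /h /orP[/eqP|]; [left|right].
  case=> vq h; rewrite vq andbT; apply/allP=> w /h [->|->]; first by rewrite eqxx.
  by rewrite orbT.
have [irr tr _] := rP.
rewrite /lead; split.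
  move=> h; apply/maxE; move: h.
  by case: [seq _ <- _ | _] => //= v p [->]; rewrite inE eqxx.
move=> h; have := h; move/maxE.
case E: [seq _ <- _ | _] => [|v p] //= _.
have /maxE[vq hv] : v \in [seq u <- q | all (fun w => (w == u) || r w u) q].
  by rewrite E inE eqxx.
case: h => uq hu; congr Some; case: (hu v vq) => // rvu; case: (hv u uq) => // ruv.
by have := tr _ _ _ rvu ruv; rewrite irr.
Qed.

Lemma lead_None (q : seq T) : lead r q = None <-> q = [::].
Proof.
have [irr tr tot] := rP.
split; last by move=> ->.
suff ex : q <> [::] -> exists u, u \in q /\ (forall w, w \in q -> w = u \/ r w u).
  case: q ex => // v q /(_ _)[] // u /leadP ->; done.
elim: q => // v [|v' q] IH _.
  by exists v; rewrite inE eqxx; split=> // w; rewrite inE => /eqP; left.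
have [//|u [uq hu]] := IH.
case: (eqVneq v u) => [e|ne].
  exists u; split; first by rewrite inE uq orbT.
  by move=> w; rewrite inE => /orP[/eqP->|/hu //]; left.
case/orP: (tot _ _ ne) => h.
  exists u; split; first by rewrite inE uq orbT.
  by move=> w; rewrite inE => /orP[/eqP->|/hu //]; right.
exists v; split; first by rewrite inE eqxx.
move=> w; rewrite inE => /orP[/eqP->|/hu [->|wu]]; [by left|by right|].
by right; apply: tr h.
Qed.
End Lead.

Section PBW.
Variables (K : fieldType) (n : nat) (A : algType K) (a : 'I_n -> A).
Hypothesis pbwA : pbw_basis a.

(** Padding with zero coefficients lets combinations with different supports be added termwise. *)
Lemma lincomb_superset (s : seq 'X_{1..n}) (p : {mpoly K[n]}) : uniq s ->
  {subset msupp p <= s} -> lincomb a p = \sum_(al <- s) p@_al *: mon a al.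
Proof.
move=> us sub; rewrite /lincomb [RHS](bigID (mem (msupp p))) /=.
rewrite [X in _ + X]big1 ?addr0; last first.
  by move=> al; rewrite -mcoeff_eq0 => /eqP ->; rewrite scale0r.
rewrite -[RHS]big_filter; apply: perm_big; apply: uniq_perm.
- exact: msupp_uniq.
- exact: filter_uniq.
by move=> al; rewrite mem_filter; case h: (al \in msupp p) => //=; rewrite sub.
Qed.

Lemma lincombZD (c : K) (p q : {mpoly K[n]}) :
  lincomb a (c *: p + q) = c *: lincomb a p + lincomb a q.
Proof.
pose s := undup (msupp p ++ msupp q ++ msupp (c *: p + q)).
rewrite !(@lincomb_superset s) ?undup_uniq //.
- rewrite scaler_sumr -big_split /=; apply: eq_bigr => al _.
  by rewrite mcoeffD mcoeffZ scalerDl scalerA.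
- by move=> al h; rewrite mem_undup !mem_cat h orbT.
- by move=> al h; rewrite mem_undup !mem_cat h.
- by move=> al h; rewrite mem_undup !mem_cat h !orbT.
Qed.

Lemma crdK : cancel (crd a) (lincomb a).
Proof.
move=> f; have [p [hp _]] := pbwA f.
exact: (epsilon_spec (inhabits 0) (fun p => lincomb a p = f) (ex_intro _ p hp)).
Qed.

Lemma lincombK : cancel (lincomb a) (crd a).
Proof.
move=> p; have [q [hq uq]] := pbwA (lincomb a p).
by rewrite -(uq _ (crdK _)) (uq p).
Qed.

Lemma crdZD c f g : crd a (c *: f + g) = c *: crd a f + crd a g.
Proof.
by apply: (can_inj lincombK); rewrite lincombZD !crdK.
Qed.

Lemma crd0 : crd a 0 = 0.
Proof.
apply: (can_inj lincombK); rewrite crdK /lincomb big1 // => al _.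
by rewrite mcoeff0 scale0r.
Qed.

Lemma crdD f g : crd a (f + g) = crd a f + crd a g.
Proof. by rewrite -[f]scale1r crdZD !scale1r. Qed.

Lemma crdZ c f : crd a (c *: f) = c *: crd a f.
Proof. by rewrite -[c *: f]addr0 crdZD crd0 addr0. Qed.

Lemma crd_mon al : crd a (mon a al) = 'X_[al].
Proof.
apply: (can_inj lincombK); rewrite crdK /lincomb msuppX big_seq1 mcoeffX eqxx.
by rewrite scale1r.
Qed.

Lemma crdE f : f = \sum_(al <- msupp (crd a f)) (crd a f)@_al *: mon a al.
Proof. by rewrite -{1}[f]crdK. Qed.

Lemma mon0 : mon a 0%MM = 1.
Proof. by rewrite /mon big1 // => i _; rewrite mnm0E expr0. Qed.

Section Coef.
Variable s : nat.
Implicit Types (x y : 'rV[A]_s) (u w : 'X_{1..n} * 'I_s).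

(** Unlike the list [supp], scalar coefficients on pairs (exponent, component) are additive in [x];
    leading monomials are characterised through them. *)
Definition cf x u : K := (crd a (x 0 u.2))@_(u.1).

Lemma cfD x y u : cf (x + y) u = cf x u + cf y u.
Proof. by rewrite /cf mxE crdD mcoeffD. Qed.
Lemma cfZ c x u : cf (c%:A *: x) u = c * cf x u.
Proof. by rewrite /cf mxE mulr_algl crdZ mcoeffZ. Qed.
Lemma cf0 u : cf 0 u = 0.
Proof. by rewrite /cf mxE crd0 mcoeff0. Qed.
Lemma cfN x u : cf (- x) u = - cf x u.
Proof.
have -> : - x = (-1)%:A *: x by rewrite scaleN1r scaleNr scale1r.
by rewrite cfZ mulN1r.
Qed.
Lemma cfB x y u : cf (x - y) u = cf x u - cf y u.
Proof. by rewrite cfD cfN. Qed.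
Lemma cf_sum I (r : seq I) (P : pred I) (F : I -> 'rV[A]_s) u :
  cf (\sum_(i <- r | P i) F i) u = \sum_(i <- r | P i) cf (F i) u.
Proof.
by apply: (big_morph (fun x => cf x u)) => [x y|]; rewrite ?cfD ?cf0.
Qed.
Lemma cf_bmon u w : cf (bmon a u) w = (u == w)%:R.
Proof.
rewrite /cf /bmon !mxE eqxx /= eq_sym; case: u w => [al i] [be j] /=.
rewrite xpair_eqE eq_sym; case: eqP => _ /=; last first.
  by rewrite mulr0 crd0 mcoeff0 andbF.
by rewrite mulr1 crd_mon mcoeffX andbT.
Qed.

Lemma mem_supp x u : (u \in supp a x) = (cf x u != 0).
Proof.
rewrite /cf -mcoeff_msupp; case: u => al i /=.
apply/allpairsPdep/idP => [[j [be [_ h [-> ->]]]] //|h].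
by exists i, al; rewrite mem_enum.
Qed.

Lemma cf_inj x y : (forall u, cf x u = cf y u) -> x = y.
Proof.
move=> h; apply/rowP=> i; apply: (can_inj crdK); apply/mpolyP => al.
exact: (h (al, i)).
Qed.

Lemma supp_uniq x : uniq (supp a x).
Proof.
apply: allpairs_uniq_dep => [|i _|]; rewrite ?enum_uniq ?msupp_uniq //.
by move=> [i al] [j be] _ _ /= [-> ->].
Qed.

Lemma cfE x : x = \sum_(u <- supp a x) (cf x u)%:A *: bmon a u.
Proof.
apply: cf_inj => w; rewrite cf_sum.
under eq_bigr do rewrite cfZ cf_bmon.
case wx: (w \in supp a x); last first.
  move: (wx); rewrite mem_supp => /negbFE/eqP ->; rewrite big_seq big1 // => u ux.
  by case: eqP => [e|]; rewrite ?mulr0 //; rewrite -e ux in wx.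
rewrite (bigD1_seq w) ?supp_uniq //= eqxx mulr1 big1 ?addr0 // => u /negPf ->.
by rewrite mulr0.
Qed.

Lemma neq0_cf x : x != 0 -> exists u, cf x u != 0.
Proof.
case E: (supp a x) => [|u r] x0; last by exists u; rewrite -mem_supp E inE eqxx.
by move: x0; rewrite [x]cfE E big_nil eqxx.
Qed.
End Coef.
End PBW.

(** * Leading monomials of products and left monomial orderings *)

Section Orders.
Variables (K : fieldType) (n : nat) (A : algType K) (a : 'I_n -> A).
Variable lt : rel 'X_{1..n}.
Hypothesis solvA : solvable_polynomial_algebra a lt.

Let pbwA : pbw_basis a. Proof. by case: solvA. Qed.

Lemma lt_strict_total : strict_total lt.
Proof. by case: solvA => _ _ []. Qed.

Lemma LMAP f al : LMA a lt f = Some al <->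
  (crd a f)@_al != 0 /\ forall be, (crd a f)@_be != 0 -> be = al \/ lt be al.
Proof.
rewrite /LMA (leadP lt_strict_total) -mcoeff_msupp.
by split=> -[h1 h2]; split=> // be; move: (h2 be); rewrite mcoeff_msupp.
Qed.

(** The tail [f] lies strictly below a^(al + be), so it neither cancels nor exceeds that term:
    exponents add although A need not be commutative. *)
Lemma LMA_mul al be : LMA a lt (mon a al * mon a be) = Some (al + be)%MM.
Proof.
have [_ _ _ /(_ al be)[c [f [c0 -> hf]]]] := solvA.
have [irr _ _] := lt_strict_total.
apply/LMAP; rewrite crdZD // crd_mon //.
case: hf => [->|[mu /LMAP [hmu1 hmu2] ltmu]].
  rewrite crd0 // addr0; split; first by rewrite mcoeffZ mcoeffX eqxx mulr1.
  move=> ga; rewrite mcoeffZ mcoeffX; case: (eqVneq (al + be)%MM ga) => [<-|_]; first by left.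
  by rewrite mulr0 eqxx.
have [_ tr _] := lt_strict_total.
split.
  rewrite mcoeffD mcoeffZ mcoeffX eqxx mulr1.
  case: (eqVneq (crd a f)@_(al + be)%MM 0) => [->|/hmu2 [e|h]]; first by rewrite addr0.
    by rewrite -e irr in ltmu.
  by have := tr _ _ _ h ltmu; rewrite irr.
move=> ga; rewrite mcoeffD mcoeffZ mcoeffX; case: (eqVneq (al + be)%MM ga) => [<-|_]; first by left.
rewrite mulr0 add0r => /hmu2 [->|h]; right => //; exact: tr ltmu.
Qed.

(** The clause on factors of a product is applied to a^al times 1 times 1, with the middle 1 as the
    factor. *)
Lemma lt0m al : al != 0%MM -> lt 0%MM al.
Proof.
move=> al0; have [_ _ [_ _ h _] _] := solvA.
apply: (h al 0%MM 0%MM al); [exact/eqP|by apply/eqP; rewrite eq_sym|].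
by rewrite mon0 !mulr1; have := LMA_mul al 0%MM; rewrite mon0 mulr1 addm0.
Qed.

(** The multiplication clause excludes the leading monomial 1. Here that would force [be] = 0, and
    nothing lies below 0. *)
Lemma lt_addl al be ga : lt al be -> lt (ga + al)%MM (ga + be)%MM.
Proof.
move=> lab; have [_ _ [_ _ _ h] _] := solvA.
have [irr tr _] := lt_strict_total.
apply: (h al be ga 0%MM) => //; rewrite ?mon0 ?mulr1 ?LMA_mul //.
move=> e; have be0 : be = 0%MM.
  apply/mnmP=> i; move/mnmP/(_ i): e; rewrite mnmDE !mnm0E => /eqP.
  by rewrite addn_eq0 => /andP[_ /eqP].
move: lab; rewrite be0; case: (eqVneq al 0%MM) => [->|/lt0m l0]; first by rewrite irr.
by move/(tr _ _ _ l0); rewrite irr.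
Qed.

Lemma lt_wf (P : 'X_{1..n} -> Prop) : (exists x, P x) ->
  exists2 x, P x & forall y, P y -> ~~ lt y x.
Proof.
case=> x0; have [_ _ [_ wf _ _] _] := solvA.
elim: x0 / (wf x0) => x _ IH Px.
case: (excluded_middle_informative (exists2 y, P y & lt y x)) => [[y Py yx]|h].
  exact: IH Py.
by exists x => // y Py; apply/negP => yx; apply: h; exists y.
Qed.

Section TotalOrder.
Variables (s : nat) (lte : rel ('X_{1..n} * 'I_s)).
Hypothesis totP : strict_total lte.
Hypothesis lteA : forall al be i, lt al be -> lte (al, i) (be, i).
Implicit Types (u w : 'X_{1..n} * 'I_s).

Definition madd ga u : 'X_{1..n} * 'I_s := ((ga + u.1)%MM, u.2).

Lemma cf_monZ_bmon ga u w : cf a (mon a ga *: bmon a u) w =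
  if w.2 == u.2 then (crd a (mon a ga * mon a u.1))@_(w.1) else 0.
Proof.
rewrite /cf /bmon !mxE eqxx /=; case: (eqVneq w.2 u.2) => _; first by rewrite mulr1.
by rewrite !mulr0 crd0 // mcoeff0.
Qed.

(** Only totality and compatibility with [lt] are assumed, because this serves to verify that a
    candidate is a left monomial ordering. *)
Lemma LM_monZ_bmon_total ga u : LM a lte (mon a ga *: bmon a u) = Some (madd ga u).
Proof.
have /LMAP[h1 h2] := LMA_mul ga u.1.
apply/(leadP totP); rewrite mem_supp cf_monZ_bmon /= eqxx; split=> // w.
rewrite mem_supp cf_monZ_bmon; case: (eqVneq w.2 u.2) => [e|_]; last by rewrite eqxx.
case: w e => al i /= -> /h2 [->|h]; first by left.
by right; apply: lteA.
Qed.

Lemma left_monomial_orderingI :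
  (forall ga u w, lte u w -> lte (madd ga u) (madd ga w)) ->
  left_monomial_ordering a lt lte.
Proof.
move=> hm; split=> // ga u w u' w' h.
by rewrite !LM_monZ_bmon_total => -[<-] [<-]; apply: hm.
Qed.
End TotalOrder.

Section LeftOrder.
Variables (s : nat) (lte : rel ('X_{1..n} * 'I_s)).
Hypothesis lteP : left_monomial_ordering a lt lte.
Implicit Types (x y : 'rV[A]_s) (u w : 'X_{1..n} * 'I_s).

Lemma lte_total : strict_total lte. Proof. by case: lteP. Qed.
Lemma lte_irr u : lte u u = false. Proof. by case: lte_total => ->. Qed.
Lemma lte_trans : transitive lte. Proof. by case: lte_total. Qed.
Lemma lte_cmp u w : u <> w -> lte u w \/ lte w u.
Proof. by case: lte_total => _ _ h /eqP /h /orP. Qed.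
Definition lee u w := w = u \/ lte u w.

Lemma lee_lt_trans u v w : lee u v -> lte v w -> lte u w.
Proof. by case=> [->|h] //; apply: lte_trans. Qed.
Lemma lee_trans u v w : lee u v -> lee v w -> lee u w.
Proof. by move=> h [->|] // h2; right; apply: lee_lt_trans h2. Qed.
Lemma lee_anti u w : lee u w -> lte w u -> False.
Proof. by move=> h /(lee_lt_trans h); rewrite lte_irr. Qed.

Lemma LMP x u : LM a lte x = Some u <->
  cf a x u != 0 /\ forall w, cf a x w != 0 -> lee w u.
Proof.
rewrite /LM (leadP lte_total) mem_supp //.
split=> -[h1 h2]; split=> // w; move: (h2 w); rewrite mem_supp // => h /h [->|];
  by [left|right].
Qed.

Lemma LM_None x : LM a lte x = None <-> x = 0.
Proof.
rewrite /LM (lead_None lte_total); split=> [h|->].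
  by rewrite (cfE pbwA x) h big_nil.
case E: (supp a 0) => [//|u r].
have : u \in supp a (0 : 'rV[A]_s) by rewrite E inE eqxx.
by rewrite mem_supp // cf0 // eqxx.
Qed.

Lemma LM0 : LM a lte 0 = None. Proof. exact/LM_None. Qed.

Lemma LM_Some x : x != 0 -> exists u, LM a lte x = Some u.
Proof.
by move=> x0; case E: (LM a lte x) => [u|]; [exists u|move: x0; move/LM_None: E => ->; rewrite eqxx].
Qed.

Lemma LM_neq0 x u : LM a lte x = Some u -> x != 0.
Proof. by move=> h; apply/eqP => x0; move: h; rewrite x0 LM0. Qed.

Lemma LC_cf x u : LM a lte x = Some u -> LC a lte x = cf a x u.
Proof. by move=> h; rewrite /LC h. Qed.

Lemma LC_neq0 x u : LM a lte x = Some u -> LC a lte x != 0.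
Proof. by move=> h; rewrite (LC_cf h); case/LMP: h. Qed.

Lemma LMv_bmon x u : LM a lte x = Some u -> LMv a lte x = bmon a u.
Proof. by move=> h; rewrite /LMv h. Qed.

(** The zero vector is below every monomial, so sums can be bounded without setting apart the case
    of full cancellation. *)
Definition below x u := forall w, cf a x w != 0 -> lte w u.
Definition below_eq x u := forall w, cf a x w != 0 -> lee w u.

Lemma bel_belq x u : below x u -> below_eq x u.
Proof. by move=> h w /h; right. Qed.
Lemma belD x y u : below x u -> below y u -> below (x + y) u.
Proof.
move=> hx hy w; rewrite cfD //.
by case: (eqVneq (cf a x w) 0) => [->|/hx //]; rewrite add0r => /hy.
Qed.
Lemma belZ c x u : below x u -> below (c%:A *: x) u.
Proof. by move=> hx w; rewrite cfZ // mulf_eq0 negb_or => /andP[_ /hx]. Qed.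
Lemma bel0 u : below 0 u. Proof. by move=> w; rewrite cf0 // eqxx. Qed.
Lemma bel_sum I (r : seq I) (P : pred I) (F : I -> 'rV[A]_s) u :
  (forall i, P i -> below (F i) u) -> below (\sum_(i <- r | P i) F i) u.
Proof.
move=> h; apply: (big_ind (fun x => below x u)) => //; [exact: bel0|].
by move=> x y; apply: belD.
Qed.
Lemma belN x u : below x u -> below (- x) u.
Proof. by move=> h w; rewrite cfN // oppr_eq0; apply: h. Qed.
Lemma belqD x y u : below_eq x u -> below_eq y u -> below_eq (x + y) u.
Proof.
move=> hx hy w; rewrite cfD //.
by case: (eqVneq (cf a x w) 0) => [->|/hx //]; rewrite add0r => /hy.
Qed.
Lemma belqN x u : below_eq x u -> below_eq (- x) u.
Proof. by move=> h w; rewrite cfN // oppr_eq0; apply: h. Qed.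
Lemma belqB x y u : below_eq x u -> below_eq y u -> below_eq (x - y) u.
Proof. by move=> h /belqN; apply: belqD. Qed.

Lemma LM_belq x u : LM a lte x = Some u -> below_eq x u.
Proof. by case/LMP. Qed.

Lemma bel_LM x u : below x u -> x = 0 \/ exists2 w, LM a lte x = Some w & lte w u.
Proof.
move=> h; case: (eqVneq x 0) => [|/LM_Some [w hw]]; first by left.
by right; exists w => //; apply: h; case/LMP: hw.
Qed.

Lemma belq_cf0 x u : below_eq x u -> cf a x u = 0 -> below x u.
Proof. by move=> h e w hw; case: (h w hw) => // ew; rewrite -ew e eqxx in hw. Qed.

Lemma LM_addb x y u : LM a lte x = Some u -> below y u ->
  LM a lte (x + y) = Some u /\ LC a lte (x + y) = LC a lte x.
Proof.
move=> hx hy; have y0 : cf a y u = 0.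
  by apply/eqP; apply: contraT => /hy; rewrite lte_irr.
have e : LM a lte (x + y) = Some u.
  apply/LMP; rewrite cfD // y0 addr0; split; first by case/LMP: hx.
  by apply: belqD; [apply: LM_belq|apply: bel_belq].
by rewrite (LC_cf e) (LC_cf hx) cfD // y0 addr0.
Qed.

Lemma LM_monZ_bmon ga u : LM a lte (mon a ga *: bmon a u) = Some (madd ga u).
Proof. by case: lteP => tot _ h; apply: LM_monZ_bmon_total. Qed.

Lemma lte_madd ga u w : lte u w -> lte (madd ga u) (madd ga w).
Proof.
by have [_ h _] := lteP => h'; apply: (h ga u w) => //; apply: LM_monZ_bmon.
Qed.
Lemma monZ_expand ga x : mon a ga *: x =
  \sum_(w <- supp a x) (cf a x w)%:A *: (mon a ga *: bmon a w).
Proof.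
rewrite {1}(cfE pbwA x) scaler_sumr; apply: eq_bigr => w _.
by rewrite !scalerA mulr_algl mulr_algr.
Qed.

Lemma monZ_bel ga x u : below x u -> below (mon a ga *: x) (madd ga u).
Proof.
move=> hx; rewrite monZ_expand big_seq; apply: bel_sum => w.
rewrite mem_supp // => /hx wu; apply: belZ => v.
have /LM_belq h := LM_monZ_bmon ga w.
by move/h => h'; apply: lee_lt_trans h' _; apply: lte_madd.
Qed.

(** Split off the leading term of [x]: multiplication by a monomial keeps the rest strictly below
    the image of that term. *)
Lemma LM_monZ ga x u : LM a lte x = Some u -> LM a lte (mon a ga *: x) = Some (madd ga u).
Proof.
move=> hx; have /LMP[c0 _] := hx.
pose y := x - (cf a x u)%:A *: bmon a u.
have by_ : below y u.
  apply: belq_cf0; last by rewrite /y cfB // cfZ // cf_bmon // eqxx mulr1 subrr.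
  apply: belqB; first exact: LM_belq.
  move=> w; rewrite cfZ // cf_bmon //; case: (eqVneq u w) => [->|_]; first by left.
  by rewrite mulr0 eqxx.
have -> : mon a ga *: x = (cf a x u)%:A *: (mon a ga *: bmon a u) + mon a ga *: y.
  rewrite /y scalerBr addrC scalerA [_ *: (_ *: bmon _ _)]scalerA mulr_algl mulr_algr.
  by rewrite subrK.
have h := LM_monZ_bmon ga u; have /LMP[h1 h2] := h.
apply: (proj1 (LM_addb (u := madd ga u) _ (monZ_bel by_))).
apply/LMP; rewrite cfZ // mulf_neq0 //; split=> // w.
by rewrite cfZ // mulf_eq0 negb_or => /andP[_ /h2].
Qed.

Lemma LM_scalar c x u : c != 0 -> LM a lte x = Some u ->
  LM a lte (c%:A *: x) = Some u.
Proof.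
move=> c0 /LMP[h1 h2]; apply/LMP; rewrite cfZ // mulf_neq0 //; split=> // w.
by rewrite cfZ // mulf_eq0 negb_or => /andP[_ /h2].
Qed.

Lemma LM_LMv ga x w : LM a lte (mon a ga *: LMv a lte x) = Some w <->
  exists2 u, LM a lte x = Some u & w = madd ga u.
Proof.
rewrite /LMv; case E: (LM a lte x) => [u|].
  by rewrite LM_monZ_bmon; split=> [[<-]|[v [->] ->]] //; exists u.
by rewrite scaler0 LM0; split=> // -[].
Qed.

Lemma LT_E x u : LM a lte x = Some u -> LT a lte x = (cf a x u)%:A *: bmon a u.
Proof. by move=> h; rewrite /LT (LC_cf h) (LMv_bmon h). Qed.

Lemma bel_subLT x u : LM a lte x = Some u -> below (x - LT a lte x) u.
Proof.
move=> h; rewrite (LT_E h); apply: belq_cf0; last first.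
  by rewrite cfB // cfZ // cf_bmon // eqxx mulr1 subrr.
apply: belqB; first exact: LM_belq.
move=> w; rewrite cfZ // cf_bmon //; case: (eqVneq u w) => [->|_]; first by left.
by rewrite mulr0 eqxx.
Qed.

(** On each of the finitely many components [lte] extends the well-ordering [lt]. A nonempty set of
    inaccessible monomials would thus have a minimum, the least of the minima of its components, but
    a least inaccessible element is accessible. *)
Lemma lte_wf : well_founded (fun u w => lte u w : Prop).
Proof.
move=> u0; pose N w := ~ Acc (fun u w => lte u w : Prop) w.
case: (excluded_middle_informative (N u0)) => [nacc|]; last exact: NNPP.
suff [w Nw hw] : exists2 w, N w & forall v, N v -> lee w v.
  case: Nw; constructor=> v vw; apply: NNPP => /hw h.
  exact: lee_anti h vw.
have [_ _ lteA] := lteP.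
have [ltirr lttr lttot] := lt_strict_total.
have key (r : seq 'I_s) : (exists2 w, N w & w.2 \in r) ->
    exists2 w, N w & forall v, N v -> v.2 \in r -> lee w v.
  elim: r => [|i r IH]; first by case.
  case=> w0 Nw0; rewrite inE.
  have min_i : (exists al, N (al, i)) ->
      exists2 w, N w & forall v, N v -> v.2 = i -> lee w v.
    move/lt_wf => [al Nal min]; exists (al, i) => // -[be j] /= Nbe e; subst j.
    case: (eqVneq be al) => [->|ne]; first by left.
    case/orP: (lttot _ _ ne) => h; first by rewrite (negPf (min _ Nbe)) in h.
    by right; apply: lteA.
  case: (excluded_middle_informative (exists2 w, N w & w.2 \in r)) => [/IH [w1 N1 h1]|no].
    case: (excluded_middle_informative (exists al, N (al, i))) => [/min_i [w2 N2 h2] _|no'].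
      case: (excluded_middle_informative (lee w1 w2)) => [le|nle].
        exists w1 => // v Nv; rewrite inE => /orP[/eqP /h2 h|/h1]; last exact.
        exact: lee_trans (h Nv).
      have le : lee w2 w1.
        case: (excluded_middle_informative (w1 = w2)) => [->|ne]; first by left.
        by case: (lte_cmp ne) => h; [case: nle|]; right.
      exists w2 => // v Nv; rewrite inE => /orP[/eqP /h2|/h1 h]; first exact.
      exact: lee_trans (h Nv).
    move=> _; exists w1 => // v Nv; rewrite inE => /orP[/eqP e|/h1]; last exact.
    by case: no'; exists v.1; rewrite -e; case: v Nv {e}.
  case/orP=> [/eqP e|h]; last by case: no; exists w0.
  have [|w1 N1 h1] := min_i; first by exists w0.1; rewrite -e; case: w0 Nw0 {e}.
  exists w1 => // v Nv; rewrite inE => /orP[/eqP|h]; first exact: h1.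
  by case: no; exists v.
have [|w Nw hw] := key (enum 'I_s); first by exists u0; rewrite ?mem_enum.
by exists w => // v Nv; apply: hw; rewrite ?mem_enum.
Qed.
End LeftOrder.
End Orders.

(** * Grading and augmentation *)

Section Graded.
Variables (K : fieldType) (n : nat) (A : algType K) (a : 'I_n -> A).
Hypothesis pbwA : pbw_basis a.
Variable wt : 'I_n -> nat.
Hypothesis gradA : graded_algebra a wt.
Implicit Types (f g : A).

Lemma wdegD al be : wdeg wt (al + be)%MM = (wdeg wt al + wdeg wt be)%N.
Proof.
by rewrite /wdeg -big_split /=; apply: eq_bigr => i _; rewrite mnmDE mulnDr.
Qed.

Lemma wdeg0 : wdeg wt 0%MM = 0%N.
Proof. by rewrite /wdeg big1 // => i _; rewrite mnm0E muln0. Qed.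

Lemma wdeg_eq0 al : (wdeg wt al == 0%N) = (al == 0%MM).
Proof.
apply/eqP/eqP => [|->]; last exact: wdeg0.
move/eqP; rewrite /wdeg sum_nat_eq0 => /forallP h; apply/mnmP=> i.
move: (h i); rewrite /= muln_eq0 mnm0E.
by case: gradA => /(_ i); rewrite lt0n => /negPf -> _ /eqP.
Qed.

Lemma homogAP p f :
  reflect (forall al, (crd a f)@_al != 0 -> wdeg wt al = p) (homogA a wt p f).
Proof.
apply: (iffP allP) => h al; first by rewrite -mcoeff_msupp => /h /eqP.
by rewrite mcoeff_msupp => /h /eqP.
Qed.

Lemma homogA_mon al : homogA a wt (wdeg wt al) (mon a al).
Proof.
apply/homogAP => be; rewrite crd_mon // mcoeffX.
by case: (eqVneq al be) => [->|]; rewrite ?eqxx.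
Qed.

Lemma homogAZ p c f : homogA a wt p f -> homogA a wt p (c *: f).
Proof.
move/homogAP => h; apply/homogAP => al; rewrite crdZ // mcoeffZ mulf_eq0 negb_or.
by case/andP=> _ /h.
Qed.

Lemma homogAM p q f g : homogA a wt p f -> homogA a wt q g ->
  homogA a wt (p + q)%N (f * g).
Proof. by case: gradA => _; apply. Qed.

Definition eps f : K := (crd a f)@_0%MM.

Lemma epsD f g : eps (f + g) = eps f + eps g.
Proof. by rewrite /eps crdD // mcoeffD. Qed.
Lemma eps0 : eps 0 = 0.
Proof. by rewrite /eps crd0 // mcoeff0. Qed.
Lemma epsZ c f : eps (c *: f) = c * eps f.
Proof. by rewrite /eps crdZ // mcoeffZ. Qed.
Lemma epsN f : eps (- f) = - eps f.
Proof. by rewrite -scaleN1r epsZ mulN1r. Qed.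
Lemma epsB f g : eps (f - g) = eps f - eps g.
Proof. by rewrite epsD epsN. Qed.
Lemma eps_sum I (r : seq I) (P : pred I) (F : I -> A) :
  eps (\sum_(i <- r | P i) F i) = \sum_(i <- r | P i) eps (F i).
Proof. exact: (big_morph _ epsD eps0). Qed.
Lemma eps_mon al : eps (mon a al) = (al == 0%MM)%:R.
Proof. by rewrite /eps crd_mon // mcoeffX. Qed.
Lemma eps1 : eps 1 = 1.
Proof. by rewrite -(mon0 a) eps_mon eqxx. Qed.

Lemma eps_homog p f : homogA a wt p f -> (0 < p)%N -> eps f = 0.
Proof.
move=> /homogAP h p0; apply/eqP; apply: contraT => /h; rewrite wdeg0 => e.
by rewrite -e in p0.
Qed.

(** For nonzero [al] every product a^al a^be is homogeneous of positive degree and has no constant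
    term. This is where the grading makes [eps] multiplicative. *)
Lemma eps_monM al g : eps (mon a al * g) = (al == 0%MM)%:R * eps g.
Proof.
case: eqP => [->|/eqP al0]; first by rewrite mon0 !mul1r.
rewrite mul0r (crdE pbwA g) mulr_sumr eps_sum big1 // => be _.
rewrite -scalerAr epsZ (eps_homog (homogAM (homogA_mon _) (homogA_mon _))) ?mulr0 //.
by rewrite addn_gt0 lt0n wdeg_eq0 al0.
Qed.

Lemma epsM f g : eps (f * g) = eps f * eps g.
Proof.
rewrite {1}(crdE pbwA f) mulr_suml eps_sum [in RHS](crdE pbwA f) [in RHS]eps_sum.
rewrite mulr_suml; apply: eq_bigr => al _.
by rewrite -scalerAl !epsZ eps_monM eps_mon mulrA.
Qed.

(** The weights being positive, degree 0 contains only scalars, so a homogeneous element with a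
    constant term is a unit scalar. This translates the stopping criterion of Algorithm-MINHGSQ into
    vanishing under [eps]. *)
Lemma homogA_eps p f : homogA a wt p f -> ~ inKstar f -> eps f = 0.
Proof.
move=> hf nf; case: p hf => [|p] hf; last exact: eps_homog hf _.
apply/eqP; apply: contraT => e0; case: nf; exists (eps f) => //.
apply: (can_inj (crdK pbwA)); apply/mpolyP => al.
rewrite crdZ // -(mon0 a) crd_mon // mcoeffZ mcoeffX.
case: (eqVneq 0%MM al) => [<-|al0]; first by rewrite mulr1.
rewrite mulr0; apply/eqP; apply: contraT => /(homogAP _ _ hf)/eqP.
by rewrite wdeg_eq0 eq_sym (negPf al0).
Qed.

Section FreeModule.
Variables (s : nat) (b : 'I_s -> nat).
Implicit Types (x y : 'rV[A]_s).

Lemma homogLP q x : reflect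
  (forall u, cf a x u != 0 -> (wdeg wt u.1 + b u.2 = q)%N) (homogL a wt b q x).
Proof.
apply: (iffP allP) => h u; first by rewrite -mem_supp // => /h /eqP.
by rewrite mem_supp // => /h /eqP.
Qed.

Lemma homogL0 q : homogL a wt b q 0.
Proof. by apply/homogLP => u; rewrite cf0 // eqxx. Qed.

Lemma homogLD q x y :
  homogL a wt b q x -> homogL a wt b q y -> homogL a wt b q (x + y).
Proof.
move=> /homogLP hx /homogLP hy; apply/homogLP => u; rewrite cfD //.
by case: (eqVneq (cf a x u) 0) => [->|/hx //]; rewrite add0r => /hy.
Qed.

Lemma homogLN q x : homogL a wt b q x -> homogL a wt b q (- x).
Proof. by move=> /homogLP h; apply/homogLP => u; rewrite cfN // oppr_eq0; apply: h. Qed.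

Lemma homogLB q x y :
  homogL a wt b q x -> homogL a wt b q y -> homogL a wt b q (x - y).
Proof. by move=> h /homogLN; apply: homogLD. Qed.

Lemma homogL_sum q I (r : seq I) (P : pred I) (F : I -> 'rV[A]_s) :
  (forall i, P i -> homogL a wt b q (F i)) ->
  homogL a wt b q (\sum_(i <- r | P i) F i).
Proof.
move=> h; apply: (big_ind (fun x => homogL a wt b q x)) => //; first exact: homogL0.
by move=> x y; apply: homogLD.
Qed.

Lemma homogL_entry q x i : homogL a wt b q x -> x 0 i != 0 ->
  (b i <= q)%N /\ homogA a wt (q - b i)%N (x 0 i).
Proof.
move=> /homogLP h xi; split.
  case E: (msupp (crd a (x 0 i))) => [|al r].
    by move: xi; rewrite (crdE pbwA (x 0 i)) E big_nil eqxx.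
  have : al \in msupp (crd a (x 0 i)) by rewrite E inE eqxx.
  by rewrite mcoeff_msupp => /(h (al, i)) <-; apply: leq_addl.
by apply/homogAP => al /(h (al, i)) <-; rewrite addnK.
Qed.

Lemma homogL_row q x :
  (forall i, x 0 i != 0 -> exists2 p, homogA a wt p (x 0 i) & (p + b i = q)%N) ->
  homogL a wt b q x.
Proof.
move=> h; apply/homogLP => -[al i] /= c0.
have [|p /homogAP hp <-] := h i; last by rewrite (hp al).
by apply: contraNneq c0; rewrite /cf /= => ->; rewrite crd0 // mcoeff0.
Qed.

Lemma homogLM p q f x :
  homogA a wt p f -> homogL a wt b q x -> homogL a wt b (p + q)%N (f *: x).
Proof.
move=> hf hx; apply: homogL_row => i; rewrite mxE => fx0.
have x0 : x 0 i != 0 by apply: contraNneq fx0 => ->; rewrite mulr0.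
have [le hi] := homogL_entry hx x0.
by exists (p + (q - b i))%N; [apply: homogAM|rewrite -addnA subnK].
Qed.

Lemma homogL_delta i : homogL a wt b (b i) (delta_mx 0 i).
Proof.
apply: homogL_row => j; rewrite mxE eqxx /=; case: (eqVneq j i) => [->|]; rewrite ?eqxx // => _.
by exists 0%N; rewrite // -(mon0 a) -wdeg0 homogA_mon.
Qed.

Lemma dgr_homog q x : x != 0 -> homogL a wt b q x -> dgr a wt b x = q.
Proof.
move=> x0 hx; have [u cu] := neq0_cf pbwA x0.
apply/eqP; rewrite eqn_leq; apply/andP; split.
  rewrite /dgr big_seq; apply: (big_ind (fun m => (m <= q)%N)) => // [k l kq lq|w].
    by rewrite geq_max kq.
  by rewrite mem_supp // => /(homogLP _ _ hx) ->.
rewrite -(homogLP _ _ hx u cu) /dgr.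
rewrite (big_rem u) ?mem_supp //=; exact: leq_maxl.
Qed.

Lemma nz_homog_dgr x : nz_homog a wt b x -> x != 0 /\ homogL a wt b (dgr a wt b x) x.
Proof. by case=> x0 [q hq]; split=> //; rewrite (dgr_homog x0 hq). Qed.
End FreeModule.

Lemma homogL_mulmx s t (b : 'I_s -> nat) (c : 'I_t -> nat) q (h : 'rV[A]_t)
    (M : 'M[A]_(t, s)) :
  homogL a wt c q h -> (forall l, homogL a wt b (c l) (row l M)) ->
  homogL a wt b q (h *m M).
Proof.
move=> hh hM; rewrite mulmx_sum_row; apply: homogL_sum => l _.
case: (eqVneq (h 0 l) 0) => [->|h0]; first by rewrite scale0r homogL0.
have [le hl] := homogL_entry hh h0.
by rewrite -(subnK le); apply: homogLM.
Qed.

Definition epsmx m p (M : 'M[A]_(m, p)) : 'M[K]_(m, p) := map_mx eps M.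

Lemma epsmxM m p q (M : 'M[A]_(m, p)) (N : 'M[A]_(p, q)) :
  epsmx (M *m N) = epsmx M *m epsmx N.
Proof.
apply/matrixP => i j; rewrite !mxE eps_sum; apply: eq_bigr => k _.
by rewrite epsM !mxE.
Qed.

Lemma epsmxD m p (M N : 'M[A]_(m, p)) : epsmx (M + N) = epsmx M + epsmx N.
Proof. by apply/matrixP => i j; rewrite !mxE epsD. Qed.

Lemma epsmx1 m : epsmx (1%:M : 'M[A]_m) = 1%:M.
Proof.
apply/matrixP => i j; rewrite !mxE; case: eqP => _; rewrite ?mulr1n ?mulr0n.
  exact: eps1.
exact: eps0.
Qed.
End Graded.

(** * Division *)

Section Division.
Variables (K : fieldType) (n : nat) (A : algType K) (a : 'I_n -> A).
Variable lt : rel 'X_{1..n}.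
Hypothesis solvA : solvable_polynomial_algebra a lt.
Variables (s : nat) (lte : rel ('X_{1..n} * 'I_s)).
Hypothesis lteP : left_monomial_ordering a lt lte.
Implicit Types (x y omega eta : 'rV[A]_s) (u w : 'X_{1..n} * 'I_s)
  (Xi : seq 'rV[A]_s).

Let pbwA : pbw_basis a. Proof. by case: solvA. Qed.
Local Notation LM := (LM a lte).
Local Notation LC := (LC a lte).
Local Notation LMv := (LMv a lte).

Definition gmx Xi : 'M[A]_(size Xi, s) := \matrix_(l < size Xi) Xi`_l.

(** As leading exponents add, divisibility of monomials of L in the noncommutative sense amounts to
    comparison of exponents; [dvdm_LM] makes the link. *)
Definition dvdm (u w : 'X_{1..n} * 'I_s) : bool := (u.2 == w.2) && (u.1 <= w.1)%MM.

Lemma dvdmP u w : reflect (exists be, w = madd be u) (dvdm u w).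
Proof.
apply: (iffP andP) => [[/eqP e h]|[be ->]].
  by exists (w.1 - u.1)%MM; rewrite /madd submK // e; case: w {e h}.
by split=> //=; apply: lem_addl.
Qed.

Lemma dvdm_trans : transitive dvdm.
Proof.
move=> v u w /andP[/eqP e1 h1] /andP[/eqP e2 h2]; apply/andP.
by rewrite e1 e2; split=> //; apply: lepm_trans h2.
Qed.

Lemma dvdm_LM x w : (exists ga, LM (mon a ga *: LMv x) = Some w) <->
  exists2 u, LM x = Some u & dvdm u w.
Proof.
split=> [[ga /(LM_LMv solvA lteP)[u hu e]]|[u hu /dvdmP[ga e]]].
  by exists u => //; apply/dvdmP; exists ga.
by exists ga; apply/(LM_LMv solvA lteP); exists u.
Qed.

Section Fixed.
Variable Xi : seq 'rV[A]_s.

Definition irred u :=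
  forall (j : 'I_(size Xi)) v, LM Xi`_j = Some v -> ~~ dvdm v u.

Lemma irredP omega u : LM omega = Some u ->
  (forall (j : 'I_(size Xi)) be, LM (mon a be *: LMv Xi`_j) <> LM omega) <-> irred u.
Proof.
move=> hu; rewrite hu; split=> h j.
  move=> v hv; apply/negP => d; have [|be /h //] := proj2 (dvdm_LM Xi`_j u).
  by exists v.
move=> be e; have [|v hv d] := proj1 (dvdm_LM Xi`_j u); first by exists be.
by have := h j v hv; rewrite d.
Qed.

Definition divmult omega (i : 'I_(size Xi)) al : A :=
  ((LC (mon a al *: Xi`_i))^-1 * LC omega) *: mon a al.

Lemma reduce_step omega u (i : 'I_(size Xi)) al :
  LM omega = Some u -> LM (mon a al *: LMv Xi`_i) = LM omega ->
  exists v, [/\ LM Xi`_i = Some v, u = madd al v,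
    LM (mon a al *: Xi`_i) = Some u,
    below a lte (omega - divmult omega i al *: Xi`_i) u
    & (LC (mon a al *: Xi`_i))^-1 * LC omega != 0].
Proof.
move=> hu; rewrite hu => /(LM_LMv solvA lteP)[v hv eu]; exists v.
have hl := LM_monZ solvA lteP al hv; rewrite -eu in hl.
have c0 := LC_neq0 lteP hl; have d0 := LC_neq0 lteP hu.
split=> //; last by rewrite mulf_neq0 ?invr_eq0.
have e : divmult omega i al *: Xi`_i =
    ((LC (mon a al *: Xi`_i))^-1 * LC omega)%:A *: (mon a al *: Xi`_i).
  by rewrite scalerA mulr_algl.
rewrite e; apply: belq_cf0.
  apply: (belqB solvA); first by apply: (LM_belq lteP).
  apply: (LM_belq lteP); apply: (LM_scalar solvA lteP) => //.
  by rewrite mulf_neq0 ?invr_eq0.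
rewrite cfB // cfZ // -(LC_cf hl) -(LC_cf hu) mulrAC mulVf // mul1r subrr //.
Qed.

(** Inversion is stated with equations because the stopping rule fixes the dividend, an index of the
    relation, to be 0. *)
Lemma division_loop_inv q eta omega q' eta' :
  division_loop a lte (Xi := Xi) q eta omega q' eta' ->
  [\/ [/\ omega = 0, q' = q & eta' = eta],
    exists (i : 'I_(size Xi)) al, [/\ omega != 0, LM (mon a al *: LMv Xi`_i) = LM omega,
      (forall (j : 'I_(size Xi)) be, (j < i)%N ->
         LM (mon a be *: LMv Xi`_j) <> LM omega) &
      division_loop a lte (q + divmult omega i al *: delta_mx 0 i) eta
        (omega - divmult omega i al *: Xi`_i) q' eta'] |
    [/\ omega != 0,
      (forall (j : 'I_(size Xi)) be, LM (mon a be *: LMv Xi`_j) <> LM omega) &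
      division_loop a lte q (eta + LT a lte omega) (omega - LT a lte omega) q' eta']].
Proof.
case=> {q eta omega q' eta'} [q eta|q eta omega i al q' eta' h1 h2 h3 h h4|q eta omega q' eta' h1 h2 h3].
- by constructor 1.
- by constructor 2; exists i, al.
- by constructor 3.
Qed.

Lemma division_loop_exists omega q eta : exists q' eta',
  division_loop a lte (Xi := Xi) q eta omega q' eta'.
Proof.
case: (eqVneq omega 0) => [->|o0]; first by exists q, eta; constructor.
have [u hu] := LM_Some solvA lteP o0.
elim: u / (lte_wf solvA lteP u) omega o0 hu q eta => u _ IH omega o0 hu q eta.
have next_stage omega' q1 eta1 : below a lte omega' u -> exists q' eta',
    division_loop a lte (Xi := Xi) q1 eta1 omega' q' eta'.
  case: (eqVneq omega' 0) => [-> _|o0' hb]; first by exists q1, eta1; constructor.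
  have [e|[w hw wu]] := bel_LM solvA lteP hb; first by rewrite e eqxx in o0'.
  exact: IH wu _ o0' hw _ _.
(* Deciding divisibility classically turns the least-index rule into a minimum over a finite
   type. *)
pose B (j : 'I_(size Xi)) : bool :=
  if excluded_middle_informative (exists be, LM (mon a be *: LMv Xi`_j) = LM omega)
  then true else false.
have BP (j : 'I_(size Xi)) : reflect (exists be, LM (mon a be *: LMv Xi`_j) = LM omega) (B j).
  by rewrite /B; case: excluded_middle_informative => h; constructor.
case: (pickP B) => [j0 Bj0|noB].
  case: (@arg_minnP _ j0 B val Bj0) => i Bi min.
  have [al hal] := BP i Bi.
  have [v [_ _ _ hb _]] := reduce_step hu hal.
  have [q' [eta' h]] := next_stage _ (q + divmult omega i al *: delta_mx 0 i) eta hb.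
  exists q', eta'; apply: (Div_reduce (i := i) (al := al)) => // j be ji e.
  by have := min j (introT (BP j) (ex_intro _ be e)); rewrite leqNgt ji.
have [q' [eta' h]] := next_stage _ q (eta + LT a lte omega) (bel_subLT solvA lteP hu).
exists q', eta'; apply: Div_move => // j be e.
by have := noB j; move/BP; apply; exists be.
Qed.

Lemma division_exists x : exists q eta, @division _ _ _ a _ lte Xi x q eta.
Proof. exact: division_loop_exists. Qed.

Lemma division_loop_sum q eta omega q' eta' :
  division_loop a lte (Xi := Xi) q eta omega q' eta' ->
  q' *m gmx Xi + eta' = q *m gmx Xi + eta + omega.
Proof.
elim=> {q eta omega q' eta'} [q eta|q eta omega i al q' eta' _ _ _ h _ ->|q eta omega q' eta' _ _ _ ->].
- by rewrite addr0.
- rewrite mulmxDl -scalemxAl -rowE rowK; set z := h *: _.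
  by rewrite -!addrA; congr (_ + _); rewrite addrCA [z + _]addrC subrK addrC addrC.
- by rewrite -!addrA [LT _ _ _ + _]addrC subrK.
Qed.

Lemma division_sum x q eta : @division _ _ _ a _ lte Xi x q eta ->
  x = q *m gmx Xi + eta.
Proof. by move/division_loop_sum ->; rewrite mul0mx !add0r. Qed.

Lemma division_loop_irred q eta omega q' eta' :
  division_loop a lte (Xi := Xi) q eta omega q' eta' ->
  (forall u, cf a eta u != 0 -> irred u) -> forall u, cf a eta' u != 0 -> irred u.
Proof.
elim=> {q eta omega q' eta'} [//|q eta omega i al q' eta' _ _ _ h _ IH //|].
move=> q eta omega q' eta' o0 no _ IH hE; apply: IH => w.
have [u hu] := LM_Some solvA lteP o0.
rewrite cfD // (LT_E hu) cfZ // cf_bmon //.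
case: (eqVneq u w) => [<- _|_]; first by move/(irredP hu): no.
by rewrite mulr0 addr0 => /hE.
Qed.

Lemma division_irred x q eta u : @division _ _ _ a _ lte Xi x q eta ->
  cf a eta u != 0 -> irred u.
Proof.
by move/division_loop_irred; apply => w; rewrite cf0 // eqxx.
Qed.

Section Bound.
Variable P : 'X_{1..n} * 'I_s -> Prop.
Hypothesis Pdown : forall u w, P u -> lte w u -> P w.

Let bound_next omega u y : LM omega = Some u ->
  (forall w, cf a omega w != 0 -> P w) -> below a lte y u ->
  forall w, cf a y w != 0 -> P w.
Proof.
move=> hu hP hb w /hb; apply: Pdown; apply: hP.
by case/(LMP lteP): hu.
Qed.

(** A coefficient of [q] at (al, l) stands for the product of a^al with the l-th divisor; [Q]
    constrains the leading monomial of that product. *)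
Definition tops (Q : 'X_{1..n} * 'I_s -> Prop) (q : 'rV[A]_(size Xi)) :=
  forall z, cf a q z != 0 -> exists2 v, LM Xi`_(z.2) = Some v & Q (madd z.1 v).

(** Each product subtracted has the leading monomial of the current dividend, and dividends only
    descend. A downward closed predicate as bound covers in particular the monomials strictly below
    an lcm. *)
Lemma division_loop_tops q eta omega q' eta' :
  division_loop a lte (Xi := Xi) q eta omega q' eta' ->
  (forall w, cf a omega w != 0 -> P w) -> tops P q -> tops P q'.
Proof.
elim=> {q eta omega q' eta'} [//|q eta omega i al q' eta' o0 hal _ h _ IH hP tq|].
  have [u hu] := LM_Some solvA lteP o0.
  have [v [hv eu _ hb _]] := reduce_step hu hal.
  apply: IH; first exact: bound_next hu hP hb.
  move=> z; rewrite cfD // /h.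
  rewrite -(mulr_algl _ (mon a al)) -scalerA cfZ //.
  rewrite [cf a (_ *: delta_mx 0 i) z](_ : _ = cf a (bmon a (al, i)) z) //.
  rewrite cf_bmon //; case: (eqVneq (al, i) z) => [<- _|_].
    exists v => //; rewrite /= -eu; apply: hP.
    by case/(LMP lteP): hu.
  by rewrite mulr0 addr0 => /tq.
move=> q eta omega q' eta' o0 _ _ IH hP tq; apply: IH => //.
have [u hu] := LM_Some solvA lteP o0.
by apply: (bound_next hu hP); apply: (bel_subLT solvA lteP).
Qed.

Lemma division_loop_rem q eta omega q' eta' :
  division_loop a lte (Xi := Xi) q eta omega q' eta' ->
  (forall w, cf a omega w != 0 -> P w) -> forall w, cf a (eta' - eta) w != 0 -> P w.
Proof.
elim=> {q eta omega q' eta'} [q eta hP w|q eta omega i al q' eta' o0 hal _ h _ IH hP|].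
- by rewrite subrr cf0 // eqxx.
- have [u hu] := LM_Some solvA lteP o0.
  have [v [_ _ _ hb _]] := reduce_step hu hal.
  by apply: IH; apply: bound_next hu hP hb.
- move=> q eta omega q' eta' o0 _ _ IH hP.
  have [u hu] := LM_Some solvA lteP o0.
  move=> w; have -> : eta' - eta = (eta' - (eta + LT a lte omega)) + LT a lte omega.
    by rewrite opprD addrA subrK.
  rewrite cfD // (LT_E hu) cfZ // cf_bmon //.
  case: (eqVneq u w) => [<- _|_]; first by apply: hP; case/(LMP lteP): hu.
  rewrite mulr0 addr0 -(LT_E hu); apply: IH.
  by apply: (bound_next hu hP); apply: (bel_subLT solvA lteP).
Qed.
End Bound.

Lemma division_loop_rem_bel q eta omega q' eta' u :
  division_loop a lte (Xi := Xi) q eta omega q' eta' ->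
  below a lte omega u -> below a lte (eta' - eta) u.
Proof.
move=> h hb; apply: (@division_loop_rem (fun w => lte w u)) h hb => w1 w2 h1 h2.
exact: (lte_trans lteP h2 h1).
Qed.

Lemma division_tops P x q eta : (forall u w, P u -> lte w u -> P w) ->
  @division _ _ _ a _ lte Xi x q eta ->
  (forall w, cf a x w != 0 -> P w) -> tops P q.
Proof.
move=> down d hx; apply: (division_loop_tops down d) => // w.
by rewrite cf0 // eqxx.
Qed.

(** The least index is forced, and then the multiplier is, because exponents can be cancelled.
    Determinism identifies a division made after the algorithm with one made during it. *)
Lemma division_loop_uniq q eta omega q1 eta1 q2 eta2 :
  division_loop a lte (Xi := Xi) q eta omega q1 eta1 ->
  division_loop a lte q eta omega q2 eta2 -> q1 = q2 /\ eta1 = eta2.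
Proof.
move=> h; elim: h q2 eta2 => {q eta omega q1 eta1}
  [q eta|q eta omega i al q1 eta1 o0 hal imin h _ IH|q eta omega q1 eta1 o0 no _ IH] q2 eta2.
- by case/division_loop_inv=> [[_ -> ->] //|[? [? []]]|[]]; rewrite eqxx.
- case/division_loop_inv=> [[e]|[j [be [_ hbe jmin h2]]]|[_ no _]].
  + by rewrite e eqxx in o0.
  + have e : j = i.
      by apply: val_inj => /=; case: (ltngtP j i) => // ij; [case: (imin _ _ ij hbe)|case: (jmin _ _ ij hal)].
    subst j; apply: IH; suff e : be = al by rewrite -e in h *; exact: h2.
    have [u hu] := LM_Some solvA lteP o0.
    move: hbe hal; rewrite hu => /(LM_LMv solvA lteP)[v hv eu].
    case/(LM_LMv solvA lteP) => w; rewrite hv => -[<-]; rewrite eu => e.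
    by apply: (@addmI _ v.1); rewrite ![(v.1 + _)%MM]addmC; exact: (congr1 fst e).
  + by case: (no i al).
- case/division_loop_inv=> [[e]|[j [be [_ hbe _ _]]]|[_ _ h2]].
  + by rewrite e eqxx in o0.
  + by case: (no j be).
  + exact: IH.
Qed.

Lemma division_uniq x q1 eta1 q2 eta2 :
  @division _ _ _ a _ lte Xi x q1 eta1 -> @division _ _ _ a _ lte Xi x q2 eta2 ->
  q1 = q2 /\ eta1 = eta2.
Proof. exact: division_loop_uniq. Qed.

Lemma division_loop_homog wt (b : 'I_s -> nat) (c : 'I_(size Xi) -> nat) p q eta omega q' eta' :
  (forall l, homogL a wt b (c l) Xi`_l) ->
  division_loop a lte (Xi := Xi) q eta omega q' eta' -> graded_algebra a wt ->
  homogL a wt b p omega -> homogL a wt b p eta -> homogL a wt c p q ->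
  homogL a wt b p eta' /\ homogL a wt c p q'.
Proof.
move=> hX h gradA; elim: h => {q eta omega q' eta'} [//|q eta omega i al q' eta' o0 hal _ h _ IH ho he hq|].
  have [u hu] := LM_Some solvA lteP o0.
  have [v [hv eu _ _ _]] := reduce_step hu hal.
  have /(LMP lteP)[cu _] := hu; have /(LMP lteP)[cv _] := hv.
  have ep : (wdeg wt al + c i = p)%N.
    rewrite -(homogLP a wt _ _ _ ho u cu) eu /= wdegD // -addnA; congr (_ + _)%N.
    by rewrite (homogLP a wt _ _ _ (hX i) v cv).
  have hh : homogA a wt (wdeg wt al) h by apply: homogAZ => //; apply: homogA_mon.
  apply: IH => //.
    by apply: homogLB => //; rewrite -ep; apply: homogLM.
  by apply: homogLD => //; rewrite -ep; apply: homogLM => //; apply: homogL_delta.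
move=> q eta omega q' eta' o0 _ _ IH ho he hq.
have [u hu] := LM_Some solvA lteP o0; have /(LMP lteP)[cu _] := hu.
have hT : homogL a wt b p (LT a lte omega).
  apply/homogLP => // w; rewrite (LT_E hu) cfZ // cf_bmon //.
  case: (eqVneq u w) => [<- _|]; first exact: (homogLP a wt _ _ _ ho).
  by rewrite mulr0 eqxx.
by apply: IH => //; [apply: homogLB|apply: homogLD].
Qed.

Lemma division_homog wt (b : 'I_s -> nat) (c : 'I_(size Xi) -> nat) p x q eta :
  graded_algebra a wt -> (forall l, homogL a wt b (c l) Xi`_l) ->
  @division _ _ _ a _ lte Xi x q eta -> homogL a wt b p x ->
  homogL a wt b p eta /\ homogL a wt c p q.
Proof.
by move=> gA hX d hx; apply: (division_loop_homog hX d) => //; apply: homogL0.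
Qed.
End Fixed.

Section Extension.
Variables (Xi Ys : seq 'rV[A]_s).

(** Padding by zeros. It passes through lists, which read 0 past their end, because the length of
    the divisor list is part of the type of the quotients. *)
Definition extq (q : 'rV[A]_(size Xi)) : 'rV[A]_(size (Xi ++ Ys)) :=
  \row_l (row_seq q)`_l.

Lemma size_row_seq m (q : 'rV[A]_m) : size (row_seq q) = m.
Proof. by rewrite size_map size_enum_ord. Qed.

Lemma nth_row_seq m (q : 'rV[A]_m) (l : 'I_m) : (row_seq q)`_l = q 0 l.
Proof. by rewrite (nth_map l) ?size_enum_ord // nth_ord_enum. Qed.

Lemma row_row_seq m (q : 'rV[A]_m) : \row_l (row_seq q)`_l = q.
Proof. by apply/rowP => l; rewrite mxE nth_row_seq. Qed.

Fact ext_ord_proof (i : 'I_(size Xi)) : (i < size (Xi ++ Ys))%N.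
Proof. by rewrite size_cat ltn_addr. Qed.
Definition ext_ord i := Ordinal (ext_ord_proof i).

Lemma nth_ext (i : 'I_(size Xi)) : (Xi ++ Ys)`_(ext_ord i) = Xi`_i.
Proof. by rewrite nth_cat /= ltn_ord. Qed.

Lemma extqD q q1 : extq (q + q1) = extq q + extq q1.
Proof.
apply/rowP => l; rewrite !mxE; case: (ltnP l (size Xi)) => hl.
  by rewrite !(nth_row_seq _ (Ordinal hl)) mxE.
by rewrite !nth_default ?size_row_seq // addr0.
Qed.

Lemma extq_delta f (i : 'I_(size Xi)) :
  extq (f *: delta_mx 0 i) = f *: delta_mx 0 (ext_ord i).
Proof.
apply/rowP => l; rewrite !mxE eqxx /=; case: (ltnP l (size Xi)) => hl.
  by rewrite (nth_row_seq _ (Ordinal hl)) !mxE.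
rewrite nth_default ?size_row_seq //; case: eqP => [e|]; rewrite ?mulr0 //.
by move: hl; rewrite e /= leqNgt ltn_ord.
Qed.

Lemma extq0 : extq 0 = 0.
Proof.
apply/rowP => l; rewrite !mxE; case: (ltnP l (size Xi)) => hl.
  by rewrite (nth_row_seq _ (Ordinal hl)) mxE.
by rewrite nth_default ?size_row_seq.
Qed.

Lemma divmult_ext omega1 omega2 i al : LC omega1 = LC omega2 ->
  divmult (Xi := Xi ++ Ys) omega1 (ext_ord i) al = divmult omega2 i al.
Proof. by rewrite /divmult nth_ext => ->. Qed.

Lemma min_ext omega omega' (i : 'I_(size Xi)) : LM omega' = LM omega ->
  (forall (j : 'I_(size Xi)) be, (j < i)%N ->
     LM (mon a be *: LMv Xi`_j) <> LM omega) ->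
  forall (j : 'I_(size (Xi ++ Ys))) be, (j < ext_ord i)%N ->
     LM (mon a be *: LMv (Xi ++ Ys)`_j) <> LM omega'.
Proof.
move=> -> h j be /= ji; have jl : (j < size Xi)%N := ltn_trans ji (ltn_ord i).
by rewrite nth_cat jl; apply: (h (Ordinal jl)).
Qed.

(* What the smaller division moves to the remainder is removed from the
   dividend beforehand, so that the larger division ends with remainder 0. *)
Lemma division_loop_ext q eta omega q' eta' r :
  division_loop a lte (Xi := Xi) q eta omega q' eta' ->
  division_loop a lte (extq q + r) 0 (omega - (eta' - eta)) (extq q' + r) 0.
Proof.
elim=> {q eta omega q' eta'} [q eta|q eta omega i al q' eta' o0 hal imin h hl IH|].
- by rewrite !subrr; constructor.
- have [u hu] := LM_Some solvA lteP o0.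
  have [v [hv eu _ hb _]] := reduce_step hu hal.
  have hr : below a lte (- (eta' - eta)) u.
    by apply: (belN solvA); apply: division_loop_rem_bel hl hb.
  have [hu' hC] := LM_addb solvA lteP hu hr.
  have hM : divmult (Xi := Xi ++ Ys) (omega - (eta' - eta)) (ext_ord i) al = h.
    by apply: divmult_ext; rewrite hC.
  apply: (Div_reduce (i := ext_ord i) (al := al)).
  + exact: (LM_neq0 solvA lteP hu').
  + by rewrite nth_ext hal hu hu'.
  + by apply: min_ext imin; rewrite hu hu'.
  rewrite -/(divmult _ (ext_ord i) al) hM nth_ext addrAC -extq_delta -extqD.
  by rewrite addrAC.
(* The moved term was already taken away from the larger dividend, which this step therefore leaves
   unchanged. *)
- move=> q eta omega q' eta' _ _ _; set T := LT a lte omega.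
  suff -> : omega - (eta' - eta) = omega - T - (eta' - (eta + T)) by [].
  by rewrite !opprB [eta + T]addrC !addrA subrK.
Qed.

Lemma division_ext0 x q : @division _ _ _ a _ lte Xi x q 0 ->
  @division _ _ _ a _ lte (Xi ++ Ys) x (extq q) 0.
Proof.
by move/(division_loop_ext 0); rewrite extq0 !addr0 !subr0.
Qed.
End Extension.

Section ExtendByRemainder.
Variable Xi : seq 'rV[A]_s.

Fact last_ord_proof eta : (size Xi < size (Xi ++ [:: eta]))%N.
Proof. by rewrite size_cat addn1. Qed.
Definition last_ord eta := Ordinal (last_ord_proof eta).

(** Both divisions agree up to the first move to the remainder. There the dividend has the leading
    term of [e' - e], so the appended element is subtracted once with multiplier 1. This removes in
    advance all that would still be moved, and [division_loop_ext] takes over. *)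
Lemma division_loop_new q e omega q' e' :
  division_loop a lte (Xi := Xi) q e omega q' e' -> e' - e != 0 ->
  division_loop a lte (extq [:: e' - e] q) 0 omega
    (extq [:: e' - e] q' + delta_mx 0 (last_ord (e' - e))) 0.
Proof.
elim=> {q e omega q' e'} [q e|q e omega i al q' e' o0 hal imin h hl IH e0|].
- by rewrite subrr eqxx.
- apply: (Div_reduce (i := ext_ord [:: e' - e] i) (al := al)) => //.
  + by rewrite nth_ext hal.
  + by apply: min_ext imin.
  rewrite -/(divmult omega (ext_ord [:: e' - e] i) al) (divmult_ext _ _ _ (erefl (LC omega))) -/h.
  by rewrite nth_ext -extq_delta -extqD; apply: IH.
- move=> q e omega q' e' o0 no hl _ e0.
  set eta := e' - e.
  have [u hu] := LM_Some solvA lteP o0.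
  have hb : below a lte (e' - (e + LT a lte omega)) u.
    exact: division_loop_rem_bel hl (bel_subLT solvA lteP hu).
  have eE : eta = LT a lte omega + (e' - (e + LT a lte omega)).
    by rewrite [RHS]addrC opprD [e' + (_ + _)]addrA subrK.
  have hT : LM (LT a lte omega) = Some u.
    rewrite (LT_E hu); apply: (LM_scalar solvA lteP); first by case/(LMP lteP): hu.
    have := LM_monZ_bmon solvA lteP 0%MM u; rewrite mon0 scale1r => ->.
    by rewrite /madd add0m; case: (u).
  have [he hC] := LM_addb solvA lteP hT hb; rewrite -eE in he hC.
  have hC' : LC eta = LC omega.
    rewrite hC (LC_cf hT) (LC_cf hu) (LT_E hu) cfZ // cf_bmon // eqxx mulr1 //.
  have nthl : (Xi ++ [:: eta])`_(last_ord eta) = eta by rewrite nth_cat /= ltnn subnn.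
  have hM : divmult (Xi := Xi ++ [:: eta]) omega (last_ord eta) 0%MM = 1.
    rewrite /divmult nthl mon0 scale1r hC' mulVf ?scale1r //.
    exact: (LC_neq0 lteP hu).
  apply: (Div_reduce (i := last_ord eta) (al := 0%MM)) => //.
  + rewrite nthl hu; apply/(LM_LMv solvA lteP); exists u => //.
    by rewrite /madd add0m; case: (u).
  + move=> j be /= jl; rewrite nth_cat jl; exact: (no (Ordinal jl)).
  rewrite -/(divmult omega (last_ord eta) 0%MM) hM !scale1r nthl.
  have := division_loop_ext (Ys := [:: eta]) (delta_mx 0 (last_ord eta)) hl.
  suff -> : omega - LT a lte omega - (e' - (e + LT a lte omega)) = omega - eta by [].
  by rewrite [in RHS]eE -[LHS]addrA -opprD.
Qed.

Lemma division_new x q eta : @division _ _ _ a _ lte Xi x q eta -> eta != 0 ->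
  @division _ _ _ a _ lte (Xi ++ [:: eta]) x
    (extq [:: eta] q + delta_mx 0 (last_ord eta)) 0.
Proof.
move=> d e0; have := division_loop_new d; rewrite subr0 => /(_ e0).
by rewrite extq0.
Qed.
End ExtendByRemainder.
End Division.

(** * Dickson's lemma *)

Section Dickson.

(** From each place jump to a later index where [f] attains its minimum over the whole tail. *)
Lemma nondecreasing_subsequence (f : nat -> nat) : exists phi : nat -> nat,
  {homo phi : i j / (i < j)%N} /\ {homo (fun i => f (phi i)) : i j / (i <= j)%N}.
Proof.
have ex m : exists k, (m <= k)%N /\ forall j, (m <= j)%N -> (f k <= f j)%N.
  have [v] : exists v, exists2 k, (m <= k)%N & f k = v by exists (f m), m.
  have [w] := ubnP v; elim: w v => // w IH v; rewrite ltnS => vw [k mk fk].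
  case: (excluded_middle_informative (exists2 j, (m <= j)%N & (f j < v)%N)) => [[j mj fj]|no].
    by apply: (IH (f j) (leq_trans fj vw)); exists j.
  exists k; split=> // j mj; rewrite fk leqNgt; apply/negP => h.
  by apply: no; exists j.
pose nxt m := proj1_sig (constructive_indefinite_description _ (ex m)).
have nxtP m : (m <= nxt m)%N /\ forall j, (m <= j)%N -> (f (nxt m) <= f j)%N.
  exact: (proj2_sig (constructive_indefinite_description _ (ex m))).
pose phi := fix phi i := if i is j.+1 then nxt (phi j).+1 else nxt 0%N.
have inc i : (phi i < phi i.+1)%N by case: (nxtP (phi i).+1).
have minphi i : (f (phi i) <= f (phi i.+1))%N.
  have : exists2 m, phi i = nxt m & (m <= phi i)%N.
    by case: i => [|i]; [exists 0%N|exists (phi i).+1 => //; apply: inc].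
  case=> m e h; rewrite e; apply: (proj2 (nxtP m)).
  exact: leq_trans h (ltnW (inc i)).
exists phi; split; first by apply: homo_ltn => // i j k; apply: ltn_trans.
by apply: homo_leq => // i j k; apply: leq_trans.
Qed.

Lemma simultaneous_subsequence T (fs : seq (T -> nat)) (u : nat -> T) :
  exists phi : nat -> nat, {homo phi : i j / (i < j)%N} /\
    forall k, (k < size fs)%N ->
      {homo (fun i => nth (fun=> 0%N) fs k (u (phi i))) : i j / (i <= j)%N}.
Proof.
elim: fs u => [|f fs IH] u.
  by exists id; split=> [//|k]; rewrite ltn0.
have [phi [inc hf]] := nondecreasing_subsequence (f \o u).
have [psi [inc' hfs]] := IH (u \o phi).
exists (phi \o psi); split; first by move=> i j /inc' /inc.
case=> [|k] hk i j ij; last exact: (hfs k hk i j ij).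
apply: hf; move: ij; rewrite leq_eqVlt => /orP[/eqP -> //|/inc'].
exact: ltnW.
Qed.

(* Nondecreasing i and s - i along a sequence of indices force i constant. *)
Lemma dickson n s (u : nat -> 'X_{1..n} * 'I_s) :
  exists i j, (i < j)%N /\ dvdm (u i) (u j).
Proof.
pose fs : seq ('X_{1..n} * 'I_s -> nat) :=
  (fun w => val w.2) :: (fun w => (s - val w.2)%N) ::
  [seq (fun w : 'X_{1..n} * 'I_s => w.1 k) | k <- enum 'I_n].
have [phi [inc h]] := simultaneous_subsequence fs u.
exists (phi 0%N), (phi 1%N); split; first exact: inc.
have h1 := h 0%N isT 0%N 1%N isT; have h2 := h 1%N isT 0%N 1%N isT.
apply/andP; split; last first.
  apply/mnm_lepP => k; have := h k.+2 _ 0%N 1%N isT.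
  by rewrite /= (nth_map k) ?size_map -?enumT ?size_enum_ord // nth_ord_enum => /(_ (ltn_ord k)).
rewrite -val_eqE eqn_leq; apply/andP; split; first exact: h1.
by move: h2; rewrite /= leq_sub2lE // ltnW.
Qed.

Lemma not_acc_sequence T (R : T -> T -> Prop) (x0 : T) : ~ Acc R x0 ->
  exists u : nat -> T, u 0%N = x0 /\ forall i, R (u i.+1) (u i).
Proof.
move=> nx0.
have ex (x : {x | ~ Acc R x}) : exists y : {x | ~ Acc R x}, R (proj1_sig y) (proj1_sig x).
  case: x => x nxt; apply: NNPP => no; apply: (nxt); constructor=> y yx.
  by apply: NNPP => ny; apply: no; exists (exist _ y ny).
pose nxt x := proj1_sig (constructive_indefinite_description _ (ex x)).
have nxtP x : R (proj1_sig (nxt x)) (proj1_sig x).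
  exact: (proj2_sig (constructive_indefinite_description _ (ex x))).
by exists (fun i => proj1_sig (iter i nxt (exist _ x0 nx0))); split=> // i; apply: nxtP.
Qed.

(** An infinite chain of extensions would list a sequence without any related pair i < j. This
    converts Dickson's lemma into termination of Algorithm-MINHGS. *)
Lemma rcons_bad_wf (T : eqType) (P : T -> T -> Prop) (valid : T -> Prop) :
  (forall u : nat -> T, (forall i, valid (u i)) ->
     exists i j, (i < j)%N /\ P (u i) (u j)) ->
  well_founded (fun G' G : seq T => exists x,
    [/\ G' = rcons G x, valid x & forall g, g \in G -> ~ P g x]).
Proof.
move=> good G0; apply: NNPP => na; have [G [_ h]] := not_acc_sequence na.
pose x i := proj1_sig (constructive_indefinite_description _ (h i)).
have xP i : [/\ G i.+1 = rcons (G i) (x i), valid (x i) &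
    forall g, g \in G i -> ~ P g (x i)].
  exact: (proj2_sig (constructive_indefinite_description _ (h i))).
have [i|i [j [ij hij]]] := good x; first by case: (xP i).
have [_ _ /(_ (x i))] := xP j; apply=> //.
elim: j ij {hij} => // j IH; rewrite ltnS leq_eqVlt.
have [-> _ _] := xP j; rewrite mem_rcons inE => /orP[/eqP ->|/IH ->].
  by rewrite eqxx.
by rewrite orbT.
Qed.
End Dickson.

(** * Schreyer's theorem and Buchberger's criterion *)

Section Schreyer.
Variables (K : fieldType) (n : nat) (A : algType K) (a : 'I_n -> A).
Variable lt : rel 'X_{1..n}.
Hypothesis solvA : solvable_polynomial_algebra a lt.
Variables (s : nat) (lte : rel ('X_{1..n} * 'I_s)).
Hypothesis lteP : left_monomial_ordering a lt lte.

Let pbwA : pbw_basis a. Proof. by case: solvA. Qed.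

Lemma left_groebner_dvdm (N : 'rV[A]_s -> Prop) G : left_groebner a lte N G <->
  (forall g, g \in G -> g != 0 /\ N g) /\
  (forall x u, N x -> LM a lte x = Some u ->
     exists g v, [/\ g \in G, LM a lte g = Some v & dvdm v u]).
Proof.
split=> -[hG h]; split=> // x.
  move=> u Nx hu; have [|g gG [ga e]] := h x Nx; first exact: (LM_neq0 solvA lteP hu).
  rewrite hu in e; have [|v hv d] := proj1 (dvdm_LM solvA lteP g u); first by exists ga.
  by exists g, v.
move=> Nx x0; have [u hu] := LM_Some solvA lteP x0.
have [g [v [gG hv d]]] := h x u Nx hu; exists g => //.
by rewrite hu; apply/(dvdm_LM solvA lteP); exists v.
Qed.

Section SPolynomial.
Variables (x y : 'rV[A]_s) (u w : 'X_{1..n} * 'I_s).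
Hypotheses (hx : LM a lte x = Some u) (hy : LM a lte y = Some w) (e2 : u.2 = w.2).

Lemma same_componentE : same_component a lte x y.
Proof. by rewrite /same_component hx hy e2. Qed.

Lemma scoef_LM : LM a lte (scoef a lte x y *: x) = Some (mlcm u.1 w.1, u.2) /\
  cf a (scoef a lte x y *: x) (mlcm u.1 w.1, u.2) = 1.
Proof.
rewrite /scoef hx hy; set de := (_ - _)%MM.
have hd := LM_monZ solvA lteP de hx.
have eD : madd de u = (mlcm u.1 w.1, u.2).
  by rewrite /madd submK // lem_mlcml.
rewrite eD in hd; have c0 := LC_neq0 lteP hd.
have -> : ((LC a lte (mon a de *: x))^-1 *: mon a de) *: x =
    ((LC a lte (mon a de *: x))^-1)%:A *: (mon a de *: x).
  by rewrite scalerA mulr_algl.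
split; first by apply: (LM_scalar solvA lteP) => //; rewrite invr_eq0.
by rewrite cfZ // -(LC_cf hd) mulVf.
Qed.
End SPolynomial.

Lemma spolyE x y u w : LM a lte x = Some u -> LM a lte y = Some w -> u.2 = w.2 ->
  spoly a lte x y = scoef a lte x y *: x - scoef a lte y x *: y /\
  below a lte (spoly a lte x y) (mlcm u.1 w.1, u.2).
Proof.
move=> hx hy e; rewrite /spoly (same_componentE hx hy e); split=> //.
have [h1 c1] := scoef_LM hx hy; have [h2 c2] := scoef_LM hy hx.
rewrite mlcmC -e in h2 c2.
apply: belq_cf0; last by rewrite cfB // c1 c2 subrr.
by apply: (belqB solvA); apply: (LM_belq lteP).
Qed.

Section Module.
Variables (t : nat) (M : 'M[A]_(t, s)) (lm : 'I_t -> 'X_{1..n} * 'I_s).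
Hypothesis lmP : forall l, LM a lte (row l M) = Some (lm l).
Implicit Types (h : 'rV[A]_t).

(* Among monomials of equal weight the one with the smaller index is larger. *)
Definition schr : rel ('X_{1..n} * 'I_t) := fun u w =>
  lte (madd u.1 (lm u.2)) (madd w.1 (lm w.2)) ||
  (madd u.1 (lm u.2) == madd w.1 (lm w.2)) && (w.2 < u.2)%N.

Lemma madd_madd (al be : 'X_{1..n}) (v : 'X_{1..n} * 'I_s) :
  madd (al + be)%MM v = madd al (madd be v).
Proof. by rewrite /madd /= addmA. Qed.

Lemma schr_left_monomial_ordering : left_monomial_ordering a lt schr.
Proof.
have [irr tr tot] := lte_total lteP.
apply: (left_monomial_orderingI solvA).
- split.
  + by move=> u; rewrite /schr irr ltnn andbF.
  + move=> v u w; rewrite /schr => /orP[h1|/andP[/eqP e1 h1]] /orP[h2|/andP[/eqP e2 h2]].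
    * by rewrite (tr _ _ _ h1 h2).
    * by rewrite -e2 h1.
    * by rewrite e1 h2.
    * by rewrite e1 e2 eqxx (ltn_trans h2 h1) orbT.
  + move=> [al i] [be j] ne; rewrite /schr /=.
    case: (eqVneq (madd al (lm i)) (madd be (lm j))) => [e|/tot]; last first.
      by case/orP=> ->; rewrite ?orbT.
    rewrite e irr ?eqxx /= orbC; case: (ltngtP i j) => // ij; case/eqP: ne.
    have ij' : i = j by apply: val_inj.
    subst j; congr (_, _); apply: (@addmI _ (lm i).1).
    by rewrite ![((lm i).1 + _)%MM]addmC; exact: (congr1 fst e).
- move=> al be i h; rewrite /schr /=; apply/orP; left.
  have [_ _ hA] := lteP; apply: hA.
  by rewrite ![(_ + (lm i).1)%MM]addmC; apply: (lt_addl solvA).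
- move=> ga u w; rewrite /schr /= !madd_madd => /orP[h|/andP[/eqP e h]].
    by rewrite (lte_madd solvA lteP).
  by rewrite e eqxx h orbT.
Qed.

Let schrP := schr_left_monomial_ordering.

Lemma mulmx_bmon (w : 'X_{1..n} * 'I_t) : bmon a w *m M = mon a w.1 *: row w.2 M.
Proof. by rewrite /bmon -scalemxAl -rowE. Qed.

(* Unless the leading term of h cancels against another term of the same
   Schreyer weight, it determines the leading monomial of the combination. *)
Lemma LM_combination h (u : 'X_{1..n} * 'I_t) : LM a schr h = Some u ->
  LM a lte (h *m M) = Some (madd u.1 (lm u.2)) \/
  exists w : 'X_{1..n} * 'I_t, (u.2 < w.2)%N /\ madd w.1 (lm w.2) = madd u.1 (lm u.2).
Proof.
move=> hu; have /(LMP schrP)[cu hmax] := hu.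
case: (excluded_middle_informative (exists w : 'X_{1..n} * 'I_t, (u.2 < w.2)%N /\
  madd w.1 (lm w.2) = madd u.1 (lm u.2))) => [|no]; [by right|left].
have -> : h *m M = (cf a h u)%:A *: (mon a u.1 *: row u.2 M) +
    (\sum_(w <- supp a h | w != u) (cf a h w)%:A *: (mon a w.1 *: row w.2 M)).
  rewrite {1}(cfE pbwA h) mulmx_suml.
  rewrite (bigD1_seq u) ?supp_uniq ?mem_supp //= -scalemxAl mulmx_bmon.
  by congr (_ + _); apply: eq_bigr => w _; rewrite -scalemxAl mulmx_bmon.
apply: (proj1 (LM_addb solvA lteP (u := madd u.1 (lm u.2)) _ _)).
  by apply: (LM_scalar solvA lteP) => //; apply: (LM_monZ solvA lteP); apply: lmP.
rewrite big_seq_cond; apply: (bel_sum solvA) => w /andP[]; rewrite mem_supp // => cw wu.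
apply: (belZ solvA) => v hv.
have {}hv := LM_belq lteP (LM_monZ solvA lteP w.1 (lmP w.2)) hv.
apply: (lee_lt_trans lteP hv).
case: (hmax w cw) => [e|]; first by rewrite e eqxx in wu.
rewrite /schr => /orP[//|/andP[/eqP e lt_uw]]; case: no; by exists w.
Qed.

Section Pairs.
Variables (i j : 'I_t).
Hypotheses (ltij : (i < j)%N) (eij : (lm i).2 = (lm j).2).

Definition lcmij : 'X_{1..n} * 'I_s := (mlcm (lm i).1 (lm j).1, (lm i).2).

(** With [f] the quotients of the S-polynomial this is s_ij. Leaving [f] free allows both freshly
    computed and recorded quotients. *)
Definition pair_syz (f : 'rV[A]_t) : 'rV[A]_t :=
  f - scoef a lte (row i M) (row j M) *: delta_mx 0 i
    + scoef a lte (row j M) (row i M) *: delta_mx 0 j.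

Lemma pair_syz_mul f : pair_syz f *m M = f *m M - spoly a lte (row i M) (row j M).
Proof.
have [-> _] := spolyE (lmP i) (lmP j) eij.
rewrite /pair_syz mulmxDl mulmxBl -!scalemxAl -!rowE.
by rewrite opprB addrA addrAC.
Qed.

(** Both S-polynomial multipliers have the lcm as Schreyer weight, the tie is broken in favour of
    the smaller index [i], and the terms of [f] stay strictly below. *)
Lemma LM_pair_syz f :
  (forall w, cf a f w != 0 -> lte (madd w.1 (lm w.2)) lcmij) ->
  LM a schr (pair_syz f) = Some ((mlcm (lm i).1 (lm j).1 - (lm i).1)%MM, i).
Proof.
move=> hf; set de := (_ - _)%MM.
have ed : madd de (lm i) = lcmij by rewrite /madd submK // lem_mlcml.
pose de' := (mlcm (lm j).1 (lm i).1 - (lm j).1)%MM.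
have ed' : madd de' (lm j) = lcmij.
  by rewrite /madd submK ?lem_mlcml // /lcmij mlcmC eij.
have eqsc k l (al : 'X_{1..n}) : al = (mlcm (lm k).1 (lm l).1 - (lm k).1)%MM ->
    (lm k).2 = (lm l).2 -> exists2 c, c != 0 &
    scoef a lte (row k M) (row l M) *: delta_mx 0 k = c%:A *: bmon a (al, k) :> 'rV[A]_t.
  move=> -> e; rewrite /scoef !lmP; eexists; last first.
    by rewrite /bmon scalerA mulr_algl; reflexivity.
  by rewrite invr_eq0; apply: (LC_neq0 lteP (LM_monZ solvA lteP _ (lmP k))).
have [c c0 ec] := eqsc i j de erefl eij.
have [c' c'0 ec'] := eqsc j i de' erefl (esym eij).
have -> : pair_syz f = (- c)%:A *: bmon a (de, i) + (f + c'%:A *: bmon a (de', j)).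
  by rewrite /pair_syz ec ec' !scaleNr addrA; congr (_ + _); rewrite addrC.
have LMb (u : 'X_{1..n} * 'I_t) : LM a schr (bmon a u) = Some u.
  have := LM_monZ_bmon solvA schrP 0%MM u; rewrite mon0 scale1r => ->.
  by rewrite /madd add0m; case: (u).
apply: (proj1 (LM_addb solvA schrP (u := (de, i)) _ _)).
  by apply: (LM_scalar solvA schrP) => //; rewrite oppr_eq0.
apply: (belD solvA) => [w /hf h|]; first by rewrite /schr /= ed h.
apply: (belZ solvA) => w /(LM_belq schrP (LMb _)) h.
by apply: (lee_lt_trans schrP h); rewrite /schr /= ed ed' eqxx ltij orbT.
Qed.
End Pairs.

Section Criterion.
Variable S : seq 'rV[A]_t.
Hypothesis SP : forall x, x \in S -> x *m M = 0.
Hypothesis Spairs : forall i j : 'I_t, (i < j)%N -> (lm i).2 = (lm j).2 ->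
  exists2 x, x \in S & LM a schr x = Some ((mlcm (lm i).1 (lm j).1 - (lm i).1)%MM, i).

(** If another index w allows the same Schreyer weight, that weight is a common multiple of the
    leading monomials at u.2 and w, hence of their lcm. So the leading term of the syzygy of this
    pair divides that of [h]. *)
Lemma LM_irreducible h (u : 'X_{1..n} * 'I_t) : LM a schr h = Some u ->
  (exists x v, [/\ x \in S, LM a schr x = Some v & dvdm v u]) \/
  LM a lte (h *m M) = Some (madd u.1 (lm u.2)).
Proof.
move=> hu; case: (LM_combination hu) => [|[w [uw e]]]; first by right.
left; have e2 : (lm u.2).2 = (lm w.2).2 by exact: esym (congr1 snd e).
have [x xS hx] := Spairs uw e2; exists x, ((mlcm (lm u.2).1 (lm w.2).1 - (lm u.2).1)%MM, u.2).
split=> //; apply/andP; split=> //=.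
have le : (mlcm (lm u.2).1 (lm w.2).1 <= u.1 + (lm u.2).1)%MM.
  by rewrite lem_mlcm lem_addl -[(_ + _)%MM](congr1 fst e) lem_addl.
apply/mnm_lepP => k; rewrite mnmBE leq_subLR addnC -mnmDE.
exact: (mnm_lepP le).
Qed.

(** Dividing by pair syzygies does not change the image and leaves a representative whose leading
    term shows in the image. Buchberger's criterion and Schreyer's generation theorem are both read
    off from it. *)
Lemma reduce_modulo_pairs h : exists h',
  [/\ exists q, h = q *m gmx S + h', h' *m M = h *m M &
    h' = 0 \/ exists u, LM a schr h' = Some u /\
      LM a lte (h' *m M) = Some (madd u.1 (lm u.2))].
Proof.
have [q [h' d]] := division_exists solvA schrP S h.
have eh := division_sum d; exists h'; split; first by exists q.
  rewrite eh mulmxDl -mulmxA (_ : gmx S *m M = 0) ?mulmx0 ?add0r //.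
  by apply/row_matrixP => l; rewrite row_mul rowK row0 SP // mem_nth.
case: (eqVneq h' 0) => [|/(LM_Some solvA schrP)[u hu]]; [by left|right].
exists u; split=> //; case: (LM_irreducible hu) => // -[x [v [xS hv dv]]].
have cu : cf a h' u != 0 by case/(LMP schrP): hu.
have := division_irred solvA schrP d cu.
have lt_ix : (index x S < size S)%N by rewrite index_mem.
by move/(_ (Ordinal lt_ix) v); rewrite /= nth_index // dv => /(_ hv).
Qed.

Lemma buchberger h u : LM a lte (h *m M) = Some u -> exists l, dvdm (lm l) u.
Proof.
have [h' [_ <- [->|[v [_ ->]]]]] := reduce_modulo_pairs h.
  by rewrite mul0mx (LM0 solvA lteP).
by case=> <-; exists v.2; apply/dvdmP; exists v.1.
Qed.

Lemma schreyer_generates h : h *m M = 0 -> exists q, h = q *m gmx S.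
Proof.
move=> h0; have [h' [[q eh] e]] := reduce_modulo_pairs h.
case=> [h'0|[u [_]]]; first by exists q; rewrite eh h'0 addr0.
by rewrite e h0 (LM0 solvA lteP).
Qed.

Lemma schreyer_groebner : left_groebner a schr (fun h => h *m M = 0)
  [seq x <- S | x != 0].
Proof.
split=> [x|h h0 hn0]; first by rewrite mem_filter => /andP[-> /SP].
have [u hu] := LM_Some solvA schrP hn0.
case: (LM_irreducible hu) => [[x [v [xS hv d]]]|]; last by rewrite h0 (LM0 solvA lteP).
exists x; first by rewrite mem_filter xS (LM_neq0 solvA schrP hv).
by rewrite hu; apply/(dvdm_LM solvA schrP); exists v.
Qed.
End Criterion.
End Module.
End Schreyer.

(** * Projective dimension *)

Section Lift.
Variables (R : nzRingType).

(** Projectivity of free modules in matrix form, a preimage being chosen for each row. *)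
Lemma row_lift m t s (g : 'M[R]_(t, s)) (B : 'M[R]_(m, s)) :
  (forall i, exists y, y *m g = row i B) -> exists Y, Y *m g = B.
Proof.
move=> h; pose f i := proj1_sig (constructive_indefinite_description _ (h i)).
exists (\matrix_i f i); apply/row_matrixP => i; rewrite row_mul rowK.
exact: (proj2_sig (constructive_indefinite_description _ (h i))).
Qed.

(** [k] counts the free modules resolving N itself, so the quotient of a free module by N has a
    resolution of length at most [k]. Recursion through kernels avoids a dependently typed
    complex. *)
Fixpoint pd_le (k : nat) : forall s, ('rV[R]_s -> Prop) -> Prop :=
  match k with
  | 0 => fun s N => forall x, N x -> x = 0
  | k'.+1 => fun s N => exists t (g : 'M[R]_(t, s)),
      (forall x, N x <-> exists y, y *m g = x) /\ pd_le k' (fun y : 'rV_t => y *m g = 0)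
  end.

Definition submodule s (N : 'rV[R]_s -> Prop) : Prop :=
  N 0 /\ forall f x y, N x -> N y -> N (f *: x + y).

Lemma submodule_mulmx s (N : 'rV[R]_s -> Prop) t (q : 'rV[R]_t) (g : 'M[R]_(t, s)) :
  submodule N -> (forall l, N (row l g)) -> N (q *m g).
Proof.
case=> N0 NZD hg; rewrite mulmx_sum_row; apply: (big_ind N) => // [x y Nx Ny|l _].
  by rewrite -[x]scale1r; apply: NZD.
by rewrite -[_ *: _]addr0; apply: NZD.
Qed.

Lemma submoduleB s (N : 'rV[R]_s -> Prop) x y : submodule N -> N x -> N y -> N (x - y).
Proof. by case=> _ h Nx Ny; rewrite addrC -scaleN1r; apply: h. Qed.

Lemma submodule_ker s t (g : 'M[R]_(t, s)) : submodule (fun y : 'rV_t => y *m g = 0).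
Proof.
split=> [|f x y hx hy]; first by rewrite mul0mx.
by rewrite mulmxDl -scalemxAl hx hy scaler0 addr0.
Qed.

Lemma submodule_span s (U : seq 'rV[R]_s) : submodule (Defs.span U).
Proof.
have [[S0 SD] SZ] := in_span_closed U.
split; first exact/in_spanP.
by move=> f x y /in_spanP hx /in_spanP hy; apply/in_spanP; apply: SD => //; apply: SZ.
Qed.
End Lift.

(** * Free resolutions from Groebner bases *)

Section GroebnerResolution.
Variables (K : fieldType) (n : nat) (A : algType K) (a : 'I_n -> A).
Variable lt : rel 'X_{1..n}.
Hypothesis solvA : solvable_polynomial_algebra a lt.

Section Basis.
Variables (s : nat) (lte : rel ('X_{1..n} * 'I_s)).
Hypothesis lteP : left_monomial_ordering a lt lte.
Variable N : 'rV[A]_s -> Prop.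

(** The remainder lies in N, yet no leading monomial of the basis divides its own. *)
Lemma groebner_division G x : submodule N -> left_groebner a lte N G -> N x ->
  forall q eta, @division _ _ _ a _ lte G x q eta -> eta = 0.
Proof.
move=> subN gbG Nx q eta d; apply: NNPP => /eqP eta0.
have [u hu] := LM_Some solvA lteP eta0.
have [hG hdiv] := proj1 (left_groebner_dvdm solvA lteP N G) gbG.
have Neta : N eta.
  have -> : eta = x - q *m gmx G by rewrite {1}(division_sum d) addrAC subrr add0r.
  apply: submoduleB => //; apply: submodule_mulmx => // l; rewrite rowK.
  by case: (hG G`_l); rewrite ?mem_nth.
have [g [v [gG hv dv]]] := hdiv eta u Neta hu.
have ix : (index g G < size G)%N by rewrite index_mem.
have /(LMP lteP)[cu _] := hu.
have := division_irred solvA lteP d cu.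
by move/(_ (Ordinal ix) v); rewrite /= nth_index // dv => /(_ hv).
Qed.

Lemma groebner_span G : submodule N -> left_groebner a lte N G ->
  forall x, N x <-> exists q, q *m gmx G = x.
Proof.
move=> subN gbG x; split=> [Nx|[q <-]].
  have [q [eta d]] := division_exists solvA lteP G x.
  exists q; rewrite [RHS](division_sum d).
  by rewrite (groebner_division subN gbG Nx d) addr0.
apply: submodule_mulmx => // l; rewrite rowK.
by case: gbG => /(_ G`_l) h _; case: h; rewrite ?mem_nth.
Qed.

Lemma groebner_minimal G : left_groebner a lte N G -> exists G',
  [/\ {subset G' <= G}, left_groebner a lte N G' &
    forall i j u v, (i < size G')%N -> (j < size G')%N -> i != j ->
      LM a lte G'`_i = Some u -> LM a lte G'`_j = Some v -> ~~ dvdm u v].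
Proof.
have [m] := ubnP (size G); elim: m G => // m IH G; rewrite ltnS => szG gbG.
have [hG hdiv] := proj1 (left_groebner_dvdm solvA lteP N G) gbG.
case: (excluded_middle_informative (exists g h u v,
  [/\ g \in G, h \in G, g != h & [/\ LM a lte g = Some u, LM a lte h = Some v & dvdm u v]])).
  case=> g [h [u [v [gG hG' gh [hu hv d]]]]].
  have [||G' [sub gb' min]] := IH [seq x <- G | x != h].
  - apply: leq_trans szG; rewrite size_filter -(count_predC (pred1 h)) -[X in (X < _)%N]add0n.
    by rewrite ltn_add2r -has_count; apply/hasP; exists h; rewrite //= eqxx.
  - apply/(left_groebner_dvdm solvA lteP N); split=> [x|x w Nx hw].
      by rewrite mem_filter => /andP[_ /hG].
    have [g0 [v0 [g0G hv0 d0]]] := hdiv x w Nx hw.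
    case: (eqVneq g0 h) => [e|ne]; last by exists g0, v0; rewrite mem_filter ne.
    exists g, u; rewrite mem_filter gh gG; split=> //.
    by apply: dvdm_trans d0; move: hv0; rewrite e hv => -[<-].
  by exists G'; split=> // x /sub; rewrite mem_filter => /andP[].
move=> no; exists (undup G); split.
- by move=> x; rewrite mem_undup.
- apply/(left_groebner_dvdm solvA lteP N); split=> [x|x w Nx hw].
    by rewrite mem_undup => /hG.
  by have [g [v h]] := hdiv x w Nx hw; exists g, v; rewrite mem_undup.
move=> i j u v hi hj ij hu hv; apply/negP => d; apply: no.
exists (undup G)`_i, (undup G)`_j, u, v; rewrite -!(mem_undup G) !mem_nth //.
by rewrite nth_uniq ?undup_uniq.
Qed.

Lemma groebner_sub G G' : left_groebner a lte N G -> G =i G' -> left_groebner a lte N G'.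
Proof.
move=> [hG h] e; split=> [g|x Nx x0]; first by rewrite -e => /hG.
by have [g] := h x Nx x0; exists g; rewrite -?e.
Qed.

Lemma groebner_neq0 G : left_groebner a lte N G -> forall g, g \in G -> g != 0.
Proof. by case=> hG _ g /hG[]. Qed.

Lemma LM_family (G : seq 'rV[A]_s) : (forall g, g \in G -> g != 0) ->
  exists lm : 'I_(size G) -> 'X_{1..n} * 'I_s, forall l, LM a lte (row l (gmx G)) = Some (lm l).
Proof.
move=> hG.
have ex (l : 'I_(size G)) : exists u, LM a lte (row l (gmx G)) = Some u.
  by apply: (LM_Some solvA lteP); rewrite rowK hG // mem_nth.
exists (fun l => proj1_sig (constructive_indefinite_description _ (ex l))) => l.
exact: (proj2_sig (constructive_indefinite_description _ (ex l))).
Qed.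
End Basis.

(* Schreyer's argument: listing a Groebner basis by decreasing exponent of the
   j-th variable, the leading monomials of the syzygies s_ij avoid one more
   variable; with one variable left, a minimal basis has no critical pair. *)
Lemma pd_le_groebner k j : (j + k.+1 = n)%N ->
  forall s (lte : rel ('X_{1..n} * 'I_s)) (N : 'rV[A]_s -> Prop) G,
  left_monomial_ordering a lt lte -> submodule N -> left_groebner a lte N G ->
  (forall g u, g \in G -> LM a lte g = Some u ->
     forall v : 'I_n, (v < j)%N -> u.1 v = 0%N) ->
  pd_le k.+1 N.
Proof.
elim: k j => [|k IH] j jk s lte N G lteP subN gbG hG0.
  have [G' [sub gb' min]] := groebner_minimal lteP gbG.
  exists (size G'), (gmx G'); split; first exact: (groebner_span lteP subN gb').
  have [lm hlm] := LM_family lteP (groebner_neq0 gb').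
  move=> h h0; apply: NNPP => /eqP hn0.
  have schrP := schr_left_monomial_ordering solvA lteP lm.
  have [u hu] := LM_Some solvA schrP hn0.
  (* With no pair to treat, the empty list of syzygies suffices: the leading term of [h] would
     reappear in its image, which is 0. *)
  case: (LM_irreducible solvA lteP hlm (S := [::]) _ hu).
  - move=> i1 i2 lt12 e2; exfalso.
    have G'0 (l : 'I_(size G')) (v : 'I_n) : (v < j)%N -> (lm l).1 v = 0%N.
      apply: (hG0 G'`_l); first by apply: sub; apply: mem_nth.
      by have := hlm l; rewrite rowK.
    have le12 (l1 l2 : 'I_(size G')) : (lm l1).2 = (lm l2).2 ->
        (forall v : 'I_n, (j <= v)%N -> ((lm l1).1 v <= (lm l2).1 v)%N) -> dvdm (lm l1) (lm l2).
      move=> e h'; apply/andP; split; first exact/eqP.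
      apply/mnm_lepP => v; case: (ltnP v j) => [vj|/h' //]; by rewrite !G'0.
    have lastv (v1 v2 : 'I_n) : (j <= v1)%N -> (j <= v2)%N -> v1 = v2.
      move=> h1 h2; apply: val_inj => /=.
      have le_j (v : 'I_n) : (v <= j)%N by rewrite -ltnS (_ : j.+1 = n) // -jk addn1.
      by apply/eqP; rewrite eqn_leq (leq_trans (le_j v1) h2) (leq_trans (le_j v2) h1).
    have jn : (j < n)%N by rewrite -jk addn1.
    have [h12|h21] := leqP ((lm i1).1 (Ordinal jn)) ((lm i2).1 (Ordinal jn)).
      have := min i1 i2 (lm i1) (lm i2) (ltn_ord i1) (ltn_ord i2).
      rewrite ltn_eqF // le12 // => [/(_ isT)|v hv].
        by have := hlm i1; have := hlm i2; rewrite !rowK => -> -> /(_ erefl erefl).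
      by rewrite (lastv v (Ordinal jn)).
    have := min i2 i1 (lm i2) (lm i1) (ltn_ord i2) (ltn_ord i1).
    rewrite gtn_eqF // le12 // => [/(_ isT)|v hv].
      by have := hlm i1; have := hlm i2; rewrite !rowK => -> -> /(_ erefl erefl).
    by rewrite (lastv v (Ordinal jn)) //; apply: ltnW.
  - by case=> x [v []].
  - by rewrite h0 (LM0 solvA lteP).
have jn : (j < n)%N by rewrite -jk addnS ltnS leq_addr.
pose vj := Ordinal jn.
pose ex (g : 'rV[A]_s) := if LM a lte g is Some u then u.1 vj else 0%N.
pose leT (g h : 'rV[A]_s) := (ex h <= ex g)%N.
pose G' := sort leT G.
have memG' : G =i G' by move=> x; rewrite mem_sort.
have gb' := groebner_sub gbG memG'.
have [lm hlm] := LM_family lteP (groebner_neq0 gb').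
have schrP := schr_left_monomial_ordering solvA lteP lm.
exists (size G'), (gmx G'); split; first exact: (groebner_span lteP subN gb').
have lmG (l : 'I_(size G')) : LM a lte G'`_l = Some (lm l) by have := hlm l; rewrite rowK.
have exG (i1 i2 : 'I_(size G')) : (i1 < i2)%N -> ((lm i2).1 vj <= (lm i1).1 vj)%N.
  move=> lt12; have : leT G'`_i1 G'`_i2.
    apply: (@sorted_leq_nth _ leT _ _ 0 G' _ i1 i2); rewrite ?inE //; last exact: ltnW.
    - by move=> x y z h1 h2; apply: leq_trans h2 h1.
    - by move=> x; apply: leqnn.
    - by apply: sort_sorted => x y; apply: leq_total.
  by rewrite /leT /ex !lmG.
pose crit (ij : 'I_(size G') * 'I_(size G')) := (ij.1 < ij.2)%N && ((lm ij.1).2 == (lm ij.2).2).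
(* The property is guarded by [crit], with 0 as dummy witness elsewhere, so that choice yields a
   total function. *)
have exs ij : exists x : 'rV[A]_(size G'), crit ij -> x *m gmx G' = 0 /\
    LM a (schr lte lm) x = Some ((mlcm (lm ij.1).1 (lm ij.2).1 - (lm ij.1).1)%MM, ij.1).
  case: (boolP (crit ij)) => [/andP[lt12 /eqP e2]|]; last by exists 0.
  case: ij lt12 e2 => i1 i2 /= lt12 e2.
  have [es bs] := spolyE solvA lteP (hlm i1) (hlm i2) e2.
  set S := spoly a lte (row i1 (gmx G')) (row i2 (gmx G')) in es bs *.
  have NS : N S.
    have Nr l : N (row l (gmx G')).
      by rewrite rowK; case: gb' => /(_ G'`_l) h _; case: h; rewrite ?mem_nth.
    rewrite es; apply: submoduleB => //; rewrite -[_ *: _]addr0;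
      by case: subN => N0 hN; apply: hN.
  have [q [eta d]] := division_exists solvA lteP G' S.
  have eta0 := groebner_division lteP subN gb' NS d.
  exists (pair_syz a lte (gmx G') i1 i2 q) => _; split.
    rewrite (pair_syz_mul solvA lteP hlm e2) -/S [X in _ - X](division_sum d) eta0 addr0.
    by rewrite subrr.
  apply: (LM_pair_syz solvA lteP hlm lt12 e2) => w cw.
  (* The S-polynomial lies strictly below the lcm, and so does every product used in dividing it. *)
  have [||v hv] := division_tops solvA lteP (P := fun v => lte v (lcmij lm i1 i2)) _ d _ cw.
  - by move=> u1 u2 h1 h2; apply: (lte_trans lteP h2 h1).
  - exact: bs.
  - by rewrite lmG in hv; case: hv => <-.
pose sy ij := proj1_sig (constructive_indefinite_description _ (exs ij)).
have syP ij : crit ij -> sy ij *m gmx G' = 0 /\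
    LM a (schr lte lm) (sy ij) = Some ((mlcm (lm ij.1).1 (lm ij.2).1 - (lm ij.1).1)%MM, ij.1).
  exact: (proj2_sig (constructive_indefinite_description _ (exs ij))).
pose S := [seq sy ij | ij <- enum predT & crit ij].
have SP x : x \in S -> x *m gmx G' = 0.
  by case/mapP=> ij; rewrite mem_filter => /andP[/syP[h _] _] ->.
have Spairs (i1 i2 : 'I_(size G')) : (i1 < i2)%N -> (lm i1).2 = (lm i2).2 ->
    exists2 x, x \in S & LM a (schr lte lm) x = Some ((mlcm (lm i1).1 (lm i2).1 - (lm i1).1)%MM, i1).
  move=> lt12 e2; have c12 : crit (i1, i2) by rewrite /crit /= lt12 e2 eqxx.
  exists (sy (i1, i2)); last by case: (syP _ c12).
  by apply/mapP; exists (i1, i2); rewrite // mem_filter c12 mem_enum.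
apply: (IH j.+1 _ _ (schr lte lm) _ [seq x <- S | x != 0]).
- by rewrite addSn -addnS.
- exact: schrP.
- exact: submodule_ker.
- exact: (schreyer_groebner solvA lteP hlm SP Spairs).
move=> x u; rewrite mem_filter => /andP[_ /mapP[[i1 i2]]].
rewrite mem_filter => /andP[cij _] -> hu v.
have [_] := syP _ cij; rewrite hu => -[->] /=.
move: cij => /andP[/= lt12 _]; rewrite ltnS leq_eqVlt => /orP[/eqP ev|lv].
  (* By the decreasing sort the lcm takes its exponent at [vj] from the first member of the pair, so
     the difference is 0 there. *)
  have -> : v = vj by apply: val_inj.
  by rewrite mnmBE mnmE; apply/eqP; rewrite subn_eq0 geq_max leqnn exG.
rewrite mnmBE mnmE.
have z l : (lm l).1 v = 0%N.
  by apply: (hG0 G'`_l (lm l)) => //; rewrite memG' mem_nth.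
by rewrite !z.
Qed.
End GroebnerResolution.

(** * Comparison of a resolution with a minimal one *)

Section Comparison.
Variables (K : fieldType) (n : nat) (A : algType K) (a : 'I_n -> A).
Hypothesis pbwA : pbw_basis a.
Variable wt : 'I_n -> nat.
Hypothesis gradA : graded_algebra a wt.

(* Chain maps alpha, beta between the two resolutions and a homotopy h from
   alpha beta to 1: modulo A_+ the differentials of the minimal resolution
   vanish, so alpha beta becomes the identity there. *)
Lemma minimal_rank_pd k : forall (r : nat -> nat) (D : forall i, 'M[A]_(r i.+1, r i)),
  (forall i (x : 'rV_(r i.+1)), x *m D i = 0 <-> exists y : 'rV_(r i.+2), y *m D i.+1 = x) ->
  (forall i, epsmx a (D i) = 0) ->
  forall t (output_row_space : 'rV[A]_t -> Prop) (alpha : 'M_(r 0%N, t)) (beta : 'M_(t, r 0%N))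
    (h : 'M_(r 0%N, r 1%N)),
  pd_le k output_row_space ->
  (forall y : 'rV_(r 1%N), output_row_space (y *m D 0%N *m alpha)) ->
  (forall x, output_row_space x -> exists y : 'rV_(r 1%N), y *m D 0%N = x *m beta) ->
  D 0%N *m (alpha *m beta - 1%:M - h *m D 0%N) = 0 ->
  r k.+1 = 0%N.
Proof.
have homotopy (r : nat -> nat) (D : forall i, 'M[A]_(r i.+1, r i)) (B : 'M[A]_(r 1%N)) :
    (forall i (x : 'rV_(r i.+1)), x *m D i = 0 <-> exists y : 'rV_(r i.+2), y *m D i.+1 = x) ->
    B *m D 0%N = 0 -> exists H, H *m D 1%N = B.
  move=> ex hB; apply: row_lift => i; apply/ex.
  by rewrite -row_mul hB row0.
elim: k => [|k IH] r D ex epsD t output_row_space alpha beta h.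
  move=> NG0 hal _ hh.
  have Dal : D 0%N *m alpha = 0.
    apply/row_matrixP => i; rewrite row0 -[D 0%N]mul1mx -mulmxA row_mul mulmxA.
    exact: NG0.
  (* Since D 0 alpha = 0, the homotopy relation reads (1 + D 0 h) D 0 = 0. Lifting through D 1 and
     reducing by [eps] turns the identity matrix of size r 1 into 0. *)
  have [|H eH] := homotopy r D (1%:M + D 0%N *m h) ex.
    apply/eqP; rewrite -oppr_eq0; apply/eqP; rewrite -hh !mulmxBr mulmxA Dal mul0mx sub0r mulmx1.
    by rewrite mulmxDl mul1mx opprD mulmxA.
  have := congr1 (fun B => epsmx a B) eH.
  rewrite (epsmxM pbwA gradA) epsD mulmx0 (epsmxD pbwA) (epsmx1 pbwA) (epsmxM pbwA gradA) epsD mul0mx addr0.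
  case: (posnP (r 1%N)) => // r1 /matrixP/(_ (Ordinal r1) (Ordinal r1))/eqP.
  by rewrite !mxE eqxx eq_sym oner_eq0.
case=> u [g [hg pdg]] hal hbe hh.
(* One more square of the comparison: [alpha1] and [beta1] lie over [alpha] and [beta], and [H]
   lifts alpha1 beta1 - 1 - D 0 h through D 1. The leftover D 0 h is killed by composing with D 1,
   which is why the relation is required only in that form. *)
have [|alpha1 ea] := @row_lift _ _ _ _ g (D 0%N *m alpha).
  by move=> i; apply/hg; rewrite -[D 0%N]mul1mx -mulmxA row_mul mulmxA.
have [|beta1 eb] := @row_lift _ _ _ _ (D 0%N) (g *m beta).
  by move=> i; rewrite row_mul; apply: hbe; apply/hg; exists (delta_mx 0 i); rewrite -rowE.
have [|H eH] := homotopy r D (alpha1 *m beta1 - 1%:M - D 0%N *m h) ex.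
  by rewrite !mulmxBl -[alpha1 *m beta1 *m _]mulmxA eb [alpha1 *m (_ *m _)]mulmxA ea mul1mx
    -hh !mulmxBr mulmx1 !mulmxA.
have DD i : D i.+1 *m D i = 0.
  apply/row_matrixP => l; rewrite row_mul row0; apply/ex; exists (delta_mx 0 l).
  by rewrite -rowE.
apply: (IH (fun i => r i.+1) (fun i => D i.+1) _ _ u _ alpha1 beta1 H pdg).
- by move=> i x; apply: ex.
- by move=> i; apply: epsD.
- by move=> y; rewrite -!mulmxA ea [D 1%N *m _]mulmxA DD mul0mx mulmx0.
- by move=> x hx; apply/ex; rewrite -mulmxA eb mulmxA hx mul0mx.
- by rewrite eH opprB addrC subrK mulmxA DD mul0mx.
Qed.
End Comparison.

(** * Algorithm-MINHGS *)

Lemma terminates_output T (step : T -> T -> Prop) (final : T -> Prop) x :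
  terminates step final x -> exists y, outputs step final x y.
Proof.
case=> acc; elim: x / acc => x _ IH prog.
have [fx|[y xy]] := prog x (rt_refl _ _ _); first by exists x; split=> //; apply: rt_refl.
have [|z [yz fz]] := IH y xy.
  by move=> z yz; apply: prog; apply: rt_trans yz; apply: rt_step.
by exists z; split=> //; apply: rt_trans yz; apply: rt_step.
Qed.

Lemma reach_invariant T (step : T -> T -> Prop) (P : T -> Prop) x y :
  (forall y z, P y -> step y z -> P z) -> clos_refl_trans T step x y -> P x -> P y.
Proof.
by move=> h; elim=> {x y} [x y xy Px|//|x y z _ IH1 _ IH2 /IH1 //]; apply: h xy.
Qed.

Section Minhgs.
Variables (K : fieldType) (n : nat) (A : algType K) (a : 'I_n -> A).
Variable lt : rel 'X_{1..n}.
Hypothesis solvA : solvable_polynomial_algebra a lt.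
Variable wt : 'I_n -> nat.
Variables (s : nat) (b : 'I_s -> nat) (lte : rel ('X_{1..n} * 'I_s)).
Hypothesis lteP : left_monomial_ordering a lt lte.
Variable U : seq 'rV[A]_s.

Let pbwA : pbw_basis a. Proof. by case: solvA. Qed.
Local Notation LM := (LM a lte).
Local Notation divide Xi x q eta := (@division K n A a s lte Xi x q eta).
Local Notation dgr := (dgr a wt b).
Local Notation step := (hgs_step a wt b lte (U := U)).
Local Notation state := (hgs_state U).
Local Notation pair_spoly := (pair_spoly a lte).

(** Lexicographic descent. Appending to [hG] is well-founded by Dickson's lemma, a remainder being
    irreducible. For fixed [hG] a selection shrinks S and W, since its degree is attained, and the
    remaining steps shrink S_p and W_p. *)
Lemma hgs_step_acc (st : state) : Acc (fun y z => step z y) st.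
Proof.
pose P (g x : 'rV[A]_s) := exists u v, [/\ LM g = Some u, LM x = Some v & dvdm u v].
have wf : well_founded (fun G' G : seq 'rV[A]_s => exists x,
    [/\ G' = rcons G x, x != 0 & forall g, g \in G -> ~ P g x]).
  apply: rcons_bad_wf => x hx.
  have ex i : exists u, LM (x i) = Some u by apply: (LM_Some solvA lteP).
  pose u i := proj1_sig (constructive_indefinite_description _ (ex i)).
  have uP i : LM (x i) = Some (u i).
    exact: (proj2_sig (constructive_indefinite_description _ (ex i))).
  have [i [j [ij d]]] := dickson u; exists i, j; split=> //.
  by exists (u i), (u j).
have [G eG0] : exists G, hG st = G by exists (hG st).
move: st eG0; elim/(well_founded_ind wf): G => G IHG st eG0; move: eG0.
have [m] := ubnP (size (hS st) + size (hW st)); elim: m st => [st|m IHm st hm]; first by rewrite ltn0.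
have [k] := ubnP (size (hSp st) + size (hWp st)); elim: k st hm => [st _|k IHk st hm hk eG]; first by rewrite ltn0.
constructor=> st' h; move: hm hk eG.
have newG G0 x q eta : divide G0 x q eta -> eta != 0 -> exists x,
    [/\ rcons G0 eta = rcons G0 x, x != 0 & forall g, g \in G0 -> ~ P g x].
  move=> d e0; exists eta; split=> // g gG [u [v [hu hv dv]]].
  have ix : (index g G0 < size G0)%N by rewrite index_mem.
  have /(LMP lteP)[cv _] := hv.
  have := division_irred solvA lteP d cv.
  by move/(_ (Ordinal ix) u); rewrite /= nth_index // dv => /(_ hu).
have szrem (T : eqType) (x : T) r : x \in r -> (size (rem x r)).+1 = size r.
  by move=> xr; rewrite size_rem // prednK //; case: r xr.
case: h => {st st'} [S W G0 V T M p degs pd _|S W Sp Wp G0 V T M ij q ijS d|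
  S W Sp Wp G0 V T M ij q eta ijS d e0 gi gj|S W Wp G0 V T M j q jW d|S W Wp G0 V T M j q eta jW d e0] /= hm hk eG.
- apply: IHm => //=; rewrite -ltnS; apply: leq_trans hm; rewrite ltnS.
  rewrite -(count_predC (fun ij => dgr (pair_spoly G0 ij) == p) S).
  rewrite -(count_predC (fun j : 'I_(size U) => dgr U`_j == p) W).
  rewrite !size_filter addnACA -[X in (X < _)%N]add0n ltn_add2r addn_gt0 -!has_count.
  move: pd; rewrite /degs mem_cat => /orP[/mapP[ij ijS ->]|/mapP[j jW ->]].
    by apply/orP; left; apply/hasP; exists ij.
  by apply/orP; right; apply/hasP; exists j.
- by apply: IHk => //=; move: hk; rewrite -(szrem _ _ _ ijS) addSn ltnS.
- by apply: (IHG (rcons G0 eta)) => //; rewrite -eG; apply: newG d e0.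
- by apply: IHk => //=; move: hk; rewrite -(szrem _ _ _ jW) addnS ltnS.
- by apply: (IHG (rcons G0 eta)) => //; rewrite -eG; apply: newG d e0.
Qed.

Lemma hgs_step_progress (st : state) : hgs_final st \/ exists st', step st st'.
Proof.
case: st => S W [|ij Sp] Wp G V T M; last first.
  right; have [q [eta d]] := division_exists solvA lteP G (pair_spoly G ij).
  case: (eqVneq eta 0) => [e|e].
    by eexists; apply: Hgs_spair_zero; [exact: mem_head|rewrite e in d; exact: d].
  by eexists; apply: Hgs_spair_new; [exact: mem_head|exact: d|exact: e].
case: Wp => [|j Wp]; last first.
  right; have [q [eta d]] := division_exists solvA lteP G U`_j.
  case: (eqVneq eta 0) => [e|e].
    by eexists; apply: Hgs_gen_zero; [exact: mem_head|rewrite e in d; exact: d].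
  by eexists; apply: Hgs_gen_new; [exact: mem_head|exact: d|exact: e].
pose degs := [seq dgr (pair_spoly G ij) | ij <- S] ++ [seq dgr U`_j | j : 'I_(size U) <- W].
case E: degs => [|p0 r].
  by left; case: S W @degs E => [|ij S] [|j W].
have exp0 : exists p, p \in degs by exists p0; rewrite E mem_head.
right; case: (ex_minnP exp0) => p pd min; eexists.
by apply: Hgs_select pd _; apply/allP.
Qed.

Lemma hgs_terminates : terminates step (@hgs_final K A s U) (hgs_init U).
Proof. by split=> [|y _]; [apply: hgs_step_acc|apply: hgs_step_progress]. Qed.
End Minhgs.

(** * Degrees and constant terms of the data recorded by Algorithm-MINHGS *)

Section MinhgsInvariant.
Variables (K : fieldType) (n : nat) (A : algType K) (a : 'I_n -> A).
Variable lt : rel 'X_{1..n}.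
Hypothesis solvA : solvable_polynomial_algebra a lt.
Variable wt : 'I_n -> nat.
Hypothesis gradA : graded_algebra a wt.
Variables (s : nat) (b : 'I_s -> nat) (lte : rel ('X_{1..n} * 'I_s)).
Hypothesis lteP : left_monomial_ordering a lt lte.
Variable U : seq 'rV[A]_s.
Hypothesis hU : forall x, x \in U -> nz_homog a wt b x.

Let pbwA : pbw_basis a. Proof. by case: solvA. Qed.
Local Notation LM := (LM a lte).
Local Notation divide Xi x q eta := (@division K n A a s lte Xi x q eta).
Local Notation dgr := (dgr a wt b).
Local Notation homogb := (homogL a wt b).
Local Notation step := (hgs_step a wt b lte (U := U)).
Local Notation state := (hgs_state U).
Local Notation pair_spoly := (pair_spoly a lte).
Local Notation scoef := (scoef a lte).
Local Notation same_component := (same_component a lte).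
Implicit Types (S Sp : seq (nat * nat)) (W Wp M : seq 'I_(size U))
  (G : seq 'rV[A]_s) (V : seq 'rV[A]_(size U))
  (T : seq ((nat * nat) * seq A)).

Definition gen_degree (j : 'I_(size U)) : nat := dgr U`_j.
Local Notation homogU := (homogL a wt gen_degree).

Lemma LM_degree p x u : homogb p x -> LM x = Some u -> (wdeg wt u.1 + b u.2 = p)%N.
Proof. by move=> /homogLP h /(LMP lteP)[/h]. Qed.

Lemma wdeg_mlcm (al be : 'X_{1..n}) :
  (wdeg wt (mlcm al be - al)%MM + wdeg wt al = wdeg wt (mlcm al be))%N.
Proof. by rewrite -wdegD submK // lem_mlcml. Qed.

(** The cofactor of a^be in the lcm differs from 1, hence has positive degree. *)
Lemma wdeg_mlcm_gt (al be : 'X_{1..n}) : ~~ (al <= be)%MM ->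
  (wdeg wt be < wdeg wt (mlcm al be))%N.
Proof.
move=> h; rewrite mlcmC mlcmE wdegD -[X in (X < _)%N]addn0 ltn_add2l lt0n.
rewrite (wdeg_eq0 gradA); apply: contraNneq h => e; apply/mnm_lepP => i.
by move/mnmP/(_ i): e; rewrite mnmBE mnm0E => /eqP.
Qed.

Lemma same_componentP x y u w : LM x = Some u -> LM y = Some w ->
  same_component x y = (u.2 == w.2).
Proof. by move=> hx hy; rewrite /Defs.same_component hx hy. Qed.

Lemma scoef_homog x y u w : LM x = Some u -> LM y = Some w ->
  homogA a wt (wdeg wt (mlcm u.1 w.1 - u.1)%MM) (scoef x y).
Proof.
by move=> hx hy; rewrite /Defs.scoef hx hy; apply: homogAZ => //; apply: homogA_mon.
Qed.

Lemma scoef_row_homog t (c : 'I_t -> nat) x y u w v : homogb (dgr x) x ->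
  LM x = Some u -> LM y = Some w -> homogL a wt c (dgr x) v ->
  homogL a wt c (wdeg wt (mlcm u.1 w.1) + b u.2)%N (scoef x y *: v).
Proof.
move=> hx hu hw hv; rewrite -wdeg_mlcm -addnA (LM_degree hx hu).
by apply: homogLM => //; apply: scoef_homog.
Qed.

Lemma spoly_homog x y u w : homogb (dgr x) x -> homogb (dgr y) y ->
  LM x = Some u -> LM y = Some w -> u.2 = w.2 ->
  homogb (wdeg wt (mlcm u.1 w.1) + b u.2)%N (spoly a lte x y).
Proof.
move=> hx hy hu hw e; have [-> _] := spolyE solvA lteP hu hw e.
apply: homogLB => //; first exact: scoef_row_homog.
by rewrite mlcmC e; apply: scoef_row_homog.
Qed.

(** The entry at [j] is homogeneous of degree [q] minus that of the j-th generator. Here degrees are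
    turned into vanishing under [eps]. *)
Lemma eps_entry q (v : 'rV[A]_(size U)) j : homogU q v -> (gen_degree j < q)%N ->
  eps a (v 0 j) = 0.
Proof.
move=> hv ltq; case: (eqVneq (v 0 j) 0) => [->|v0]; first exact: eps0.
have [le h] := homogL_entry pbwA hv v0.
by apply: (eps_homog h); rewrite subn_gt0.
Qed.

(** The last clause confines the rows of V to U_min, so that its columns can be restricted later
    without loss. *)
Definition base_ok G V M : Prop := size V = size G /\
  forall l, (l < size G)%N -> [/\ G`_l != 0, homogb (dgr G`_l) G`_l,
    homogU (dgr G`_l) V`_l, V`_l *m gmx U = G`_l &
    forall j, j \notin M -> V`_l 0 j = 0].

(** Required of all critical pairs, including those with zero S-polynomial, which are never recorded
    but still contribute rows to S_{r x t}. *)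
Definition pairs_ok G V : Prop := forall i j, (i < j)%N -> (j < size G)%N ->
  same_component G`_i G`_j -> forall k,
  eps a ((scoef G`_i G`_j *: V`_i) 0 k) = 0 /\ eps a ((scoef G`_j G`_i *: V`_j) 0 k) = 0.

(** The recorded list is padded by zeros to the current length of [G], so a record keeps its meaning
    while [G] grows. *)
Definition rec_ok G V (e : (nat * nat) * seq A) : Prop :=
  [/\ (e.1.1 < e.1.2)%N, (e.1.2 < size G)%N, (size e.2 <= size G)%N,
    divide G (pair_spoly G e.1) (\row_l e.2`_l) 0 &
    forall k, eps a ((\sum_(l < size e.2) e.2`_l *: V`_l) 0 k) = 0].

Definition lift_row V t (q : 'rV[A]_t) : 'rV[A]_(size U) := \sum_(l < t) q 0 l *: V`_l.

(** The clause for members of U_min is the source of the identity U_{m x t} V_{t x m} = 1 restricted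
    to U_min. *)
Definition gen_ok G V M (j : 'I_(size U)) : Prop := exists q,
  divide G U`_j q 0 /\ (j \in M -> lift_row V q = delta_mx 0 j).

Lemma liftE V t (q : 'rV[A]_t) : lift_row V q = q *m \matrix_(l < t) V`_l.
Proof. by rewrite mulmx_sum_row; apply: eq_bigr => l _; rewrite rowK. Qed.

Section Lift.
Variables (G : seq 'rV[A]_s) (V : seq 'rV[A]_(size U)) (M : seq 'I_(size U)).
Hypothesis bGV : base_ok G V M.

Lemma lift_homog p (q : 'rV[A]_(size G)) :
  homogL a wt (fun l : 'I_(size G) => dgr G`_l) p q -> homogU p (lift_row V q).
Proof.
move=> hq; rewrite liftE; apply: (homogL_mulmx pbwA gradA hq) => l.
by rewrite rowK; case: bGV => _ /(_ l (ltn_ord l))[].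
Qed.

Lemma lift_supp (q : 'rV[A]_(size G)) (j : 'I_(size U)) : j \notin M -> lift_row V q 0 j = 0.
Proof.
move=> jM; rewrite /lift_row summxE big1 // => l _; rewrite mxE.
by case: bGV => _ /(_ l (ltn_ord l))[_ _ _ _ ->] //; rewrite mulr0.
Qed.

Lemma lift_mul (q : 'rV[A]_(size G)) : lift_row V q *m gmx U = q *m gmx G.
Proof.
rewrite liftE -mulmxA; congr (_ *m _); apply/row_matrixP => l.
by rewrite row_mul !rowK; case: bGV => _ /(_ l (ltn_ord l))[].
Qed.

Lemma remainder_homog p x q eta : homogb p x -> divide G x q eta ->
  homogb p eta /\ homogL a wt (fun l : 'I_(size G) => dgr G`_l) p q.
Proof.
move=> hx d; apply: (division_homog solvA lteP gradA _ d hx) => l.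
by case: bGV => _ /(_ l (ltn_ord l))[].
Qed.

Lemma base_LM l : (l < size G)%N -> exists u, LM G`_l = Some u.
Proof.
by move=> lG; apply: (LM_Some solvA lteP); case: bGV => _ /(_ l lG)[].
Qed.
End Lift.

Lemma nth_row_rcons t (q : 'rV[A]_t) (x : A) l :
  (rcons (row_seq q) x)`_l = if (l < t)%N then (row_seq q)`_l else if l == t then x else 0.
Proof. by rewrite nth_rcons size_row_seq. Qed.

Section Extend.
Variables (G : seq 'rV[A]_s) (V : seq 'rV[A]_(size U)) (M M' : seq 'I_(size U)).
Variables (eta : 'rV[A]_s) (v : 'rV[A]_(size U)) (p : nat).
Hypotheses (bGV : base_ok G V M) (MM' : {subset M <= M'}).
Hypotheses (eta0 : eta != 0) (heta : homogb p eta) (hv : homogU p v).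
Hypotheses (veta : v *m gmx U = eta) (vM' : forall j : 'I_(size U), j \notin M' -> v 0 j = 0).

Local Notation G' := (rcons G eta).
Local Notation V' := (rcons V v).

Lemma nthG l : (l < size G)%N -> G'`_l = G`_l.
Proof. by move=> h; rewrite nth_rcons h. Qed.

Lemma nthV l : (l < size G)%N -> V'`_l = V`_l.
Proof. by case: bGV => e _ h; rewrite nth_rcons e h. Qed.

Lemma lastG : G'`_(size G) = eta.
Proof. by rewrite nth_rcons ltnn eqxx. Qed.

Lemma lastV : V'`_(size G) = v.
Proof. by case: bGV => e _; rewrite nth_rcons e ltnn eqxx. Qed.

Lemma base_extend : base_ok G' V' M'.
Proof.
have [e h] := bGV; split; first by rewrite !size_rcons e.
move=> l; rewrite size_rcons ltnS leq_eqVlt => /orP[/eqP ->|lG].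
  by rewrite lastG lastV (dgr_homog pbwA eta0 heta).
rewrite nthG // nthV //; have [h1 h2 h3 h4 h5] := h l lG.
by split=> // j jM; apply: h5; apply: contra jM; apply: MM'.
Qed.

Lemma pair_spoly_extend ij : (ij.1 < size G)%N -> (ij.2 < size G)%N ->
  pair_spoly G' ij = pair_spoly G ij.
Proof. by move=> h1 h2; rewrite /Defs.pair_spoly !nthG. Qed.

Lemma lift_extend (q : 'rV[A]_(size G)) :
  lift_row V' (\row_(l < size G') (row_seq q)`_l) = lift_row V q.
Proof.
rewrite /lift_row (eq_bigr (fun l : 'I_(size G') => (row_seq q)`_l *: V'`_l)); last first.
  by move=> l _; rewrite mxE.
rewrite size_rcons big_ord_recr /= [(row_seq q)`_(size G)]nth_default ?size_row_seq //.
rewrite scale0r addr0; apply: eq_bigr => l _.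
by rewrite nth_row_seq nthV.
Qed.

Lemma divide_extend x q : divide G x q 0 ->
  divide G' x (\row_(l < size G') (row_seq q)`_l) 0.
Proof. by rewrite -cats1; apply: (division_ext0 solvA lteP). Qed.

Lemma rec_extend e : rec_ok G V e -> rec_ok G' V' e.
Proof.
case: e => ij r [/= h1 h2 h3 h4 h5]; split=> //=.
- by rewrite size_rcons ltnS ltnW.
- by rewrite size_rcons leqW.
- rewrite pair_spoly_extend ?(ltn_trans h1) //.
  move/divide_extend: h4; congr (division _ _ _ _ _); apply/rowP => l; rewrite !mxE.
  case: (ltnP l (size G)) => lG; first by rewrite (nth_row_seq _ (Ordinal lG)) mxE.
  by rewrite !nth_default ?size_row_seq // (leq_trans h3).
- move=> k; have -> : \sum_(l < size r) r`_l *: V'`_l = \sum_(l < size r) r`_l *: V`_l.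
    by apply: eq_bigr => l _; rewrite nthV // (leq_trans (ltn_ord l)).
  exact: h5.
Qed.

Lemma gen_extend j : (j \in M' -> j \in M) -> gen_ok G V M j -> gen_ok G' V' M' j.
Proof.
move=> hj [q [d h]]; exists (\row_(l < size G') (row_seq q)`_l).
by split; [apply: divide_extend|move/hj => /h; rewrite lift_extend].
Qed.

Lemma divide_new x q : divide G x q eta ->
  divide G' x (\row_(l < size G') (rcons (row_seq q) 1)`_l) 0.
Proof.
move=> d; have := division_new solvA lteP d eta0.
rewrite -cats1; congr (division _ _ _ _ _); apply/rowP => l; rewrite !mxE eqxx /=.
rewrite nth_row_rcons -val_eqE /=; case: (ltngtP l (size G)) => h.
- exact: addr0.
- by rewrite [X in X + _]nth_default ?size_row_seq ?(ltnW h) //; apply: addr0.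
- by rewrite [X in X + _]nth_default ?size_row_seq ?h //; apply: add0r.
Qed.

Lemma sum_new (q : 'rV[A]_(size G)) :
  \sum_(l < size (rcons (row_seq q) 1)) (rcons (row_seq q) 1)`_l *: V'`_l = lift_row V q + v.
Proof.
rewrite size_rcons size_row_seq big_ord_recr /= nth_row_rcons ltnn eqxx scale1r lastV.
congr (_ + _); apply: eq_bigr => l _.
by rewrite nth_row_rcons ltn_ord nth_row_seq nthV.
Qed.

Lemma lift_new (q : 'rV[A]_(size G)) :
  lift_row V' (\row_(l < size G') (rcons (row_seq q) 1)`_l) = lift_row V q + v.
Proof.
rewrite -sum_new /lift_row (eq_bigr (fun l : 'I_(size G') => (rcons (row_seq q) 1)`_l *: V'`_l)).
  by rewrite !size_rcons size_row_seq.
by move=> l _; rewrite mxE.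
Qed.

Hypothesis irr : forall u w l, (l < size G)%N -> LM G`_l = Some u ->
  LM eta = Some w -> ~~ dvdm u w.

Lemma lcm_degree_gt i u w : (i < size G)%N -> LM G`_i = Some u -> LM eta = Some w ->
  u.2 = w.2 -> (p < wdeg wt (mlcm u.1 w.1) + b u.2)%N.
Proof.
move=> iG hu hw e; rewrite -(LM_degree heta hw) -e ltn_add2r; apply: wdeg_mlcm_gt.
by have := irr iG hu hw; rewrite /dvdm e eqxx.
Qed.

(** No earlier leading monomial divides that of the remainder, so each new lcm has degree larger
    than [p]. The members of U_min have degree at most [p], hence the lifted multiples have entries
    of positive degree at these places and 0 at the others. *)
Lemma pairs_extend : pairs_ok G V -> (forall j : 'I_(size U), j \in M' -> (gen_degree j <= p)%N) ->
  pairs_ok G' V'.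
Proof.
move=> hp hM' i j ij; rewrite size_rcons ltnS leq_eqVlt => /orP[/eqP ej|jG]; last first.
  by rewrite !nthG ?(ltn_trans ij) // !nthV ?(ltn_trans ij) //; apply: hp.
rewrite ej in ij *; rewrite lastG lastV nthG // nthV // => sc k.
have [u hu] := base_LM bGV ij; have [w hw] := LM_Some solvA lteP eta0.
have e2 : u.2 = w.2 by move: sc; rewrite (same_componentP hu hw) => /eqP.
have deg := lcm_degree_gt ij hu hw e2.
have [_ /(_ i ij)[_ hG hVi _ sV]] := bGV.
case: (boolP (k \in M')) => kM'; last first.
  rewrite !mxE (vM' kM') sV ?mulr0 ?eps0 //.
  by apply: contra kM'; apply: MM'.
have ltk := leq_ltn_trans (hM' k kM') deg; split.
  exact: eps_entry (scoef_row_homog hG hu hw hVi) ltk.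
have ep := dgr_homog pbwA eta0 heta.
apply: (@eps_entry (wdeg wt (mlcm w.1 u.1) + b w.2)).
  by apply: scoef_row_homog hw hu _; rewrite ep.
by rewrite mlcmC -e2.
Qed.

(** The degree exceeding [p] puts new pairs into a later selection, never into the one being
    processed. *)
Lemma new_pairsP ij : ij \in new_pairs a lte G eta -> exists i u w,
  [/\ ij = (i, size G), (i < size G)%N, LM G`_i = Some u, LM eta = Some w &
   [/\ u.2 = w.2, pair_spoly G' ij != 0, same_component G'`_(ij.1) G'`_(ij.2) &
    (p < dgr (pair_spoly G' ij))%N]].
Proof.
case/mapP=> i; rewrite mem_filter mem_iota add0n => /andP[/andP[sc s0] /= iG] ->.
have [u hu] := base_LM bGV iG; have [w hw] := LM_Some solvA lteP eta0.
have e2 : u.2 = w.2 by move: sc; rewrite (same_componentP hu hw) => /eqP.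
exists i, u, w; rewrite /Defs.pair_spoly /= lastG nthG //; split=> //; split=> //.
have [_ /(_ i iG)[_ hG _ _ _]] := bGV.
have ep := dgr_homog pbwA eta0 heta.
rewrite (dgr_homog pbwA s0 (spoly_homog hG _ hu hw e2)) ?ep //.
exact: lcm_degree_gt iG hu hw e2.
Qed.
End Extend.
End MinhgsInvariant.

(** * Preservation of the invariant by each step of Algorithm-MINHGS *)

Section MinhgsStep.
Variables (K : fieldType) (n : nat) (A : algType K) (a : 'I_n -> A).
Variable lt : rel 'X_{1..n}.
Hypothesis solvA : solvable_polynomial_algebra a lt.
Variable wt : 'I_n -> nat.
Hypothesis gradA : graded_algebra a wt.
Variables (s : nat) (b : 'I_s -> nat) (lte : rel ('X_{1..n} * 'I_s)).
Hypothesis lteP : left_monomial_ordering a lt lte.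
Variable U : seq 'rV[A]_s.
Hypothesis hU : forall x, x \in U -> nz_homog a wt b x.

Let pbwA : pbw_basis a. Proof. by case: solvA. Qed.
Local Notation LM := (LM a lte).
Local Notation divide Xi x q eta := (@division K n A a s lte Xi x q eta).
Local Notation dgr := (dgr a wt b).
Local Notation homogb := (homogL a wt b).
Local Notation step := (hgs_step a wt b lte (U := U)).
Local Notation state := (hgs_state U).
Local Notation pair_spoly := (pair_spoly a lte).
Local Notation same_component := (same_component a lte).
Local Notation dU := (gen_degree a wt b (U := U)).
Local Notation homogU := (homogL a wt dU).

(** [p] is one more than the degree being processed, so 0 describes the initial state. [inv_dMp]
    encodes the order of the two WHILE loops: while a pair of the current degree is pending, no
    generator of that degree has been accepted. *)
Record hgs_inv (st : state) (p : nat) : Prop := HgsInv {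
  inv_base : base_ok a wt b (hG st) (hV st) (hmin st);
  inv_pairs : pairs_ok a lte (hG st) (hV st);
  inv_recs : forall e, e \in hQ st -> rec_ok a lte (hG st) (hV st) e;
  inv_S : forall ij, ij \in hS st ++ hSp st ->
    [/\ (ij.1 < ij.2)%N, (ij.2 < size (hG st))%N & pair_spoly (hG st) ij != 0];
  inv_all : forall ij, (ij.1 < ij.2)%N -> (ij.2 < size (hG st))%N ->
    pair_spoly (hG st) ij != 0 ->
    ij \in hS st ++ hSp st \/ ij \in [seq e.1 | e <- hQ st];
  inv_gens : forall j : 'I_(size U), j \in hW st ++ hWp st \/
    gen_ok a lte (hG st) (hV st) (hmin st) j;
  inv_uniq : uniq (hW st ++ hWp st ++ hmin st);
  inv_dSp : forall ij, ij \in hSp st -> (dgr (pair_spoly (hG st) ij)).+1 = p;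
  inv_dWp : forall j : 'I_(size U), j \in hWp st -> (dU j).+1 = p;
  inv_dS : forall ij, ij \in hS st -> (p <= dgr (pair_spoly (hG st) ij))%N;
  inv_dW : forall j : 'I_(size U), j \in hW st -> (p <= dU j)%N;
  inv_dM : forall j : 'I_(size U), j \in hmin st -> (dU j < p)%N;
  inv_dMp : hSp st != [::] -> forall j : 'I_(size U), j \in hmin st -> ((dU j).+1 < p)%N }.

Lemma hgs_inv_init : hgs_inv (hgs_init U) 0.
Proof.
split=> //=.
- by move=> j; left; rewrite cats0 mem_enum.
- by rewrite !cats0 enum_uniq.
Qed.

Lemma spoly_neq0_component x y : spoly a lte x y != 0 -> same_component x y.
Proof. by rewrite /spoly; case: ifP; rewrite ?eqxx. Qed.

Lemma mem_rem_or (T : eqType) (x y : T) r : x \in r -> y \in r -> y = x \/ y \in rem x r.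
Proof.
move=> xr; rewrite (perm_mem (perm_to_rem xr)) inE => /orP[/eqP|]; [by left|by right].
Qed.

Lemma sum_row_seq (V : seq 'rV[A]_(size U)) m (q : 'rV[A]_m) :
  \sum_(l < size (row_seq q)) (row_seq q)`_l *: V`_l = lift_row V q.
Proof.
rewrite /lift_row size_row_seq; apply: eq_bigr => l _; by rewrite nth_row_seq.
Qed.

Section SPair.
Variables (G : seq 'rV[A]_s) (V : seq 'rV[A]_(size U)) (M : seq 'I_(size U)).
Hypothesis bGV : base_ok a wt b G V M.
Variable ij : nat * nat.
Hypotheses (ltij : (ij.1 < ij.2)%N) (ijG : (ij.2 < size G)%N)
  (s0 : pair_spoly G ij != 0).

Lemma pair_facts : let d := dgr (pair_spoly G ij) in
  [/\ homogb d (pair_spoly G ij),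
      pair_spoly G ij = Defs.scoef a lte G`_(ij.1) G`_(ij.2) *: G`_(ij.1)
        - Defs.scoef a lte G`_(ij.2) G`_(ij.1) *: G`_(ij.2),
      homogU d (Defs.scoef a lte G`_(ij.1) G`_(ij.2) *: V`_(ij.1)) &
      homogU d (Defs.scoef a lte G`_(ij.2) G`_(ij.1) *: V`_(ij.2))].
Proof.
have iG := ltn_trans ltij ijG.
have [u hu] := base_LM solvA lteP bGV iG; have [w hw] := base_LM solvA lteP bGV ijG.
have sc : same_component G`_(ij.1) G`_(ij.2) by apply: spoly_neq0_component s0.
have e2 : u.2 = w.2 by move: sc; rewrite (same_componentP hu hw) => /eqP.
have [_ h] := bGV; have [_ hGi hVi _ _] := h _ iG; have [_ hGj hVj _ _] := h _ ijG.
have hs := spoly_homog solvA gradA lteP hGi hGj hu hw e2.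
have ed := dgr_homog pbwA s0 hs; rewrite /= ed; split=> //.
- by have [] := spolyE solvA lteP hu hw e2.
- exact: (scoef_row_homog solvA gradA lteP hGi hu hw hVi).
- by rewrite mlcmC e2; apply: (scoef_row_homog solvA gradA lteP hGj hw hu hVj).
Qed.
End SPair.

Lemma irr_division G x q eta : divide G x q eta ->
  forall u w l, (l < size G)%N -> LM G`_l = Some u -> LM eta = Some w -> ~~ dvdm u w.
Proof.
move=> d u w l lG hu /(LMP lteP)[cw _].
by have := division_irred solvA lteP d cw; move/(_ (Ordinal lG) u); apply.
Qed.

Lemma gen_homog (j : 'I_(size U)) : U`_j != 0 /\ homogb (dU j) U`_j.
Proof. by apply: nz_homog_dgr => //; apply: hU; apply: mem_nth. Qed.

Lemma inv_select S W G V T M p p0 :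
  let degs := [seq dgr (pair_spoly G ij) | ij <- S] ++
              [seq dgr U`_j | j : 'I_(size U) <- W] in
  p0 \in degs -> all (leq p0) degs ->
  hgs_inv (HgsState S W [::] [::] G V T M) p ->
  hgs_inv (HgsState [seq ij <- S | dgr (pair_spoly G ij) != p0]
                [seq j : 'I_(size U) <- W | dgr U`_j != p0]
                [seq ij <- S | dgr (pair_spoly G ij) == p0]
                [seq j : 'I_(size U) <- W | dgr U`_j == p0] G V T M) p0.+1.
Proof.
move=> degs pd /allP amin [] /= ib ip ir iS ia ig iu _ _ dS dW dM _.
rewrite cats0 in iS ia *; rewrite cats0 in ig.
have minS ij : ij \in S -> (p0 <= dgr (pair_spoly G ij))%N.
  by move=> h; apply: amin; rewrite mem_cat; apply/orP; left; apply/mapP; exists ij.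
have minW (j : 'I_(size U)) : j \in W -> (p0 <= dU j)%N.
  by move=> h; apply: amin; rewrite mem_cat; apply/orP; right; apply/mapP; exists j.
have pp0 : (p <= p0)%N.
  by move: pd; rewrite mem_cat => /orP[/mapP[ij /dS h ->]|/mapP[j /dW h ->]].
have memS ij : ij \in [seq ij <- S | dgr (pair_spoly G ij) != p0] ++
    [seq ij <- S | dgr (pair_spoly G ij) == p0] = (ij \in S).
  by rewrite mem_cat !mem_filter -andb_orl orNb.
have memW (j : 'I_(size U)) : j \in [seq j : 'I_(size U) <- W | dgr U`_j != p0] ++
    [seq j : 'I_(size U) <- W | dgr U`_j == p0] = (j \in W).
  by rewrite mem_cat !mem_filter -andb_orl orNb.
split=> //=.
- by move=> ij; rewrite memS; apply: iS.
- by move=> ij h1 h2 h3; rewrite memS; apply: ia.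
- by move=> j; rewrite memW; apply: ig.
- rewrite catA cat_uniq; move: iu; rewrite cat_uniq => /and3P[uW hM uM].
  rewrite uM andbT; apply/andP; split.
    rewrite cat_uniq !filter_uniq // andbT; apply/hasPn => j; rewrite !mem_filter.
    by case/andP=> ->.
  by apply/hasPn => j jM; rewrite /= memW; apply: (hasPn hM).
- by move=> ij; rewrite mem_filter => /andP[/eqP ->].
- by move=> j; rewrite mem_filter => /andP[/eqP h]; rewrite -h.
- by move=> ij; rewrite mem_filter => /andP[h /minS]; rewrite leq_eqVlt eq_sym (negPf h).
- by move=> j; rewrite mem_filter => /andP[h /minW]; rewrite leq_eqVlt eq_sym (negPf h).
- by move=> j /dM h; rewrite ltnS ltnW // (leq_trans h).
- by move=> _ j /dM h; rewrite ltnS (leq_trans h).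
Qed.

Lemma inv_spair_zero S W Sp Wp G V T M ij q p :
  ij \in Sp -> divide G (pair_spoly G ij) q 0 ->
  hgs_inv (HgsState S W Sp Wp G V T M) p ->
  hgs_inv (HgsState S W (rem ij Sp) Wp G V (rcons T (ij, row_seq q)) M) p.
Proof.
move=> ijS d [] /= ib ip ir iS ia ig iu dSp dWp dS dW dM dMp.
have Sp0 : Sp != [::] by case: Sp ijS {iS ia dSp dMp}.
have [lt12 l2 s0] := iS ij (etrans (mem_cat _ _ _) (introT orP (or_intror ijS))).
split=> //=.
- move=> e; rewrite mem_rcons inE => /orP[/eqP ->|/ir //]; split=> //=.
  + by rewrite size_row_seq.
  + by rewrite row_row_seq.
  move=> k; rewrite sum_row_seq.
  case: (boolP (k \in M)) => kM; last by rewrite (lift_supp ib) // eps0.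
  have [hs _ _ _] := pair_facts ib lt12 l2 s0.
  have [_ hq] := remainder_homog solvA gradA lteP ib hs d.
  have hl := lift_homog solvA gradA ib hq.
  (* The pair being treated is still pending, so by [inv_dMp] every member of U_min has degree
     strictly below that of the lifted quotients. *)
  by apply: (eps_entry solvA hl); rewrite -ltnS (dSp ij ijS); apply: dMp.
- by move=> kl; rewrite mem_cat => /orP[h|/mem_rem h]; apply: iS; rewrite mem_cat h ?orbT.
- move=> kl h1 h2 h3; case: (ia kl h1 h2 h3) => [|h]; last first.
    by right; rewrite map_rcons mem_rcons inE h orbT.
  rewrite mem_cat => /orP[h|h]; first by left; rewrite mem_cat h.
  case: (mem_rem_or ijS h) => [->|h'].
    by right; rewrite map_rcons mem_rcons inE eqxx.
  by left; rewrite mem_cat h' orbT.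
- by move=> kl /mem_rem; apply: dSp.
- by move=> _; apply: dMp.
Qed.

Lemma inv_spair_new S W Sp Wp G V T M ij q eta p :
  ij \in Sp -> divide G (pair_spoly G ij) q eta -> eta != 0 ->
  hgs_inv (HgsState S W Sp Wp G V T M) p ->
  hgs_inv (HgsState (S ++ new_pairs a lte G eta) W (rem ij Sp) Wp (rcons G eta)
        (rcons V (Defs.scoef a lte G`_(ij.1) G`_(ij.2) *: V`_(ij.1)
                  - Defs.scoef a lte G`_(ij.2) G`_(ij.1) *: V`_(ij.2)
                  - lift_row V q))
        (rcons T (ij, rcons (row_seq q) 1)) M) p.
Proof.
move=> ijS d eta0 [] /= ib ip ir iS ia ig iu dSp dWp dS dW dM dMp.
have Sp0 : Sp != [::] by case: Sp ijS {iS ia dSp dMp}.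
have [lt12 l2 s0] := iS ij (etrans (mem_cat _ _ _) (introT orP (or_intror ijS))).
have l1 := ltn_trans lt12 l2.
have [hs es hv1 hv2] := pair_facts ib lt12 l2 s0.
set dd := dgr (pair_spoly G ij) in hs hv1 hv2; have ep : dd.+1 = p := dSp ij ijS.
have [heta hq] := remainder_homog solvA gradA lteP ib hs d.
have hl := lift_homog solvA gradA ib hq.
set v := _ - lift_row V q.
have [eVG hGV] := ib.
have [_ _ _ mul1 sup1] := hGV _ l1; have [_ _ _ mul2 sup2] := hGV _ l2.
have hv : homogU dd v by do 2![apply: homogLB => //].
have ev : v *m gmx U = eta.
  rewrite /v !mulmxBl -!scalemxAl mul1 mul2 -es (lift_mul ib).
  by rewrite {1}(division_sum d) addrAC subrr add0r.
have vM (j : 'I_(size U)) : j \notin M -> v 0 j = 0.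
  move=> jM; have := lift_supp ib q jM; rewrite /v !mxE sup1 // sup2 //.
  by rewrite !mulr0 subrr sub0r => ->; rewrite oppr0.
have sub : {subset M <= M} by [].
have irr := irr_division d.
have dMd (j : 'I_(size U)) : j \in M -> (dU j <= dd)%N.
  by move/dM; rewrite -ep ltnS.
have spE kl : (kl.1 < kl.2)%N -> (kl.2 < size G)%N ->
    pair_spoly (rcons G eta) kl = pair_spoly G kl.
  by move=> h1 h2; apply: pair_spoly_extend => //; apply: ltn_trans h2.
have newP kl : kl \in new_pairs a lte G eta -> [/\ (kl.1 < kl.2)%N,
    kl.2 = size G, pair_spoly (rcons G eta) kl != 0 & (p <= dgr (pair_spoly (rcons G eta) kl))%N].
  case/(new_pairsP solvA gradA lteP ib eta0 heta irr) => i [u [w [-> h1 _ _ [_ h2 _ h3]]]].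
  by split=> //; rewrite -ep.
split=> //=.
- exact: (base_extend solvA ib sub eta0 heta hv ev vM).
- exact: (pairs_extend solvA gradA lteP ib sub eta0 heta hv vM irr ip dMd).
- move=> e; rewrite mem_rcons inE => /orP[/eqP ->|/ir h]; last first.
    exact: (rec_extend solvA lteP eta v ib h).
  split=> //=.
  + by rewrite size_rcons ltnW.
  + by rewrite !size_rcons size_row_seq.
  + by rewrite spE //; apply: (divide_new solvA lteP eta0 d).
  (* By construction of [v] the lifted quotients cancel and only the two multiples entering the
     S-polynomial remain; these vanish under [eps] by [pairs_ok]. *)
  move=> k; rewrite (sum_new v ib q) /v [lift_row V q + _]addrC subrK.
  have sc : same_component G`_(ij.1) G`_(ij.2) by apply: spoly_neq0_component s0.
  have [e1 e2] := ip _ _ lt12 l2 sc k.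
  by rewrite !mxE epsB //; rewrite !mxE in e1 e2; rewrite e1 e2 subrr.
- move=> kl; rewrite -catA !mem_cat => /or3P[h|/newP[h1 h2 h3 _]|/mem_rem h].
  + have [h1 h2 h3] := iS kl (etrans (mem_cat _ _ _) (introT orP (or_introl h))).
    by rewrite spE // size_rcons; split=> //; apply: leqW.
  + by rewrite size_rcons h1 h2.
  + have [h1 h2 h3] := iS kl (etrans (mem_cat _ _ _) (introT orP (or_intror h))).
    by rewrite spE // size_rcons; split=> //; apply: leqW.
- move=> kl h1; rewrite size_rcons ltnS leq_eqVlt => /orP[/eqP h2|h2].
    move=> h3; left; rewrite !mem_cat; apply/orP; left; apply/orP; right.
    case: kl h1 h2 h3 => k l /= h1 h2 h3; subst l; apply/mapP; exists k => //.
    move: h3; rewrite /Defs.pair_spoly /= nth_rcons h1 nth_rcons ltnn eqxx => h3.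
    by rewrite mem_filter (spoly_neq0_component h3) h3 mem_iota.
  rewrite spE // => h3; case: (ia kl h1 h2 h3) => [|h]; last first.
    by right; rewrite map_rcons mem_rcons inE h orbT.
  rewrite mem_cat => /orP[h|h]; first by left; rewrite !mem_cat h.
  case: (mem_rem_or ijS h) => [->|h'].
    by right; rewrite map_rcons mem_rcons inE eqxx.
  by left; rewrite !mem_cat h' !orbT.
- move=> j; case: (ig j) => [|h]; [by left|right].
  exact: (gen_extend solvA lteP eta v ib _ h).
- move=> kl /mem_rem h; have [h1 h2 _] := iS kl (etrans (mem_cat _ _ _) (introT orP (or_intror h))).
  by rewrite spE //; apply: dSp.
- move=> kl; rewrite mem_cat => /orP[h|/newP[]//].
  have [h1 h2 _] := iS kl (etrans (mem_cat _ _ _) (introT orP (or_introl h))).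
  by rewrite spE //; apply: dS.
- by move=> _; apply: dMp.
Qed.

Lemma inv_gen_zero S W Wp G V T M (j : 'I_(size U)) q p :
  j \in Wp -> divide G U`_j q 0 ->
  hgs_inv (HgsState S W [::] Wp G V T M) p ->
  hgs_inv (HgsState S W [::] (rem j Wp) G V T M) p.
Proof.
move=> jW d [] /= ib ip ir iS ia ig iu dSp dWp dS dW dM dMp.
have up : perm_eq (W ++ Wp ++ M) (j :: (W ++ rem j Wp ++ M)).
  rewrite perm_sym -cat1s perm_catCA perm_cat2l cat1s -cat_cons perm_cat2r.
  by rewrite perm_sym perm_to_rem.
split=> //=.
- move=> k; case: (ig k) => [|h]; last by right.
  rewrite mem_cat => /orP[h|h]; first by left; rewrite mem_cat h.
  case: (mem_rem_or jW h) => [->|h']; last by left; rewrite mem_cat h' orbT.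
  (* By uniqueness of the pending and accepted positions, [j] is not in U_min, so nothing is asked
     of its lifted quotients. *)
  right; exists q; split=> // jM; move: iu; rewrite (perm_uniq up) /=.
  by rewrite !mem_cat jM !orbT.
- by move: iu; rewrite (perm_uniq up) /= => /andP[].
- by move=> k /mem_rem; apply: dWp.
Qed.

Lemma inv_gen_new S W Wp G V T M (j : 'I_(size U)) q eta p :
  j \in Wp -> divide G U`_j q eta -> eta != 0 ->
  hgs_inv (HgsState S W [::] Wp G V T M) p ->
  hgs_inv (HgsState (S ++ new_pairs a lte G eta) W [::] (rem j Wp) (rcons G eta)
        (rcons V (delta_mx 0 j - lift_row V q)) T (rcons M j)) p.
Proof.
move=> jW d eta0 [] /= ib ip ir iS ia ig iu dSp dWp dS dW dM dMp.
have up : perm_eq (W ++ Wp ++ M) (j :: (W ++ rem j Wp ++ M)).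
  rewrite perm_sym -cat1s perm_catCA perm_cat2l cat1s -cat_cons perm_cat2r.
  by rewrite perm_sym perm_to_rem.
have [Uj0 hs] := gen_homog j; have ep : (dU j).+1 = p := dWp j jW.
have [heta hq] := remainder_homog solvA gradA lteP ib hs d.
have hl := lift_homog solvA gradA ib hq.
set v := _ - lift_row V q.
have hv : homogU (dU j) v by apply: homogLB => //; apply: homogL_delta.
have ev : v *m gmx U = eta.
  rewrite /v mulmxBl (lift_mul ib) -rowE rowK.
  by rewrite {1}(division_sum d) addrAC subrr add0r.
have vM (k : 'I_(size U)) : k \notin rcons M j -> v 0 k = 0.
  rewrite mem_rcons inE negb_or => /andP[kj kM].
  have := lift_supp ib q kM; rewrite /v !mxE (negPf kj) sub0r => ->.
  by rewrite oppr0.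
have sub : {subset M <= rcons M j} by move=> k; rewrite mem_rcons inE orbC => ->.
have irr := irr_division d.
have dMd (k : 'I_(size U)) : k \in rcons M j -> (dU k <= dU j)%N.
  by rewrite mem_rcons inE => /orP[/eqP ->//|/dM]; rewrite -ep ltnS.
have spE kl : (kl.1 < kl.2)%N -> (kl.2 < size G)%N ->
    pair_spoly (rcons G eta) kl = pair_spoly G kl.
  by move=> h1 h2; apply: pair_spoly_extend => //; apply: ltn_trans h2.
have newP kl : kl \in new_pairs a lte G eta -> [/\ (kl.1 < kl.2)%N,
    kl.2 = size G, pair_spoly (rcons G eta) kl != 0 & (p <= dgr (pair_spoly (rcons G eta) kl))%N].
  case/(new_pairsP solvA gradA lteP ib eta0 heta irr) => i [u [w [-> h1 _ _ [_ h2 _ h3]]]].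
  by split=> //; rewrite -ep.
split=> //=.
- exact: (base_extend solvA ib sub eta0 heta hv ev vM).
- exact: (pairs_extend solvA gradA lteP ib sub eta0 heta hv vM irr ip dMd).
- by move=> e /ir h; apply: (rec_extend solvA lteP eta v ib h).
- move=> kl; rewrite cats0 mem_cat => /orP[h|/newP[h1 h2 h3 _]].
    have [h1 h2 h3] := iS kl (etrans (mem_cat _ _ _) (introT orP (or_introl h))).
    by rewrite spE // size_rcons; split=> //; apply: leqW.
  by rewrite size_rcons h1 h2.
- move=> kl h1; rewrite size_rcons ltnS leq_eqVlt => /orP[/eqP h2|h2].
    move=> h3; left; rewrite cats0 mem_cat; apply/orP; right.
    case: kl h1 h2 h3 => k l /= h1 h2 h3; subst l; apply/mapP; exists k => //.
    move: h3; rewrite /Defs.pair_spoly /= nth_rcons h1 nth_rcons ltnn eqxx => h3.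
    by rewrite mem_filter (spoly_neq0_component h3) h3 mem_iota.
  rewrite spE // => h3; case: (ia kl h1 h2 h3) => [|h]; last by right.
  by rewrite cats0 => h; left; rewrite cats0 mem_cat h.
- move=> k; case: (eqVneq k j) => [->|kj].
    right; exists (\row_(l < size (rcons G eta)) (rcons (row_seq q) 1)`_l).
    split=> [|_]; first exact: (divide_new solvA lteP eta0 d).
    by rewrite (lift_new eta v ib q) /v addrC subrK.
  case: (ig k) => [|h].
    rewrite mem_cat => /orP[h|h]; first by left; rewrite mem_cat h.
    by case: (mem_rem_or jW h) => [/eqP|h']; [rewrite (negPf kj)|left; rewrite mem_cat h' orbT].
  right; apply: (gen_extend solvA lteP eta v ib _ h).
  by rewrite mem_rcons inE (negPf kj).
- move: iu; rewrite (perm_uniq up) /= -cats1 !catA cats1 rcons_uniq; exact.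
- by move=> k /mem_rem; apply: dWp.
- move=> kl; rewrite mem_cat => /orP[h|/newP[]//].
  have [h1 h2 _] := iS kl (etrans (mem_cat _ _ _) (introT orP (or_introl h))).
  by rewrite spE //; apply: dS.
- by move=> k; rewrite mem_rcons inE => /orP[/eqP ->|/dM //]; rewrite ep.
Qed.

Lemma hgs_inv_step st st' : (exists p, hgs_inv st p) -> step st st' -> exists p, hgs_inv st' p.
Proof.
case=> p hi h; case: h hi => {st st'} [S W G V T M p0 degs h1 h2|S W Sp Wp G V T M ij q h1 h2|
  S W Sp Wp G V T M ij q eta h1 h2 h3 gi gj|S W Wp G V T M j q h1 h2|S W Wp G V T M j q eta h1 h2 h3] hi.
- by exists p0.+1; exact: (inv_select h1 h2 hi).
- by exists p; exact: (inv_spair_zero h1 h2 hi).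
- by exists p; exact: (inv_spair_new h1 h2 h3 hi).
- by exists p; exact: (inv_gen_zero h1 h2 hi).
- by exists p; exact: (inv_gen_new h1 h2 h3 hi).
Qed.

Lemma hgs_output_inv o : outputs step (@hgs_final K A s U) (hgs_init U) o ->
  exists p, hgs_inv o p.
Proof.
case=> h _; apply: (reach_invariant (P := fun st => exists p, hgs_inv st p) _ h).
  exact: hgs_inv_step.
by exists 0%N; apply: hgs_inv_init.
Qed.
End MinhgsStep.

(** * Procedures 2-4 *)

Section SpanMatrix.
Variable R : nzRingType.

Lemma lspanP s k (g : 'I_k -> 'rV[R]_s) (J : {set 'I_k}) x :
  lspan g J x <-> exists c : 'rV[R]_k,
    (forall i, i \notin J -> c 0 i = 0) /\ c *m (\matrix_i g i) = x.
Proof.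
split=> [[c ->]|[c [cJ <-]]].
  exists (\row_i if i \in J then c i else 0); split=> [i /negPf iJ|]; first by rewrite mxE iJ.
  rewrite mulmx_sum_row [RHS]big_mkcond /=; apply: eq_bigr => i _.
  by rewrite rowK mxE; case: ifP; rewrite ?scale0r.
exists (fun i => c 0 i); rewrite mulmx_sum_row [RHS]big_mkcond /=; apply: eq_bigr => i _.
by rewrite rowK; case: ifPn => // /cJ ->; rewrite scale0r.
Qed.

Lemma span_lspanT s k (g : 'I_k -> 'rV[R]_s) x :
  lspan g setT x <-> exists c : 'rV[R]_k, c *m (\matrix_i g i) = x.
Proof.
split=> [/lspanP[c [_ h]]|[c h]]; first by exists c.
by apply/lspanP; exists c; split=> // i; rewrite inE.
Qed.

Lemma spanP s (U : seq 'rV[R]_s) x :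
  Defs.span U x <-> exists q, q *m (\matrix_(l < size U) U`_l) = x.
Proof.
have e : \matrix_(i < size U) (tnth (in_tuple U) i) = \matrix_(l < size U) U`_l.
  by apply/row_matrixP => i; rewrite !rowK (tnth_nth 0).
by rewrite /Defs.span span_lspanT e.
Qed.

Lemma span_mem s (U : seq 'rV[R]_s) x : x \in U -> Defs.span U x.
Proof.
move=> xU; apply/spanP; have ix : (index x U < size U)%N by rewrite index_mem.
by exists (delta_mx 0 (Ordinal ix)); rewrite -rowE rowK /= nth_index.
Qed.

Lemma span_min s (U : seq 'rV[R]_s) (N : 'rV[R]_s -> Prop) :
  submodule N -> (forall x, x \in U -> N x) -> forall x, Defs.span U x -> N x.
Proof.
move=> subN h x /spanP[q <-]; apply: submodule_mulmx => // l; rewrite rowK.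
by apply: h; apply: mem_nth.
Qed.

Lemma span_eq_mem s (U V : seq 'rV[R]_s) : U =i V ->
  forall x, Defs.span U x <-> Defs.span V x.
Proof.
move=> e x; split; apply: span_min; try exact: submodule_span.
  by move=> y; rewrite e => /span_mem.
by move=> y; rewrite -e => /span_mem.
Qed.

Lemma submodule_image s t (g : 'M[R]_(t, s)) : submodule (fun x : 'rV_s => exists y, y *m g = x).
Proof.
split=> [|f _ _ [y <-] [z <-]]; first by exists 0; rewrite mul0mx.
by exists (f *: y + z); rewrite mulmxDl -scalemxAl.
Qed.

Lemma colsub_mul m p (M : seq 'I_m) (v : 'rV[R]_m) (B : 'M[R]_(m, p)) : uniq M ->
  (forall j, j \notin M -> v 0 j = 0) ->
  v *m B = colsub (tnth (in_tuple M)) v *m rowsub (tnth (in_tuple M)) B.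
Proof.
move=> uM hv; rewrite !mulmx_sum_row.
transitivity (\sum_(j <- M) v 0 j *: row j B).
  rewrite (big_uniq _ uM) /= (bigID (mem M)) /= [X in _ + X]big1 ?addr0 //.
  by move=> j /hv ->; rewrite scale0r.
by rewrite big_tnth; apply: eq_bigr => k _; rewrite row_rowsub mxE.
Qed.
End SpanMatrix.

Section Round.
Variables (K : fieldType) (n : nat) (A : algType K) (a : 'I_n -> A).
Variable lt : rel 'X_{1..n}.
Hypothesis solvA : solvable_polynomial_algebra a lt.
Variable wt : 'I_n -> nat.
Hypothesis gradA : graded_algebra a wt.
Variables (s : nat) (b : 'I_s -> nat) (lte : rel ('X_{1..n} * 'I_s)).
Hypothesis lteP : left_monomial_ordering a lt lte.
Variable U : seq 'rV[A]_s.
Hypothesis hU : forall x, x \in U -> nz_homog a wt b x.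
Variable o : hgs_state U.
Hypothesis ho : outputs (hgs_step a wt b lte (U := U)) (@hgs_final K A s U) (hgs_init U) o.

Let pbwA : pbw_basis a. Proof. by case: solvA. Qed.
Local Notation LM := (LM a lte).
Local Notation divide Xi x q eta := (@division K n A a s lte Xi x q eta).
Local Notation dgr := (dgr a wt b).
Local Notation homogb := (homogL a wt b).
Local Notation dU := (gen_degree a wt b (U := U)).
Local Notation homogU := (homogL a wt dU).
Local Notation G := (hG o).
Local Notation V := (hV o).
Local Notation mi := (tnth (in_tuple (hmin o))).
Local Notation crit := (critical_pairs a lte o).
Local Notation srow := (srow a lte (o := o)).
Local Notation Smx := (Smx a lte o).
Local Notation degG := (fun l : 'I_(size G) => dgr G`_l).

Let oinv : exists p, hgs_inv a wt b lte o p.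
Proof. exact: (hgs_output_inv solvA gradA lteP hU ho). Qed.
Let ofin : [/\ hS o = [::], hW o = [::], hSp o = [::] & hWp o = [::]].
Proof. by case: ho. Qed.
Let obase : base_ok a wt b G V (hmin o).
Proof. by case: oinv => p []. Qed.

Lemma output_uniq : uniq (hmin o).
Proof.
have [p h] := oinv; have [_ hW0 _ hWp0] := ofin.
by have := inv_uniq h; rewrite hW0 hWp0.
Qed.

Lemma output_nz g : g \in G -> g != 0.
Proof.
move=> gG; have ix : (index g G < size G)%N by rewrite index_mem.
by have [_ /(_ _ ix)[]] := obase; rewrite nth_index.
Qed.

Lemma output_homog (l : 'I_(size G)) : homogb (dgr G`_l) G`_l.
Proof. by have [_ /(_ l (ltn_ord l))[]] := obase. Qed.

Lemma output_V : Gmx o = Vmx o *m Umx U.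
Proof.
apply/row_matrixP => l; rewrite row_mul !rowK.
by have [_ /(_ l (ltn_ord l))[]] := obase.
Qed.

Lemma output_gens (j : 'I_(size U)) : gen_ok a lte G V (hmin o) j.
Proof.
have [p h] := oinv; have [_ hW0 _ hWp0] := ofin.
by case: (inv_gens h j) => //; rewrite hW0 hWp0.
Qed.

Lemma critP ij : ij \in crit -> (ij.1 < ij.2)%N /\ same_component a lte G`_(ij.1) G`_(ij.2).
Proof. by rewrite mem_filter => /andP[/andP[]]. Qed.

Lemma output_pair ij : ij \in crit ->
  divide G (spoly a lte G`_(ij.1) G`_(ij.2)) (spair_quot ij) 0 /\
  forall k, eps a ((spair_quot ij *m Vmx o) 0 k) = 0.
Proof.
case: ij => i j /critP[/= lij sc]; have [p h] := oinv.
have hrec := inv_recs h; have hall := inv_all h.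
have [hS0 _ hSp0 _] := ofin.
rewrite /spair_quot /=; case E: [seq _ | _ <- _ & _] => [|r rs].
  (* At the end of a run a pair without record has zero S-polynomial, whose quotient row is the
     default 0. *)
  have -> : (\row__ 0 : 'rV[A]_(size G)) = 0 by apply/rowP => l; rewrite !mxE.
  split=> [|k]; last by rewrite mul0mx mxE eps0.
  have [->|s0] := eqVneq (spoly a lte G`_i G`_j) 0; first by constructor.
  case: (hall (val i, val j) lij (ltn_ord j) s0); first by rewrite hS0 hSp0.
  case/mapP=> e eQ ee; have : e.2 \in [seq e.2 | e <- hQ o & e.1 == (val i, val j)].
    by apply: map_f; rewrite mem_filter -ee eqxx.
  by rewrite E.
have : r \in [seq e.2 | e <- hQ o & e.1 == (val i, val j)] by rewrite E mem_head.
case/mapP=> e; rewrite mem_filter => /andP[/eqP e1 /hrec[_ _ sz d he]] ->.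
split; first by move: d; rewrite e1.
move=> k; suff -> : (\row_l e.2`_l) *m Vmx o = \sum_(l < size e.2) e.2`_l *: V`_l by [].
rewrite mulmx_sum_row (eq_bigr (fun l : 'I_(size G) => e.2`_l *: V`_l)); last first.
  by move=> l _; rewrite mxE rowK.
rewrite (big_ord_widen _ (fun l => e.2`_l *: V`_l) sz) [RHS]big_mkcond /=.
apply: eq_bigr => l _; case: ltnP => // hl.
by rewrite [e.2`_l]nth_default // scale0r.
Qed.

Let lmE : exists lm : 'I_(size G) -> 'X_{1..n} * 'I_s, forall l, LM (row l (Gmx o)) = Some (lm l).
Proof. exact: (LM_family solvA lteP output_nz). Qed.

Lemma rowGmx (l : 'I_(size G)) : row l (Gmx o) = G`_l. Proof. by rewrite rowK. Qed.

Lemma srow_pair_syz ij : srow ij = pair_syz a lte (Gmx o) ij.1 ij.2 (spair_quot ij).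
Proof. by rewrite /pair_syz !rowGmx. Qed.

Lemma crit_lm lm ij : (forall l, LM (row l (Gmx o)) = Some (lm l)) -> ij \in crit ->
  (ij.1 < ij.2)%N /\ (lm ij.1).2 = (lm ij.2).2.
Proof.
move=> hlm /critP[h1]; have := hlm ij.1; have := hlm ij.2; rewrite !rowGmx => h2 h3.
by rewrite (same_componentP h3 h2) => /eqP.
Qed.

Lemma srow_mul ij : ij \in crit -> srow ij *m Gmx o = 0.
Proof.
move=> hij; have [lm hlm] := lmE; have [h1 h2] := crit_lm hlm hij.
rewrite srow_pair_syz (pair_syz_mul solvA lteP hlm h2) !rowGmx.
have [d _] := output_pair hij.
by rewrite {1}(division_sum d) addr0 subrr.
Qed.

Lemma mem_srows x : x \in [seq srow ij | ij <- crit] -> x *m Gmx o = 0.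
Proof. by case/mapP=> ij hij ->; apply: srow_mul. Qed.

Lemma srow_LM lm : (forall l, LM (row l (Gmx o)) = Some (lm l)) ->
  forall i j : 'I_(size G), (i < j)%N -> (lm i).2 = (lm j).2 ->
  exists2 x, x \in [seq srow ij | ij <- crit] &
    Defs.LM a (schr lte lm) x = Some ((mlcm (lm i).1 (lm j).1 - (lm i).1)%MM, i).
Proof.
move=> hlm i j lij e2; have hi := hlm i; have hj := hlm j; rewrite !rowGmx in hi hj.
have hij : (i, j) \in crit.
  by rewrite mem_filter /= lij (same_componentE hi hj e2) mem_enum.
exists (srow (i, j)); first by apply: map_f.
rewrite srow_pair_syz; apply: (LM_pair_syz solvA lteP hlm lij e2) => w cw.
have [d _] := output_pair hij.
have [||v hv] := division_tops solvA lteP (P := fun v => lte v (lcmij lm i j)) _ d _ cw.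
- by move=> u1 u2 h1 h2; apply: (lte_trans lteP h2 h1).
- by have [_ hb] := spolyE solvA lteP hi hj e2; exact: hb.
- by have := hlm w.2; rewrite rowGmx hv => -[->].
Qed.

Lemma srows_Smx x : x \in [seq srow ij | ij <- crit] -> exists y, y *m Smx = x.
Proof.
case/mapP=> ij hij ->; have ix : (index ij crit < size crit)%N by rewrite index_mem.
by exists (delta_mx 0 (Ordinal ix)); rewrite -rowE rowK (tnth_nth ij) /= nth_index.
Qed.

Lemma Smx_mul : Smx *m Gmx o = 0.
Proof.
by apply/row_matrixP => r; rewrite row_mul rowK row0; apply: srow_mul; apply: mem_tnth.
Qed.

Lemma syz_Gmx (h : 'rV_(size G)) : h *m Gmx o = 0 -> exists y, h = y *m Smx.
Proof.
have [lm hlm] := lmE.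
move=> h0; have [q ->] := schreyer_generates solvA lteP hlm mem_srows (srow_LM hlm) h0.
have [y <-] : exists y, y *m Smx = q *m gmx [seq srow ij | ij <- crit]; last by exists y.
apply: (submodule_mulmx (N := fun x => exists y, y *m Smx = x)).
  exact: submodule_image.
by move=> l; rewrite rowK; apply: srows_Smx; apply: mem_nth.
Qed.

Variable N : 'rV[A]_s -> Prop.
Hypothesis NU : forall x, N x <-> Defs.span U x.

Let subN : submodule N.
Proof.
have [h0 hD] := submodule_span U.
by split=> [|f x y /NU hx /NU hy]; apply/NU; [exact: h0|apply: hD].
Qed.

Let NE x : N x <-> exists q, q *m Umx U = x.
Proof. by rewrite NU spanP. Qed.

Lemma output_mem g : g \in G -> N g.
Proof.
move=> gG; have ix : (index g G < size G)%N by rewrite index_mem.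
apply/NE; exists (row (Ordinal ix) (Vmx o)).
by rewrite -row_mul -output_V rowK /= nth_index.
Qed.

Lemma output_row_space x : N x -> exists h : 'rV_(size G), h *m Gmx o = x.
Proof.
move=> /NU; apply: (span_min (N := fun x => exists h, h *m Gmx o = x)).
  exact: submodule_image.
move=> y yU; have ix : (index y U < size U)%N by rewrite index_mem.
have [q [d _]] := output_gens (Ordinal ix).
by exists q; have := division_sum d; rewrite /= nth_index // addr0 => ->.
Qed.

Lemma output_groebner : left_groebner a lte N G.
Proof.
apply/(left_groebner_dvdm solvA lteP N); split.
  by move=> g gG; split; [apply: output_nz|apply: output_mem].
move=> x u /output_row_space[h <-] hu; have [lm hlm] := lmE.
have [l dl] := buchberger solvA lteP hlm mem_srows (srow_LM hlm) hu.
by exists G`_l, (lm l); rewrite mem_nth //; have := hlm l; rewrite rowGmx.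
Qed.

Lemma division_matrix_exists : exists Q, division_matrix a lte (o := o) Q.
Proof.
have ex (j : 'I_(size U)) : exists q, divide G U`_j q 0.
  by have [q [d _]] := output_gens j; exists q.
exists (\matrix_j proj1_sig (constructive_indefinite_description _ (ex j))) => j.
by rewrite rowK; exact: (proj2_sig (constructive_indefinite_description _ (ex j))).
Qed.

Lemma Umin_mxE : Umin_mx o = rowsub mi (Umx U).
Proof. by apply/row_matrixP => k; rewrite row_rowsub !rowK. Qed.

(** Dropping the columns outside U_min loses nothing, because the rows of V vanish there. *)
Lemma Vmin_mul : Vmin o *m Umin_mx o = Gmx o.
Proof.
rewrite output_V Umin_mxE; apply/row_matrixP => l; rewrite !row_mul.
have -> : row l (Vmin o) = colsub mi (row l (Vmx o)) by apply/rowP => k; rewrite !mxE.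
rewrite -colsub_mul ?output_uniq // => j jM; rewrite rowK.
by have [_ /(_ l (ltn_ord l))[_ _ _ _ ->]] := obase.
Qed.

Section DivisionMatrix.
Variable Q : 'M[A]_(size U, size G).
Hypothesis hQ : division_matrix a lte (o := o) Q.

Lemma Q_mul : Umx U = Q *m Gmx o.
Proof.
apply/row_matrixP => j; rewrite row_mul rowK.
by have := division_sum (hQ j); rewrite addr0.
Qed.

Lemma Qmin_mul : Umin_mx o = Qmin Q *m Gmx o.
Proof. by rewrite Umin_mxE Q_mul; apply/row_matrixP => k; rewrite row_mul !row_rowsub row_mul. Qed.

(* Each member of U_min enters hG through its own remainder, so that dividing
   it again by the final hG retraces that computation. *)
Lemma QVmin : Qmin Q *m Vmin o = 1%:M.
Proof.
have e (j : 'I_(size U)) : j \in hmin o -> row j (Q *m Vmx o) = delta_mx 0 j.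
  move=> jM; have [q [d /(_ jM) <-]] := output_gens j.
  have [-> _] := division_uniq solvA lteP d (hQ j).
  by rewrite row_mul liftE.
have mi_inj : injective mi by apply/tuple_uniqP; exact: output_uniq.
apply/matrixP => k l; rewrite [RHS]mxE -(inj_eq mi_inj k l).
transitivity ((row (mi k) (Q *m Vmx o)) 0 (mi l)).
  by rewrite !mxE; apply: eq_bigr => i _; rewrite !mxE.
by rewrite e ?mem_tnth // mxE eqxx /= eq_sym; case: eqP.
Qed.

(** [x *m Qmin Q] is a syzygy of the Groebner basis, hence a combination of the rows of [Smx], and
    multiplying it by [Vmin] gives back [x], because [QVmin] makes the product the identity. *)
Lemma syz_Umin (x : 'rV_(size (hmin o))) : x *m Umin_mx o = 0 <-> exists y, x = y *m (Smx *m Vmin o).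
Proof.
split=> [x0|[y ->]]; last by rewrite -!mulmxA Vmin_mul Smx_mul mulmx0.
have [|y ey] := @syz_Gmx (x *m Qmin Q); first by rewrite -mulmxA -Qmin_mul.
by exists y; rewrite mulmxA -ey -mulmxA QVmin mulmx1.
Qed.

Lemma srowV_eps ij k : ij \in crit -> eps a ((srow ij *m Vmx o) 0 k) = 0.
Proof.
move=> hij; have [p h] := oinv; have [lij sc] := critP hij.
have [_ hs] := output_pair hij.
have [e1 e2] := inv_pairs h lij (ltn_ord ij.2) sc k.
rewrite /Defs.srow mulmxDl mulmxBl -!scalemxAl -!rowE !rowK.
by rewrite mxE epsD // e2 addr0 mxE epsD // hs add0r mxE epsN // e1 oppr0.
Qed.

Lemma SVmin_row r : row r (Smx *m Vmin o) =
  colsub mi (srow (tnth (in_tuple crit) r) *m Vmx o).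
Proof.
rewrite row_mul rowK; apply/rowP => k; rewrite !mxE.
by apply: eq_bigr => l _; rewrite !mxE.
Qed.

Lemma syz_eps (x : 'rV_(size (hmin o))) k : x *m Umin_mx o = 0 -> eps a (x 0 k) = 0.
Proof.
move/syz_Umin => [y ->]; rewrite mulmx_sum_row summxE eps_sum // big1 // => r _.
by rewrite mxE (epsM pbwA gradA) SVmin_row mxE srowV_eps ?mem_tnth // mulr0.
Qed.

Lemma Umin_minimal : minimal_generators N (Umin (o := o)).
Proof.
split=> [x|J /properP[_ [k0 _ k0J]] h].
  split=> [/NE[q <-]|/span_lspanT[c <-]].
    apply/span_lspanT; exists (q *m Q *m Vmin o).
    change (q *m Q *m Vmin o *m Umin_mx o = q *m Umx U).
    by rewrite -mulmxA Vmin_mul -mulmxA -Q_mul.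
  apply: submodule_mulmx => // k; rewrite rowK; apply/NU; apply: span_mem.
  exact: mem_nth.
have Nk : N (Umin k0) by apply/NU; apply: span_mem; apply: mem_nth.
have /lspanP[c [cJ ec]] := h _ Nk.
(* Were the member at [k0] a combination of the others, this syzygy would have the entry 1 at [k0],
   which [eps] does not kill. *)
have x0 : (delta_mx 0 k0 - c) *m Umin_mx o = 0.
  by rewrite mulmxBl -rowE rowK; apply/eqP; rewrite subr_eq0 eq_sym; apply/eqP.
have := syz_eps k0 x0; rewrite !mxE cJ // !eqxx subr0 eps1 //.
by move/eqP; rewrite oner_eq0.
Qed.

Local Notation dm := (Umin_dgr a wt b (o := o)).

Lemma Umin_homog k : Umin k != 0 /\ homogb (dm k) (Umin k).
Proof. by apply: nz_homog_dgr => //; apply: hU; apply: mem_nth. Qed.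

Lemma syzygy_row_homog r : exists q, homogL a wt dm q (row r (Smx *m Vmin o)).
Proof.
set ij := tnth (in_tuple crit) r; have hij : ij \in crit by apply: mem_tnth.
have [lm hlm] := lmE; have [h1 h2] := crit_lm hlm hij.
have hi := hlm ij.1; have hj := hlm ij.2; rewrite !rowGmx in hi hj.
have [Hi Hj] := (output_homog ij.1, output_homog ij.2).
have [d _] := output_pair hij.
have hs := spoly_homog solvA gradA lteP Hi Hj hi hj h2.
have [_ hq] := division_homog solvA lteP gradA output_homog d hs.
exists (wdeg wt (mlcm (lm ij.1).1 (lm ij.2).1) + b (lm ij.1).2)%N.
rewrite row_mul rowK -/ij; apply: (homogL_mulmx pbwA gradA (c := degG)).
  apply: homogLD => //; first apply: homogLB => //.
    by apply: (scoef_row_homog solvA gradA lteP Hi hi hj); apply: homogL_delta.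
  rewrite mlcmC h2; apply: (scoef_row_homog solvA gradA lteP Hj hj hi).
  exact: homogL_delta.
move=> l; apply: homogL_row => // k; rewrite !mxE => v0.
have [_ /(_ l (ltn_ord l))[_ _ hV _ _]] := obase.
have [le hh] := homogL_entry pbwA hV v0.
by eexists; [exact: hh|rewrite subnK].
Qed.

Lemma mem_syzygy_gens x : x \in syzygy_gens a lte Q ->
  x != 0 /\ exists r, x = row r (Smx *m Vmin o).
Proof.
rewrite mem_filter mem_cat => /andP[x0 /orP[/mapP[r _ er]|/mapP[k _ ex]]].
  by split; [|exists r].
by move: x0; rewrite ex QVmin subrr row0 eqxx.
Qed.

Lemma syzygy_gens_homog x : x \in syzygy_gens a lte Q -> nz_homog a wt dm x.
Proof. by case/mem_syzygy_gens=> x0 [r er]; split=> //; rewrite er; apply: syzygy_row_homog. Qed.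

Lemma syzygy_gens_eps x k : x \in syzygy_gens a lte Q -> eps a (x 0 k) = 0.
Proof.
case/mem_syzygy_gens=> _ [r ->]; apply: syz_eps; apply/syz_Umin.
by exists (delta_mx 0 r); rewrite -rowE.
Qed.

Lemma syzygy_gens_span (x : 'rV_(size (hmin o))) : x *m Umin_mx o = 0 <-> Defs.span (syzygy_gens a lte Q) x.
Proof.
split=> [/syz_Umin[y ->]|].
  apply: submodule_mulmx; first exact: submodule_span.
  move=> r; case: (eqVneq (row r (Smx *m Vmin o)) 0) => [->|r0].
    by case: (submodule_span (syzygy_gens a lte Q)).
  apply: span_mem; rewrite mem_filter r0 mem_cat; apply/orP; left.
  by apply: map_f; rewrite mem_enum.
apply: (span_min (N := fun x => x *m Umin_mx o = 0)); first exact: submodule_ker.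
move=> y /mem_syzygy_gens[_ [r ->]]; apply/syz_Umin.
by exists (delta_mx 0 r); rewrite -rowE.
Qed.

Lemma Umin_image x : N x <-> exists y : 'rV_(size (hmin o)), y *m Umin_mx o = x.
Proof. by have [h _] := Umin_minimal; rewrite h span_lspanT. Qed.
End DivisionMatrix.
End Round.

(** * Algorithm-MINHGSQ *)

Lemma split_first (T : eqType) (P : T -> Prop) (r : seq T) : (exists2 x, x \in r & P x) ->
  exists r1 x r2, [/\ r = r1 ++ x :: r2, P x & forall y, y \in r1 -> ~ P y].
Proof.
elim: r => [[x] //|y r IH [x xr Px]].
case: (excluded_middle_informative (P y)) => [Py|nPy]; first by exists [::], y, r.
have [|r1 [z [r2 [-> Pz h]]]] := IH.
  by move: xr; rewrite inE => /orP[/eqP e|]; [rewrite e in Px|exists x].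
exists (y :: r1), z, r2; split=> // w; rewrite inE => /orP[/eqP ->|/h] //.
Qed.

Section Minhgsq.
Variables (K : fieldType) (n : nat) (A : algType K) (a : 'I_n -> A).
Hypothesis pbwA : pbw_basis a.
Variable wt : 'I_n -> nat.
Hypothesis gradA : graded_algebra a wt.
Variables (s : nat) (b : 'I_s -> nat) (U : seq 'rV[A]_s).
Hypothesis hU : forall x, x \in U -> nz_homog a wt b x.
Local Notation homogb := (homogL a wt b).
Local Notation step := (@hgsq_step K A s).
Local Notation final := (@hgsq_final K A s).

Lemma hgsq_step_acc (st : seq 'I_s * seq 'rV[A]_s) : Acc (fun y z => step z y) st.
Proof.
have [m] := ubnP (size st.1); elim: m st => [st|m IH st]; first by rewrite ltn0.
move=> hm; constructor=> st' h; case: h hm => {st st'} E1 E2 E' i V1 V2 V' v c _ _ _ pE _ /= hm.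
apply: IH; rewrite /= (perm_size pE) size_cat; move: hm; rewrite size_cat /= addnS.
by rewrite ltnS.
Qed.

Lemma hgsq_step_progress st : final st \/ exists st', step st st'.
Proof.
case: st => E V; case: (excluded_middle_informative (final (E, V))) => [|nf]; [by left|right].
have [v vV [i iE hi]] : exists2 v, v \in V & exists2 i, i \in E & inKstar (v 0 i).
  apply: NNPP => no; apply: nf => v i /= vV iE hi; apply: no.
  by exists v => //; exists i.
have [V1 [v' [V2 [-> <- _]]]] := @split_first _ (fun w => v = w) V (ex_intro2 _ _ v vV erefl).
(* The rule asks for the least index with a unit entry, hence the split at the first one. *)
have [E1 [k [E2 [-> [c c0 hc] hE1]]]] := @split_first _ (fun k => inKstar (v 0 k)) E
  (ex_intro2 _ _ i iE hi).
by eexists (_, _); apply: (Hgsq_step _ c0 hc (perm_refl _) (perm_refl _)).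
Qed.

Lemma hgsq_terminates : terminates step final (hgsq_init U).
Proof. by split=> [|y _]; [apply: hgsq_step_acc|apply: hgsq_step_progress]. Qed.

(** With L_0' spanned by [E]: [hq_supp] and [hq_span] say that [V] generates the intersection of N
    and L_0', and [hq_reduce] that L_0 = L_0' + N compatibly with degrees. The second isomorphism
    theorem then gives the graded isomorphism with M. *)
Record hgsq_inv (E : seq 'I_s) (V : seq 'rV[A]_s) : Prop := HgsqInv {
  hq_uniq : uniq E;
  hq_supp : forall v, v \in V -> Defs.span U v /\ forall i, i \notin E -> v 0 i = 0;
  hq_span : forall x : 'rV_s, Defs.span U x -> (forall i, i \notin E -> x 0 i = 0) ->
    Defs.span V x;
  hq_reduce : forall x : 'rV_s, exists y : 'rV_s, [/\ forall i, i \notin E -> y 0 i = 0,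
    Defs.span U (x - y) & forall q, homogb q x -> homogb q y];
  hq_homog : forall v, v \in V -> nz_homog a wt b v }.

Lemma hgsq_inv_init : hgsq_inv (enum 'I_s) U.
Proof.
split=> //.
- exact: enum_uniq.
- by move=> v /span_mem h; split=> // i; rewrite mem_enum.
- move=> x; exists x; split=> // [i|]; first by rewrite mem_enum.
  by rewrite subrr; case: (submodule_span U).
Qed.

Lemma hgsq_inv_step st st' : hgsq_inv st.1 st.2 -> step st st' -> hgsq_inv st'.1 st'.2.
Proof.
move=> hi h; case: h hi => {st st'} E1 E2 E' i V1 V2 V' v c _ c0 vi pE pV [] /= uE sV spV red hV.
set E := E1 ++ i :: E2 in uE sV spV red; set V := V1 ++ v :: V2 in sV spV hV.
have subU := submodule_span U; have subV' := submodule_span V'.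
have memE k : (k \in E') = (k != i) && (k \in E).
  rewrite (perm_mem pE) /E !mem_cat inE; case: (eqVneq k i) => [->|//].
  move: uE; rewrite cat_uniq /= => /and3P[_ /norP[hi1 _] /andP[hi2 _]].
  by rewrite (negPf hi1) (negPf hi2).
have uE' : uniq E'.
  rewrite (perm_uniq pE); move: uE; rewrite cat_uniq /= cat_uniq negb_or.
  by case/and3P=> -> /andP[_ ->] /andP[_ ->].
have vV : v \in V by rewrite mem_cat inE eqxx orbT.
have [spv supv] := sV v vV.
have [p hp] := proj2 (hV v vV).
(* The entry of [v] at [i] is a nonzero scalar, so [v] has the degree of e_i and the elimination
   preserves degrees. *)
have ep : b i = p.
  have := homogLP a wt b p v hp (0%MM, i); rewrite /cf /= vi wdeg0 add0n; apply.
  by rewrite crdZ // -(mon0 a) crd_mon // mcoeffZ mcoeffX eqxx mulr1.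
pose el (w : 'rV[A]_s) := w - (c^-1 *: w 0 i) *: v.
have el_supp (w : 'rV[A]_s) : (forall k, k \notin E -> w 0 k = 0) ->
    forall k, k \notin E' -> el w 0 k = 0.
  move=> hw k; rewrite memE negb_and negbK /el !mxE => /orP[/eqP ->|kE].
    by rewrite vi mulr_algr scalerA mulfV // scale1r subrr.
  by rewrite (hw k kE) (supv k kE) mulr0 subr0.
have el_homog q (w : 'rV[A]_s) : homogb q w -> homogb q (el w).
  move=> hw; apply: homogLB => //.
  case: (eqVneq (w 0 i) 0) => [->|w0]; first by rewrite scaler0 scale0r homogL0.
  have [le hwi] := homogL_entry pbwA hw w0.
  rewrite -(subnK le); apply: homogLM; rewrite ?ep //.
  by rewrite -ep; apply: homogAZ.
have memV' w : w \in V' -> exists2 w0, w0 \in V & w = el w0.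
  rewrite (perm_mem pV) mem_filter => /andP[_ /mapP[w0 h ->]]; exists w0 => //.
  by move: h; rewrite !mem_cat inE orbCA => ->; rewrite orbT.
have V'_zero (x : 'rV[A]_s) : Defs.span V' x -> x 0 i = 0.
  apply: (span_min (N := fun x => x 0 i = 0)) => [|w /memV'[w0 w0V ->]].
    split=> [|f x1 x2 h1 h2]; first by rewrite mxE.
    by rewrite !mxE h1 h2 mulr0 addr0.
  by apply: el_supp; [case: (sV w0 w0V)|rewrite memE eqxx].
split=> //=.
- move=> w /memV'[w0 /sV[sw supw] ->]; split; last exact: el_supp.
  rewrite /el addrC -scaleNr; by apply: (proj2 subU).
- move=> x Ux supx.
  have : Defs.span V x.
    apply: spV => // k kE; apply: supx; by rewrite memE negb_and kE orbT.
  (* The span of [V] is contained in that of [V'] plus A v. For a vector vanishing at [i] the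
     coefficient of [v] must be 0, since [v] has a unit entry there and [V'] vanishes there. *)
  pose N (y : 'rV[A]_s) := exists d : A, Defs.span V' (y - d *: v).
  have hN : submodule N.
    split; first by exists 0; rewrite scale0r subr0; case: subV'.
    move=> f y z [d hd] [e he]; exists (f * d + e).
    have -> : f *: y + z - (f * d + e) *: v = f *: (y - d *: v) + (z - e *: v).
      by rewrite scalerDl scalerBr scalerA opprD addrACA.
    exact: (proj2 subV').
  case/(span_min hN) => [w|d hd].
    rewrite mem_cat inE orbCA => /orP[/eqP ->|hw].
      by exists 1; rewrite scale1r subrr; case: subV'.
    exists (c^-1 *: w 0 i); case: (eqVneq (el w) 0) => [e|w0].
      by rewrite -[w - _]/(el w) e; case: subV'.
    apply: span_mem; rewrite (perm_mem pV) mem_filter w0 /=.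
    by apply/mapP; exists w; rewrite // mem_cat.
  have := V'_zero _ hd; rewrite !mxE vi supx ?memE ?eqxx // sub0r mulr_algr => /eqP.
  by rewrite oppr_eq0 scaler_eq0 (negPf c0) /= => /eqP d0; rewrite d0 scale0r subr0 in hd.
- move=> x; have [y [supy sy hy]] := red x; exists (el y); split.
  + exact: el_supp.
  + rewrite /el opprB addrCA; apply: (proj2 subU) => //.
  + by move=> q /hy; apply: el_homog.
- move=> w wV'; have [w0 w0V e] := memV' w wV'; split.
    by move: wV'; rewrite (perm_mem pV) mem_filter => /andP[].
  by have [_ [q hq]] := hV w0 w0V; exists q; rewrite e; apply: el_homog.
Qed.

Section Output.
Variables (E : seq 'I_s) (V : seq 'rV[A]_s).
Hypothesis hEV : outputs step final (hgsq_init U) (E, V).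

Let inv : hgsq_inv E V.
Proof.
case: hEV => h _.
apply: (reach_invariant (P := fun st => hgsq_inv st.1 st.2) _ h); last exact: hgsq_inv_init.
exact: hgsq_inv_step.
Qed.

Local Notation f := (tnth (in_tuple E)).
Local Notation B := (basis_mx A E).
Local Notation X := (stage1 b E V).

Lemma colsub_basis (y : 'rV[A]_(size E)) : colsub f (y *m B) = y.
Proof.
have f_inj : injective f by apply/tuple_uniqP; exact: (hq_uniq inv).
have -> : colsub f (y *m B) = y *m colsub f B.
  by apply/rowP => k; rewrite !mxE; apply: eq_bigr => l _; rewrite !mxE.
have -> : colsub f B = 1%:M.
  by apply/matrixP => k l; rewrite !mxE eqxx /= (inj_eq f_inj) eq_sym; case: eqP.
exact: mulmx1.
Qed.

Lemma basis_supp (y : 'rV[A]_(size E)) i : i \notin E -> (y *m B) 0 i = 0.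
Proof.
move=> iE; rewrite mxE big1 // => k _; rewrite !mxE eqxx /=.
by case: eqP => [e|_]; rewrite ?mulr0 //; rewrite e mem_tnth in iE.
Qed.

Lemma basis_colsub (x : 'rV[A]_s) : (forall i, i \notin E -> x 0 i = 0) ->
  colsub f x *m B = x.
Proof.
move=> hx; rewrite -[RHS]mulmx1 [RHS](colsub_mul _ (hq_uniq inv) hx).
congr (_ *m _); apply/matrixP => k l; rewrite !mxE eqxx /= eq_sym; by case: eqP.
Qed.

Lemma basis_homog q (x : 'rV[A]_(size E)) : homogL a wt (@dg _ _ X) q x -> homogb q (x *m B).
Proof.
move=> hx; apply: (homogL_mulmx pbwA gradA hx) => l; rewrite rowK.
exact: homogL_delta.
Qed.

Lemma colsub_homog q (x : 'rV[A]_s) : homogb q x -> homogL a wt (@dg _ _ X) q (colsub f x).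
Proof.
move=> hx; apply: homogL_row => // k; rewrite !mxE => x0.
have [le h] := homogL_entry pbwA hx x0; eexists; first exact: h.
by rewrite /= subnK.
Qed.

Lemma stage1_span y : Defs.span (gens X) y <-> Defs.span U (y *m B).
Proof.
split=> [|h].
  apply: (span_min (N := fun y => Defs.span U (y *m B))) => [|_ /mapP[v vV ->]].
    have [U0 UD] := submodule_span U; split=> [|g y1 y2 h1 h2]; first by rewrite mul0mx.
    by rewrite mulmxDl -scalemxAl; apply: UD.
  by have [sv supv] := hq_supp inv vV; rewrite basis_colsub.
rewrite -(colsub_basis y).
apply: (span_min (N := fun x => Defs.span (gens X) (colsub f x)) (U := V)).
- have [X0 XD] := submodule_span (gens X); split=> [|g y1 y2 h1 h2].
    by rewrite (_ : colsub f 0 = 0) //; apply/rowP => k; rewrite !mxE.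
  rewrite (_ : colsub f (g *: y1 + y2) = g *: colsub f y1 + colsub f y2); first exact: XD.
  by apply/rowP => k; rewrite !mxE.
- by move=> v vV; apply: span_mem; apply: map_f.
- by apply: (hq_span inv) => // i; apply: basis_supp.
Qed.

Lemma stage1_nz x : x \in gens X -> nz_homog a wt (@dg _ _ X) x.
Proof.
case/mapP=> v vV ->; have [v0 [q hq]] := hq_homog inv vV.
have [_ supv] := hq_supp inv vV; split; last by exists q; apply: colsub_homog.
by apply: contraNneq v0 => e; rewrite -(basis_colsub supv) e mul0mx.
Qed.

Lemma stage1_eps x k : x \in gens X -> eps a (x 0 k) = 0.
Proof.
case/mapP=> v vV ->; have [v0 [q hq]] := hq_homog inv vV; rewrite mxE.
case: (eqVneq (v 0 (f k)) 0) => [->|vk]; first exact: eps0.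
have [le h] := homogL_entry pbwA hq vk.
apply: (homogA_eps pbwA gradA h); case: hEV => _; apply=> //=; exact: mem_tnth.
Qed.

Lemma stage1_span_eps x k : Defs.span (gens X) x -> eps a (x 0 k) = 0.
Proof.
apply: (span_min (N := fun x => eps a (x 0 k) = 0)) => [|y /stage1_eps]; last exact.
split=> [|g y z hy hz]; first by rewrite mxE eps0.
by rewrite !mxE epsD // (epsM pbwA gradA) hy hz mulr0 addr0.
Qed.

Lemma coset0P (W : seq 'rV[A]_s) x : coset W x = 0 <-> Defs.span W x.
Proof. by rewrite -[0](linear0 (coset W)) coset_eq subr0. Qed.

Lemma phi0E x : phi0 U E x = coset U (x *m B). Proof. by []. Qed.

Lemma phi0_ker x : phi0 U E x = 0 <-> Defs.span (gens X) x.
Proof. by rewrite phi0E coset0P stage1_span. Qed.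

Lemma coset_reduce x : exists y, coset U x = coset U (y *m B) /\
  forall q, homogb q x -> homogL a wt (@dg _ _ X) q y.
Proof.
have [y [supy sy hy]] := hq_reduce inv x; exists (colsub f y); split.
  by apply/coset_eq; rewrite basis_colsub.
by move=> q /hy; apply: colsub_homog.
Qed.

Lemma phi0_surj m : exists x, phi0 U E x = m.
Proof. by have [y [e _]] := coset_reduce (repr m); exists y; rewrite phi0E -e cosetK. Qed.

Lemma coset_sum (J : {set 'I_(size E)}) (c : 'I_(size E) -> A) :
  \sum_(k in J) c k *: coset U (delta_mx 0 (f k)) =
  coset U ((\row_k if k \in J then c k else 0) *m B).
Proof.
rewrite mulmx_sum_row linear_sum big_mkcond /=; apply: eq_bigr => k _.
rewrite rowK mxE linearZ /=; case: ifP => // _; by rewrite scale0r.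
Qed.

Lemma stage1_minimal : minimal_generators (fun=> True)
  (fun q => coset U (delta_mx 0 (f q))).
Proof.
split=> [m|J /properP[_ [k0 _ k0J]] h].
  split=> // _; have [x <-] := phi0_surj m; exists (fun k => x 0 k).
  rewrite coset_sum phi0E; congr (coset U (_ *m _)).
  by apply/rowP => k; rewrite mxE inE.
have [c] := h (coset U (delta_mx 0 (f k0))) I; rewrite coset_sum => /coset_eq.
(* Otherwise the unit vector at [k0] minus a vector vanishing at [k0] would lie in the span of the
   generators, whose entries have no constant term. *)
set r := \row_k _; have -> : delta_mx 0 (f k0) = (delta_mx 0 k0 : 'rV[A]_(size E)) *m B by rewrite -rowE rowK.
rewrite -mulmxBl => /stage1_span /(stage1_span_eps k0).
rewrite !mxE (negPf k0J) !eqxx subr0 eps1 // => /eqP; by rewrite oner_eq0.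
Qed.

Lemma stage1_iso : exists th : {linear quotm (gens X) -> quotm U}, bijective th /\
  forall q m, qhomog a wt (@dg _ _ X) q m <-> qhomog a wt b q (th m).
Proof.
(* Defined on representatives: [stage1_span] gives independence of the choice as well as
   injectivity. *)
pose t (m : quotm (gens X)) : quotm U := coset U (repr m *m B).
have tE x : t (coset (gens X) x) = coset U (x *m B).
  apply/coset_eq; rewrite -mulmxBl; apply/stage1_span/coset_eq; exact: cosetK.
have t_linear : linear t.
  move=> g m1 m2; rewrite -[m1]cosetK -[m2]cosetK -linearZ -linearD tE !tE.
  by rewrite mulmxDl -scalemxAl linearD linearZ.
pose th : {linear quotm (gens X) -> quotm U} :=
  HB.pack t (GRing.isLinear.Build A (quotm (gens X)) (quotm U) _ t t_linear).
have t_inj : injective t.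
  move=> m1 m2; rewrite -[m1]cosetK -[m2]cosetK !tE => /coset_eq.
  by rewrite -mulmxBl => /stage1_span/coset_eq.
have t_surj m : exists m', t m' = m.
  by have [x <-] := phi0_surj m; exists (coset (gens X) x); rewrite tE.
exists th; split.
  pose g m := proj1_sig (constructive_indefinite_description _ (t_surj m)).
  have gP m : t (g m) = m by exact: (proj2_sig (constructive_indefinite_description _ (t_surj m))).
  by exists g => m; [apply: t_inj; rewrite gP|apply: gP].
move=> q m; split=> [[x hx <-]|[x hx ex]].
  by exists (x *m B); [apply: basis_homog|rewrite /= tE].
have [y [e hy]] := coset_reduce x; exists y; first exact: hy.
by apply: t_inj; rewrite tE -e ex.
Qed.

Lemma procedure1_correct : procedure1_claim a wt b U E V.
Proof.
split.
- exact: (hq_uniq inv).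
- by move=> v /(hq_supp inv).
- exact: stage1_nz.
- exact: stage1_iso.
- by split; [exact: stage1_minimal|split; [exact: phi0_surj|exact: phi0_ker]].
Qed.
End Output.
End Minhgsq.

(** * The resolution *)

Section Resolution.
Variables (K : fieldType) (n : nat) (A : algType K) (a : 'I_n -> A).
Variable lt : rel 'X_{1..n}.
Hypothesis solvA : solvable_polynomial_algebra a lt.
Variable wt : 'I_n -> nat.
Hypothesis gradA : graded_algebra a wt.

Let pbwA : pbw_basis a. Proof. by case: solvA. Qed.

Lemma left_monomial_ordering_exists s :
  exists lte, left_monomial_ordering a lt (s := s) lte.
Proof.
(* The position-over-term ordering. *)
pose lte (u w : 'X_{1..n} * 'I_s) := (u.2 < w.2)%N || (u.2 == w.2) && lt u.1 w.1.
have [irr tr tot] := lt_strict_total solvA.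
exists lte; apply: (left_monomial_orderingI solvA).
- split.
  + by move=> u; rewrite /lte ltnn eqxx irr.
  + move=> v u w; rewrite /lte => /orP[h1|/andP[/eqP e1 h1]] /orP[h2|/andP[/eqP e2 h2]].
    * by rewrite (ltn_trans h1 h2).
    * by rewrite -e2 h1.
    * by rewrite e1 h2.
    * by rewrite e1 e2 eqxx (tr _ _ _ h1 h2) orbT.
  + move=> [al i] [be j] ne; rewrite /lte /=; case: (ltngtP i j) => //= ij.
      by rewrite orbT.
    have {ij} ij : i = j by apply: val_inj.
    by subst j; rewrite eqxx; apply: tot; apply: contraNneq ne => ->.
- by move=> al be i h; rewrite /lte /= eqxx h orbT.
- move=> ga u w; rewrite /lte /= => /orP[->//|/andP[-> h]].
  by rewrite (lt_addl solvA) ?orbT.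
Qed.

(** The second clause says that the generators lie in A_+ L. A round passes it on to the syzygies it
    finds, and it makes the differential of that round vanish under [eps]. *)
Definition stage_good (X : stage A) : Prop := forall x, x \in gens X ->
  nz_homog a wt (@dg _ _ X) x /\ forall k, eps a (x 0 k) = 0.

Lemma minimal_generators_ext s (N N' : 'rV[A]_s -> Prop) k (g g' : 'I_k -> 'rV[A]_s) :
  (forall x, N x <-> N' x) -> (forall i, g i = g' i) ->
  minimal_generators N g -> minimal_generators N' g'.
Proof.
move=> hN hg.
have hl J x : lspan g J x <-> lspan g' J x.
  by split=> -[c ->]; exists c; apply: eq_bigr => i _; rewrite hg.
case=> h1 h2; split=> [x|J hJ h]; first by rewrite -hN h1 hl.
by apply: (h2 J hJ) => x /hN /h /hl.
Qed.

Definition linked (X Y : stage A) (F : 'M[A]_(rk Y, rk X)) : Prop :=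
  [/\ forall x, Defs.span (gens X) x <-> exists y, y *m F = x,
      forall x, x *m F = 0 <-> Defs.span (gens Y) x,
      minimal_generators (Defs.span (gens X)) (fun k => delta_mx 0 k *m F),
      epsmx a F = 0 &
      forall q x, homogL a wt (@dg _ _ Y) q x -> homogL a wt (@dg _ _ X) q (x *m F)].

Section OneRound.
Variables (X : stage A) (lte : rel ('X_{1..n} * 'I_(rk X))) (U : seq 'rV[A]_(rk X)).
Hypothesis goodX : stage_good X.
Hypothesis lteP : left_monomial_ordering a lt lte.
Hypothesis pU : perm_eq U (gens X).
Let step := hgs_step a wt (@dg _ _ X) lte (U := U).

Let hU x : x \in U -> nz_homog a wt (@dg _ _ X) x.
Proof. by rewrite (perm_mem pU) => /goodX[]. Qed.
Let NU x : Defs.span (gens X) x <-> Defs.span U x.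
Proof. by apply: span_eq_mem => y; rewrite (perm_mem pU). Qed.

Lemma round_correct o : outputs step (@hgs_final K A _ U) (hgs_init U) o ->
  [/\ procedure2_claim a wt lte o,
      exists Q, division_matrix a lte (o := o) Q
    & forall Q, division_matrix a lte (o := o) Q ->
        procedure3_claim a wt lte Q /\ procedure4_claim a lte Q].
Proof.
move=> ho; have hD := division_matrix_exists solvA gradA lteP hU ho.
split=> //.
  have [Q hQ] := hD; split.
  - exact: (Umin_minimal solvA gradA lteP hU ho NU hQ).
  - by move=> k; have [_ h] := Umin_homog solvA hU k; eexists; exact: h.
  - exact: (output_groebner solvA gradA lteP hU ho NU).
  - exact: (output_V solvA gradA lteP hU ho).
  - by move=> ij /(output_pair solvA gradA lteP hU ho)[].
move=> Q hQ; have hs := syzygy_gens_span solvA gradA lteP hU ho hQ.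
split; first split.
- exact: (Q_mul hQ).
- exact: (syzygy_gens_homog solvA gradA lteP hU ho hQ).
- move=> x; rewrite -hs /syz mulmx_sum_row.
  by under [in X in _ <-> X]eq_bigr do rewrite rowK.
by split=> // x; apply: (Umin_image solvA gradA lteP hU ho NU hQ).
Qed.

Lemma round_linked o Q : outputs step (@hgs_final K A _ U) (hgs_init U) o ->
  division_matrix a lte (o := o) Q ->
  let Y := Stage (Umin_dgr a wt (@dg _ _ X) (o := o)) (syzygy_gens a lte Q) in
  stage_good Y /\ linked (X := X) (Y := Y) (Umin_mx o).
Proof.
move=> ho hQ Y; split.
  move=> x hx; split; first exact: (syzygy_gens_homog solvA gradA lteP hU ho hQ).
  by move=> k; apply: (syzygy_gens_eps solvA gradA lteP hU ho hQ).
split.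
- move=> x; exact: (Umin_image solvA gradA lteP hU ho NU hQ).
- move=> x; exact: (syzygy_gens_span solvA gradA lteP hU ho hQ).
- apply: (minimal_generators_ext (N := Defs.span (gens X)) (g := Umin (o := o))) => //.
    by move=> k; rewrite -rowE rowK.
  exact: (Umin_minimal solvA gradA lteP hU ho NU hQ).
- apply/matrixP => k i; rewrite !mxE.
  have : Umin k \in gens X by rewrite -(perm_mem pU); apply: mem_nth.
  by move/goodX => [_ ->].
- move=> q x hx; apply: (homogL_mulmx pbwA gradA hx) => k; rewrite rowK.
  by case: (Umin_homog solvA hU k).
Qed.
End OneRound.

Lemma round_good X Y (F : 'M[A]_(rk Y, rk X)) : stage_good X -> round a wt lt F ->
  stage_good Y /\ linked F.
Proof.
move=> gX h; case: h => lte U o Q lteP pU _ ho hQ.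
exact: (round_linked gX lteP pU ho hQ).
Qed.

Lemma round_exists X : stage_good X ->
  exists Y (F : 'M[A]_(rk Y, rk X)), round a wt lt F.
Proof.
move=> gX; have [lte lteP] := left_monomial_ordering_exists (rk X).
pose leT := relpre (dgr a wt (@dg _ _ X)) leq.
have pU : perm_eq (sort leT (gens X)) (gens X) by rewrite perm_sort.
have sU : sorted leT (sort leT (gens X)) by apply: sort_sorted => x y; apply: leq_total.
have hU x : x \in sort leT (gens X) -> nz_homog a wt (@dg _ _ X) x.
  by rewrite mem_sort => /gX[].
have [o ho] := terminates_output (hgs_terminates solvA wt (@dg _ _ X) lteP (sort leT (gens X))).
have [Q hQ] := division_matrix_exists solvA gradA lteP hU ho.
by eexists; eexists; apply: (Round lteP pU sU ho hQ).
Qed.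

Lemma reachable_good X Y : stage_good X -> reachable a wt lt X Y -> stage_good Y.
Proof.
move=> gX; elim=> {Y} [//|Y Z F _ gY _ h].
by case: (round_good gY h).
Qed.

Lemma procedures234_correct X : stage_good X -> procedures234_claim a wt lt X.
Proof.
move=> gX; split; first exact: left_monomial_ordering_exists.
move=> lte U lteP pU _ /=; split.
  exact: (hgs_terminates solvA wt (@dg _ _ X) lteP U).
by move=> o; apply: (round_correct gX lteP pU).
Qed.

Lemma ord_absurd r (k : 'I_r) : r = 0%N -> False.
Proof. by move=> r0; case: k => k; rewrite r0 ltn0. Qed.

Lemma rV0_eq0 r (y : 'rV[A]_r) : r = 0%N -> y = 0.
Proof. by move=> r0; apply/rowP => k; case: (ord_absurd k r0). Qed.

Lemma span_nil s (x : 'rV[A]_s) : Defs.span [::] x <-> x = 0.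
Proof.
split=> [/spanP[q <-]|->]; first by rewrite (@rV0_eq0 _ q erefl) mul0mx.
by case: (submodule_span ([::] : seq 'rV[A]_s)).
Qed.

Lemma linked_nil X Y (F : 'M[A]_(rk Y, rk X)) : gens X = [::] -> rk Y = 0%N ->
  gens Y = [::] -> linked F.
Proof.
move=> gX rY gY; rewrite /linked gX gY.
have mul0 (y : 'rV[A]_(rk Y)) : y *m F = 0 by rewrite (rV0_eq0 y rY) mul0mx.
split.
- move=> x; rewrite span_nil; split=> [->|[y <-]]; last exact: mul0.
  by exists 0; rewrite mul0mx.
- by move=> x; rewrite span_nil mul0; split=> // _; apply: rV0_eq0.
- split=> [x|J /properP[_ [k]]]; last by case: (ord_absurd k rY).
  rewrite span_nil; split=> [->|[c ->]].
    by exists (fun=> 0); rewrite big1 // => k _; rewrite scale0r.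
  by rewrite big1 // => k _; rewrite mul0 scaler0.
- by apply/matrixP => k; case: (ord_absurd k rY).
- by move=> q x _; rewrite mul0 homogL0.
Qed.

Definition next_stage (X Y : stage A) (F : 'M[A]_(rk Y, rk X)) : Prop :=
  if gens X is [::] then rk Y = 0%N /\ gens Y = [::] else round a wt lt F.

Lemma next_good X Y (F : 'M[A]_(rk Y, rk X)) : stage_good X -> next_stage F ->
  stage_good Y /\ linked F.
Proof.
move=> gX; rewrite /next_stage; case E: (gens X) => [|x r]; last exact: round_good.
case=> rY gY; split; last exact: linked_nil.
by move=> x; rewrite gY.
Qed.

Lemma next_exists X : stage_good X -> exists Y (F : 'M[A]_(rk Y, rk X)), next_stage F.
Proof.
move=> gX; rewrite /next_stage; case E: (gens X) => [|x r]; last exact: round_exists.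
by exists (@Stage K A 0 (fun=> 0%N) [::]), 0.
Qed.

Lemma run_exists X0 : stage_good X0 -> exists (Xs : nat -> stage A)
  (F : forall i, 'M[A]_(rk (stage_seq X0 Xs i.+1), rk (stage_seq X0 Xs i))),
  run a wt lt F.
Proof.
move=> g0.
(* Stages are chosen together with the proof that they are good, which the next round requires. *)
have ex (X : {X | stage_good X}) : exists Y : {X | stage_good X},
    exists F : 'M[A]_(rk (proj1_sig Y), rk (proj1_sig X)), next_stage F.
  case: X => X gX /=; have [Y [F h]] := next_exists gX.
  have [gY _] := next_good gX h.
  by exists (exist _ Y gY), F.
pose nxt X := proj1_sig (constructive_indefinite_description _ (ex X)).
have nxP X : exists F : 'M[A]_(rk (proj1_sig (nxt X)), rk (proj1_sig X)), next_stage F.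
  exact: (proj2_sig (constructive_indefinite_description _ (ex X))).
pose st i := iter i nxt (exist _ X0 g0).
exists (fun i => proj1_sig (st i.+1)).
have exF i : exists F : 'M[A]_(rk (stage_seq X0 (fun i => proj1_sig (st i.+1)) i.+1),
    rk (stage_seq X0 (fun i => proj1_sig (st i.+1)) i)), next_stage F.
  by case: i => [|i]; [apply: (nxP (st 0%N))|apply: (nxP (st i.+1))].
exists (fun i => proj1_sig (constructive_indefinite_description _ (exF i))) => i.
exact: (proj2_sig (constructive_indefinite_description _ (exF i))).
Qed.

Lemma good_pd_le X : stage_good X -> pd_le n (Defs.span (gens X)).
Proof.
(* [pd_le_groebner] requires a variable. Without variables the only monomial is 1, a generator
   without constant term is 0, and so there is none. *)
move=> gX; case: (posnP n) => [n0|npos].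
  suff g0 : gens X = [::] by rewrite g0 n0 => x /span_nil.
  case E: (gens X) => [//|g r]; have [|[gn0 _] he] := gX g; first by rewrite E mem_head.
  have [u] := neq0_cf pbwA gn0; rewrite /cf (_ : u.1 = 0%MM).
    by rewrite -/(eps a _) he eqxx.
  by apply/mnmP => i; case: (ord_absurd i n0).
have [lte lteP] := left_monomial_ordering_exists (rk X).
have hU x : x \in gens X -> nz_homog a wt (@dg _ _ X) x by move/gX => [].
(* Algorithm-MINHGS itself supplies the Groebner basis from which the second resolution starts. *)
have [o ho] := terminates_output (hgs_terminates solvA wt (@dg _ _ X) lteP (gens X)).
have gb := output_groebner solvA gradA lteP hU ho (fun x => iff_refl _).
rewrite -(prednK npos); apply: (pd_le_groebner solvA (j := 0%N)) lteP _ gb _ => //.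
- by rewrite add0n prednK.
- exact: submodule_span.
Qed.

Section Run.
Variables (X : nat -> stage A) (F : forall i, 'M[A]_(rk (X i.+1), rk (X i))).
Hypotheses (good0 : stage_good (X 0%N)) (hrun : run a wt lt F).

Lemma run_good i : stage_good (X i).
Proof. by elim: i => // i IH; case: (next_good IH (hrun i)). Qed.

Lemma run_linked i : linked (F i).
Proof. by case: (next_good (@run_good i) (hrun i)). Qed.

Lemma run_exact i (x : 'rV_(rk (X i.+1))) :
  x *m F i = 0 <-> exists y : 'rV_(rk (X i.+2)), y *m F i.+1 = x.
Proof.
have [_ -> _ _ _] := run_linked i.
by have [-> _ _ _ _] := run_linked i.+1.
Qed.

(** Both resolutions cover the same submodule of the same L_0, so the comparison starts from
    identity matrices and the zero homotopy. The index is n + 1 because index 0 belongs to L_0,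
    while [pd_le n] counts the modules resolving N. *)
Lemma run_rank : rk (X n.+1) = 0%N.
Proof.
have [im0 _ _ _ _] := run_linked 0%N.
apply: (minimal_rank_pd pbwA gradA (r := fun i => rk (X i)) run_exact
  (alpha := 1%:M) (beta := 1%:M) (h := 0) _ (good_pd_le good0)).
- by move=> i; case: (run_linked i).
- by move=> y; rewrite mulmx1; apply/im0; exists y.
- by move=> x /im0[y <-]; exists y; rewrite mulmx1.
- by rewrite mulmx1 subrr mul0mx subrr mulmx0.
Qed.

(** A module of rank 0 at index n + 1 maps onto the span of [gens (X n)], whose members are nonzero,
    so there are none; from then on [run] keeps the list empty. *)
Lemma run_stop i : (n <= i)%N -> gens (X i) = [::].
Proof.
elim: i => [|i IH].
  rewrite leqn0 => /eqP n0; have := run_rank; rewrite n0 => r1.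
  have [im0 _ _ _ _] := run_linked 0%N.
  case E: (gens (X 0%N)) => [//|g r].
  have gX : g \in gens (X 0%N) by rewrite E mem_head.
  have [y ey] := proj1 (im0 g) (span_mem gX).
  by have [[]] := good0 gX; rewrite -ey (rV0_eq0 y r1) mul0mx eqxx.
rewrite leq_eqVlt => /orP[/eqP ni|/IH gi]; last by have := hrun i; rewrite gi => -[].
have := run_rank; rewrite ni => r1.
have [imi _ _ _ _] := run_linked i.+1.
case E: (gens (X i.+1)) => [//|g r].
have gX : g \in gens (X i.+1) by rewrite E mem_head.
have [y ey] := proj1 (imi g) (span_mem gX).
by have [[]] := run_good gX; rewrite -ey (rV0_eq0 y r1) mul0mx eqxx.
Qed.

Lemma run_length : res_length (fun i => rk (X i)) n.
Proof.
case=> // i; rewrite ltnS => ni.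
by have := hrun i; rewrite run_stop // => -[].
Qed.
End Run.
End Resolution.

Theorem theorem4p4p1 (K : fieldType) (n : nat) (A : algType K)
    (a : 'I_n -> A) (lt : rel 'X_{1..n}) (wt : 'I_n -> nat)
    (solvA : solvable_polynomial_algebra a lt) (gradA : graded_algebra a wt)
    (s : nat) (b : 'I_s -> nat) (U : seq 'rV[A]_s)
    (homU : forall x, x \in U -> nz_homog a wt b x) :
  (* M = L_0 / N is [quotm U], graded by [qhomog a wt b]. *)
  (exists (r : nat -> nat) (e : forall i, 'I_(r i) -> nat)
          (f0 : {linear 'rV[A]_(r 0%N) -> quotm U})
          (f : forall i, {linear 'rV[A]_(r i.+1) -> 'rV[A]_(r i)}),
     minimal_graded_resolution a wt (qhomog a wt b (U := U)) e f0 f /\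
     exists2 d, (d <= n)%N & res_length r d)
  /\
  (* Procedure 1 *)
  terminates (@hgsq_step K A s) (@hgsq_final K A s) (hgsq_init U)
  /\
  forall (E : seq 'I_s) (V : seq 'rV[A]_s),
    outputs (@hgsq_step K A s) (@hgsq_final K A s) (hgsq_init U) (E, V) ->
    [/\ procedure1_claim a wt b U E V,
        (* Procedures 2-4, at every stage of the iteration *)
        forall X : stage A,
          reachable a wt lt (stage1 b E V) X -> gens X <> [::] ->
          procedures234_claim a wt lt X,
        (* the iteration can be carried out *)
        exists (Xs : nat -> stage A)
          (F : forall i, 'M[A]_(rk (stage_seq (stage1 b E V) Xs i.+1),
                                rk (stage_seq (stage1 b E V) Xs i))),
          run a wt lt F
      & (* however it is carried out, it stops after d <= n rounds, with a
           minimal graded free resolution of M *)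
        forall (Xs : nat -> stage A),
        let X := stage_seq (stage1 b E V) Xs in
        forall F : (forall i, 'M[A]_(rk (X i.+1), rk (X i))),
          run a wt lt F ->
          minimal_graded_resolution a wt (qhomog a wt b (U := U))
            (r := fun i => rk (X i)) (fun i => @dg K A (X i)) (phi0 U E)
            (fun i => mulmxr (F i)) /\
          exists d, [/\ (d <= n)%N, gens (X d) = [::]
                      & res_length (fun i => rk (X i)) d] ].
Proof.
have pbwA : pbw_basis a by case: solvA.
have good1 E V : outputs (@hgsq_step K A s) (@hgsq_final K A s) (hgsq_init U) (E, V) ->
    stage_good a wt (stage1 b E V).
  move=> h x hx; split; first exact: (stage1_nz pbwA gradA homU h hx).
  by move=> k; apply: (stage1_eps pbwA gradA homU h).
have main E V : outputs (@hgsq_step K A s) (@hgsq_final K A s) (hgsq_init U) (E, V) ->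
    forall Xs : nat -> stage A, let X := stage_seq (stage1 b E V) Xs in
    forall F : (forall i, 'M[A]_(rk (X i.+1), rk (X i))), run a wt lt F ->
    minimal_graded_resolution a wt (qhomog a wt b (U := U))
      (r := fun i => rk (X i)) (fun i => @dg K A (X i)) (phi0 U E)
      (fun i => mulmxr (F i)) /\
    exists d, [/\ (d <= n)%N, gens (X d) = [::] & res_length (fun i => rk (X i)) d].
  move=> h Xs X F hrun; have g0 := good1 E V h.
  have hl := run_linked solvA gradA (X := X) g0 hrun.
  have hex := run_exact solvA gradA (X := X) g0 hrun.
  have [im0 _ min0 _ _] := hl 0%N.
  have ker0 x := phi0_ker pbwA gradA homU h x.
  split; last first.
    (* No generator is left from index n on, so d = n serves for every run. *)
    exists n; split=> //; first exact: (run_stop solvA gradA (X := X) g0 hrun).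
    exact: (run_length solvA gradA (X := X) g0 hrun).
  split; split.
  - exact: (phi0_surj pbwA gradA homU h).
  - by move=> x; rewrite ker0 im0.
  - by move=> i x; apply: hex.
  - move=> q x hx; exists (x *m basis_mx A E); last by [].
    exact: (basis_homog pbwA gradA hx).
  - by move=> i q x hx; case: (hl i) => _ _ _ _; apply.
  - apply: (_ : minimal_generators (fun=> True)
      (fun k : 'I_(size E) => coset U (delta_mx 0 k *m basis_mx A E))).
    have [h1 h2] := stage1_minimal pbwA gradA homU h.
    have e k : coset U (delta_mx 0 k *m basis_mx A E) =
        coset U (delta_mx 0 (tnth (in_tuple E) k)) by rewrite -rowE rowK.
    have hlE J m : lspan (fun k : 'I_(size E) => coset U (delta_mx 0 k *m basis_mx A E)) J m <->
        lspan (fun q => coset U (delta_mx 0 (tnth (in_tuple E) q))) J m.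
      by split=> -[c ->]; exists c; apply: eq_bigr => i _; rewrite e.
    split=> [m|J hJ hs]; first by rewrite hlE; apply: h1.
    by apply: (h2 J hJ) => m /hs /hlE.
  - by apply: minimal_generators_ext min0 => // x; rewrite ker0.
  - move=> i; have [_ _ mini _ _] := hl i.+1.
    apply: minimal_generators_ext mini => // x.
    by have [_ <- _ _ _] := hl i.
have term := hgsq_terminates U.
split; last first.
  split; first exact: term.
  move=> E V h; have g0 := good1 E V h; split.
  - exact: (procedure1_correct pbwA gradA homU h).
  - move=> X hX _; apply: procedures234_correct => //.
    exact: (reachable_good solvA gradA g0 hX).
  - exact: run_exists.
  - exact: main h.
have [[E V] h] := terminates_output term.
have [Xs [F hrun]] := run_exists solvA gradA (good1 E V h).
have [hres [d [dn _ hlen]]] := main E V h Xs F hrun.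
exists (fun i => rk (stage_seq (stage1 b E V) Xs i)),
  (fun i => @dg K A (stage_seq (stage1 b E V) Xs i)), (phi0 U E), (fun i => mulmxr (F i)).
by split=> //; exists d.
Qed.
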